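(* Let $\mathcal P$ be a locally trivial QPFB with differential structure $\Gamma(\mathcal P)$, and let $R\subset H$ be the right ideal corresponding to the right covariant differential calculus $\Gamma(H)$. Left (respectively right) connections on $\mathcal P$ are in one-to-one correspondence to left (respectively right) covariant derivatives with the following property: the corresponding linear maps $A_{l_i}$ (respectively $A_{r_i}$) fulfill $$R\subset\ker A_{l_i}\ \ \forall i\in I\qquad\text{(respectively } S^{-1}(R)\subset\ker A_{r_i}\ \ \forall i\in I).$$
   Context: All algebras are associative and unital over $\mathbb C$; ideals are two-sided unless specified; $H$ is a Hopf algebra over $\mathbb C$ with coproduct $\Delta$, counit $\varepsilon$ and invertible antipode $S$; $\Delta(h)=\sum h_1\otimes h_2$. A covering of an algebra $B$ is a finite family $(J_i)_{i\in I}$ of ideals with $\bigcap_i J_i=0$. Put $B_i=B/J_i$, $B_{ij}=B/(J_i+J_j)$, with canonical projections $\pi_i:B\to B_i$, $\pi^i_j:B_i\to B_{ij}$. The covering is complete if $b\mapsto (b+J_i)_{i\in I}$ maps $B$ onto $\{(b_i)_i\in\bigoplus_i B_i\mid \pi^i_j(b_i)=\pi^j_i(b_j)\ \forall i\ne j\}$. A locally trivial quantum principal fibre bundle (QPFB) is a tuple $(\mathcal P,\Delta_{\mathcal P},H,B,\iota,(\chi_i,J_i)_{i\in I})$ where $\mathcal P$ is a right $H$-comodule algebra with coaction $\Delta_{\mathcal P}$, $(J_i)_{i\in I}$ is a complete covering of $B$, $\chi_i:\mathcal P\to B_i\otimes H$ are surjective homomorphisms, $\iota:B\to\mathcal P$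 is an injective homomorphism, $(\mathrm{id}\otimes\Delta)\circ\chi_i=(\chi_i\otimes\mathrm{id})\circ\Delta_{\mathcal P}$, $\chi_i\circ\iota(a)=\pi_i(a)\otimes1$, $(\ker\chi_i)_{i\in I}$ is a complete covering of $\mathcal P$, and $\iota(B)=\{f\mid\Delta_{\mathcal P}(f)=f\otimes1\}$. There are isomorphisms $\phi_{ij}:B_{ij}\otimes H\to B_{ij}\otimes H$ determined by $(\pi^i_j\otimes\mathrm{id})\circ\chi_i=\phi_{ij}\circ(\pi^j_i\otimes\mathrm{id})\circ\chi_j$. A differential algebra over $B$ is an $\mathbb N$-graded algebra $\Gamma(B)=\bigoplus_n\Gamma^n(B)$ with $\Gamma^0(B)=B$ and a graded derivation $d$ of degree 1, $d^2=0$; it is a differential calculus if it is generated as an algebra by $B$ and $dB$. A differential ideal is a $d$-invariant graded ideal. $\Omega(B)$ is the universal differential calculus; each calculus is $\Omega(B)/J(B)$ for a unique differential ideal $J(B)$. An algebra homomorphism $\psi:A\to B$ always extends to a homomorphism of differential algebras $\psi_{\Omega\to\Gamma}:\Omega(A)\to\Gamma(B)$. $\Gamma(A)\hat\otimes\Gamma(B)$ is the vector space $\Gamma(A)\otimes\Gamma(B)$ with $(\gamma\hat\otimes\rho)(\omega\hat\otimes\tau)=(-1)^{mn}\gamma\omega\hat\otimes\rho\tau$ for $\omega\in\Gamma^n(A)$, $\rho\in\Gamma^m(B)$, and $d(\gamma\hat\otimes\rho)=d\gamma\hat\otimes\rho+(-1)^n\gamma\hat\otimes d\rho$ for $\gamma\in\Gamma^n(A)$.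 A calculus $\Gamma(H)$ is right covariant if $\Delta^\Gamma(h_0dh_1\cdots dh_n)=\Delta(h_0)\,(d\otimes\mathrm{id})\Delta(h_1)\cdots(d\otimes\mathrm{id})\Delta(h_n)$ is a well-defined right coaction $\Gamma(H)\to\Gamma(H)\otimes H$. The right ideal corresponding to $\Gamma(H)$ is $R=\{r\in\ker\varepsilon\mid\sum S^{-1}(r_2)dr_1=0\text{ in }\Gamma^1(H)\}$; the subbimodule $J^1(H)\subset\Omega^1(H)$ with $\Gamma^1(H)=\Omega^1(H)/J^1(H)$ is generated by $\{\sum S^{-1}(r_2)dr_1\mid r\in R\}$. A differential structure on $\mathcal P$ is the calculus $\Gamma(\mathcal P)=\Omega(\mathcal P)/\bigcap_i\ker\chi_{i_{\Omega\to\Gamma}}$ determined by calculi $\Gamma(B_i)$ over $B_i$ and a right covariant calculus $\Gamma(H)$, where $\chi_{i_{\Omega\to\Gamma}}:\Omega(\mathcal P)\to\Gamma(B_i)\hat\otimes\Gamma(H)$; $\chi_{i_\Gamma}:\Gamma(\mathcal P)\to\Gamma(B_i)\hat\otimes\Gamma(H)$ are the induced maps. Similarly $\Gamma(B)=\Omega(B)/\bigcap_i\ker\pi_{i_{\Omega\to\Gamma}}$ with induced $\pi_{i_\Gamma}:\Gamma(B)\to\Gamma(B_i)$. Put $\Gamma^i(B_{ij}\otimes H):=(\Gamma(B_i)\hat\otimes\Gamma(H))/\chi_{i_\Gamma}(\ker\chi_{j_\Gamma})$, a calculus over $B_{ij}\otimes H$, with quotient map $(\pi^i_j\otimes\mathrm{id})_\Gamma$;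 $\phi_{ij}$ extends to an isomorphism $\phi_{ij_\Gamma}:\Gamma^j(B_{ij}\otimes H)\to\Gamma^i(B_{ij}\otimes H)$. The covering completion of $\Gamma(\mathcal P)$ is $$\Gamma_c(\mathcal P)=\{(\gamma_i)_i\in\bigoplus_i\Gamma(B_i)\hat\otimes\Gamma(H)\mid(\pi^i_j\otimes\mathrm{id})_\Gamma(\gamma_i)=\phi_{ij_\Gamma}\circ(\pi^j_i\otimes\mathrm{id})_\Gamma(\gamma_j)\},$$ with $i$-th projections $\chi_{i_{\Gamma_c}}$ and right coaction $\Delta^{\Gamma_c}_{\mathcal P}((\gamma_i)_i)=((\mathrm{id}\otimes\Delta^\Gamma)(\gamma_i))_i$; its degree-zero part is identified with $\mathcal P$. The covering completion $\Gamma_c(B)$ of $\Gamma(B)$ consists of the $(\rho_i)_i\in\bigoplus_i\Gamma(B_i)$ such that $\rho_i,\rho_j$ have the same image in $\Gamma(B)/(\ker\pi_{i_\Gamma}+\ker\pi_{j_\Gamma})$; $\iota_{\Gamma_c}:\Gamma_c(B)\to\Gamma_c(\mathcal P)$, $(\rho_i)_i\mapsto(\rho_i\hat\otimes1)_i$. Horizontal forms: $\mathrm{hor}\,\Gamma_c(\mathcal P)=\{\gamma\in\Gamma_c(\mathcal P)\mid\chi_{i_{\Gamma_c}}(\gamma)\in\Gamma(B_i)\hat\otimes H\ \forall i\in I\}$. A left (right) covariant derivative is a linear map $D=D_l$ ($D=D_r$) from $\mathrm{hor}\,\Gamma_c(\mathcal P)$ to itself with: $D(\mathrm{hor}\,\Gamma^n_c(\mathcal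 P))\subset\mathrm{hor}\,\Gamma^{n+1}_c(\mathcal P)$; $D(1)=0$; in the left case $D_l(\iota_{\Gamma_c}(\gamma)\alpha)=(d\iota_{\Gamma_c}(\gamma))\alpha+(-1)^n\iota_{\Gamma_c}(\gamma)D_l(\alpha)$ for $\gamma\in\Gamma^n_c(B)$, $\alpha\in\mathrm{hor}\,\Gamma_c(\mathcal P)$; in the right case $D_r(\alpha\iota_{\Gamma_c}(\gamma))=D_r(\alpha)\iota_{\Gamma_c}(\gamma)+(-1)^n\alpha\,d\iota_{\Gamma_c}(\gamma)$ for $\gamma\in\Gamma_c(B)$, $\alpha\in\mathrm{hor}\,\Gamma^n_c(\mathcal P)$; $(D\otimes\mathrm{id})\circ\Delta^{\Gamma_c}_{\mathcal P}=\Delta^{\Gamma_c}_{\mathcal P}\circ D$; and $D(\ker\chi_{i_{\Gamma_c}}|_{\mathrm{hor}\,\Gamma_c(\mathcal P)})\subset\ker\chi_{i_{\Gamma_c}}|_{\mathrm{hor}\,\Gamma_c(\mathcal P)}$ for all $i\in I$. The linear maps corresponding to $D_{l,r}$ are $A_{{l,r}_i}:H\to\Gamma^1(B_i)$, $A_{{l,r}_i}(h)=-(\mathrm{id}\otimes\varepsilon)\circ D_{{l,r}_i}(1\otimes h)$, where $D_{{l,r}_i}$ is the linear map on $\Gamma(B_i)\hat\otimes H$ with $D_{{l,r}_i}\circ\chi_{i_{\Gamma_c}}=\chi_{i_{\Gamma_c}}\circ D_{l,r}$; they determine $D_{l,r}$. A left (right) connection is a surjective left (right) $\mathcal P$-module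 homomorphism $\mathrm{hor}_{l,r}:\Gamma^1_c(\mathcal P)\to\mathrm{hor}\,\Gamma^1_c(\mathcal P)$ with $\mathrm{hor}_{l,r}^2=\mathrm{hor}_{l,r}$, $(\mathrm{hor}_{l,r}\otimes\mathrm{id})\circ\Delta^{\Gamma_c}_{\mathcal P}=\Delta^{\Gamma_c}_{\mathcal P}\circ\mathrm{hor}_{l,r}$ and $\mathrm{hor}_{l,r}(\ker\chi_{i_{\Gamma_c}})\subset\ker\chi_{i_{\Gamma_c}}$ (in degree one) for all $i\in I$. *)

(* Defs.v *)
From HB Require Import structures.
From mathcomp Require Import all_boot all_order all_algebra sesquilinear.
From mathcomp Require Import all_classical reals complex.

Set Implicit Arguments.
Unset Strict Implicit.
Unset Printing Implicit Defensive.

Import GRing.Theory.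
Local Open Scope ring_scope.
Local Open Scope classical_set_scope.
Local Open Scope quotient_scope.

Section Tensor.
Variable K : fieldType.

Lemma linD (V W : lmodType K) (h : V -> W) : linear h -> {morph h : x y / x + y}.
Proof. by move=> hl x y; have := hl 1 x y; rewrite !scale1r. Qed.

Lemma lin0 (V W : lmodType K) (h : V -> W) : linear h -> h 0 = 0.
Proof. by move=> hl; apply: (addrI (h 0)); rewrite -linD // !addr0. Qed.

Lemma linZ (V W : lmodType K) (h : V -> W) a x : linear h -> h (a *: x) = a *: h x.
Proof. by move=> hl; have := hl a x 0; rewrite !addr0 lin0 // addr0. Qed.

Lemma lin_comp (U V W : lmodType K) (f : V -> W) (g : U -> V) :
  linear f -> linear g -> linear (fun x => f (g x)).
Proof. by move=> fl gl a x y; rewrite gl fl. Qed.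

Lemma lin_add (V W : lmodType K) (f g : V -> W) :
  linear f -> linear g -> linear (fun x => f x + g x).
Proof. by move=> fl gl a x y; rewrite fl gl scalerDr addrACA. Qed.

Lemma lin_of (V W : lmodType K) (f : {linear V -> W}) : linear f.
Proof. exact: linearP. Qed.

Section Def.
Variables U V : lmodType K.

Definition tequiv (s t : seq (U * V)) : bool :=
  `[< forall (W : lmodType K) (f : {bilinear U -> V -> W}),
      \sum_(p <- s) f p.1 p.2 = \sum_(p <- t) f p.1 p.2 >].

Lemma tequiv_refl : reflexive tequiv.
Proof. by move=> s; apply/asboolP. Qed.
Lemma tequiv_sym : symmetric tequiv.
Proof. by move=> s t; apply/asboolP/asboolP => h W f; rewrite h. Qed.
Lemma tequiv_trans : transitive tequiv.
Proof.
by move=> s t r /asboolP h1 /asboolP h2; apply/asboolP => W f; rewrite h1 h2.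
Qed.
Canonical tequiv_equiv := EquivRel tequiv tequiv_refl tequiv_sym tequiv_trans.

(* U (x) V : a list of pairs stands for the formal sum of the u (x) v, and    *)
(* formal sums are identified when no bilinear map on U x V separates them.   *)
Definition tens := {eq_quot tequiv}.
HB.instance Definition _ : EqQuotient _ tequiv tens := EqQuotient.on tens.
HB.instance Definition _ := Choice.on tens.

Definition tpure (u : U) (v : V) : tens := \pi_tens [:: (u, v)].

(* For bilinear f this does not depend on the representative: [tliftE].       *)
Definition tlift (W : lmodType K) (f : U -> V -> W) (x : tens) : W :=
  \sum_(p <- repr x) f p.1 p.2.

Definition bilin (W : lmodType K) (f : U -> V -> W) : Prop :=
  (forall v, linear (f^~ v)) /\ (forall u, linear (f u)).

Section Pack.
Variables (W : lmodType K) (f : U -> V -> W) (fB : bilin f).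
Definition bilin_fun (_ : bilin f) : U -> V -> W := f.
HB.instance Definition _ :=
  bilinear_isBilinear.Build K U V W *:%R *:%R (bilin_fun fB) (fB.1, fB.2).
Definition bilin_pack : {bilinear U -> V -> W} := bilin_fun fB.
End Pack.

Lemma tliftE (W : lmodType K) (f : U -> V -> W) s : bilin f ->
  tlift f (\pi_tens s) = \sum_(p <- s) f p.1 p.2.
Proof.
move=> fB; rewrite /tlift; case: piP => t /eqmodP /asboolP /= h.
by rewrite -(h W (bilin_pack fB)).
Qed.

Lemma tensP (x y : tens) :
  (forall (W : lmodType K) (f : U -> V -> W), bilin f ->
     tlift f x = tlift f y) -> x = y.
Proof.
move=> h; rewrite -[x]reprK -[y]reprK; apply/eqmodP/asboolP => W f.
by apply: (h W f); split => ? ? ? ?; rewrite ?linearPl ?linearPr.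
Qed.

Definition tadd (x y : tens) : tens := \pi_tens (repr x ++ repr y).
Definition topp (x : tens) : tens :=
  \pi_tens [seq (- p.1, p.2) | p <- repr x].
Definition tscale (a : K) (x : tens) : tens :=
  \pi_tens [seq (a *: p.1, p.2) | p <- repr x].

Section BilinTheory.
Variables (W : lmodType K) (f : U -> V -> W) (fB : bilin f).
Lemma bilinDl u u' v : f (u + u') v = f u v + f u' v.
Proof. by have := fB.1 v 1 u u'; rewrite !scale1r. Qed.
Lemma bilinDr u v v' : f u (v + v') = f u v + f u v'.
Proof. by have := fB.2 u 1 v v'; rewrite !scale1r. Qed.
Lemma bilin0l v : f 0 v = 0.
Proof. by apply: (addrI (f 0 v)); rewrite -bilinDl !addr0. Qed.
Lemma bilin0r u : f u 0 = 0.
Proof. by apply: (addrI (f u 0)); rewrite -bilinDr !addr0. Qed.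
Lemma bilinZl a u v : f (a *: u) v = a *: f u v.
Proof. by have := fB.1 v a u 0; rewrite !addr0 bilin0l addr0. Qed.
Lemma bilinZr a u v : f u (a *: v) = a *: f u v.
Proof. by have := fB.2 u a v 0; rewrite !addr0 bilin0r addr0. Qed.
Lemma bilinNl u v : f (- u) v = - f u v.
Proof. by rewrite -scaleN1r bilinZl scaleN1r. Qed.

Lemma tliftD x y : tlift f (tadd x y) = tlift f x + tlift f y.
Proof. by rewrite /tadd tliftE // big_cat. Qed.
Lemma tliftN x : tlift f (topp x) = - tlift f x.
Proof.
rewrite /topp tliftE // big_map /tlift -sumrN.
by apply: eq_bigr => p _; rewrite bilinNl.
Qed.
Lemma tliftZ a x : tlift f (tscale a x) = a *: tlift f x.
Proof.
rewrite /tscale tliftE // big_map /tlift scaler_sumr.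
by apply: eq_bigr => p _; rewrite bilinZl.
Qed.
Lemma tlift0 : tlift f (\pi_tens [::]) = 0.
Proof. by rewrite tliftE // big_nil. Qed.
Lemma tlift_pure u v : tlift f (tpure u v) = f u v.
Proof. by rewrite tliftE // big_seq1. Qed.
End BilinTheory.

Lemma taddA : associative tadd.
Proof. by move=> x y z; apply: tensP => W f fB; rewrite !tliftD // addrA. Qed.
Lemma taddC : commutative tadd.
Proof. by move=> x y; apply: tensP => W f fB; rewrite !tliftD // addrC. Qed.
Lemma tadd0 : left_id (\pi_tens [::] : tens) tadd.
Proof. by move=> x; apply: tensP => W f fB; rewrite tliftD // tlift0 ?add0r. Qed.
Lemma taddN : left_inverse (\pi_tens [::] : tens) topp tadd.
Proof.
by move=> x; apply: tensP => W f fB; rewrite tliftD // tlift0 ?tliftN ?addNr.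
Qed.
HB.instance Definition _ := GRing.isZmodule.Build tens taddA taddC tadd0 taddN.

Lemma tscaleA a b x : tscale a (tscale b x) = tscale (a * b) x.
Proof. by apply: tensP => W f fB; rewrite !tliftZ // scalerA. Qed.
Lemma tscale1 : left_id 1 tscale.
Proof. by move=> x; apply: tensP => W f fB; rewrite !tliftZ // scale1r. Qed.
Lemma tscaleDr : right_distributive tscale +%R.
Proof.
by move=> a x y; apply: tensP => W f fB; rewrite tliftZ ?tliftD ?tliftZ ?scalerDr.
Qed.
Lemma tscaleDl x : {morph tscale^~ x : a b / a + b}.
Proof.
by move=> a b; apply: tensP => W f fB; rewrite tliftZ ?tliftD ?tliftZ ?scalerDl.
Qed.
HB.instance Definition _ :=
  GRing.Zmodule_isLmodule.Build K tens tscaleA tscale1 tscaleDr tscaleDl.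

Lemma tlift_linear (W : lmodType K) (f : U -> V -> W) :
  bilin f -> linear (tlift f).
Proof. by move=> fB a x y; rewrite tliftD // tliftZ. Qed.

Lemma tpure_bilin : bilin tpure.
Proof.
by split=> [v a u u'|u a v v']; apply: tensP => W f fB;
  rewrite (tliftD fB) (tliftZ fB) !(tlift_pure fB)
    ?(bilinDl fB) ?(bilinZl fB) ?(bilinDr fB) ?(bilinZr fB).
Qed.

Lemma tpure_sum (x : tens) : x = \sum_(p <- repr x) tpure p.1 p.2.
Proof.
apply: tensP => W f fB; rewrite -[LHS]/(\sum_(p <- repr x) f p.1 p.2).
elim: (repr x) => [|p s IH]; first by rewrite !big_nil tlift0.
by rewrite !big_cons tliftD // tlift_pure // IH.
Qed.

Lemma tens_ind (P : tens -> Prop) : P 0 -> (forall x y, P x -> P y -> P (x + y)) ->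
  (forall u v, P (tpure u v)) -> forall x, P x.
Proof. by move=> P0 PD Pp x; rewrite (tpure_sum x); apply: big_ind. Qed.

Lemma tens_ext (W : lmodType K) (f g : tens -> W) : linear f -> linear g ->
  (forall u v, f (tpure u v) = g (tpure u v)) -> f =1 g.
Proof.
move=> fl gl fg; elim/tens_ind => [|x y hx hy|//].
  by rewrite !lin0.
by rewrite !linD // hx hy.
Qed.

End Def.

Section LinearMaps.
Variables U V W : lmodType K.

Lemma tlift_fam (Z : lmodType K) (F : Z -> U -> V -> W) (x : tens U V) :
  (forall u v, linear (fun z => F z u v)) -> linear (fun z => tlift (F z) x).
Proof.
move=> Fl a z z'; rewrite /tlift scaler_sumr -big_split.
by apply: eq_bigr => p _; apply: Fl.
Qed.

Lemma tpure_linl (v : V) : linear (fun u : U => tpure u v).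
Proof. by have [h _] := @tpure_bilin U V; exact: h. Qed.

Lemma tpure_linr (u : U) : linear (fun v : V => tpure u v).
Proof. by have [_ h] := @tpure_bilin U V; exact: h. Qed.

End LinearMaps.

Section Assoc.
Variables U V W : lmodType K.

Definition tassoc (x : tens (tens U V) W) : tens U (tens V W) :=
  tlift (fun y w => tlift (fun u v => tpure u (tpure v w)) y) x.
Definition tassocV (x : tens U (tens V W)) : tens (tens U V) W :=
  tlift (fun u y => tlift (fun v w => tpure (tpure u v) w) y) x.

Lemma tassoc_bilin1 (w : W) : bilin (fun (u : U) (v : V) => tpure u (tpure v w)).
Proof.
split=> [v|u]; first exact: tpure_linl.
by apply: lin_comp; [exact: tpure_linr|exact: tpure_linl].
Qed.
Lemma tassoc_bilin2 :
  bilin (fun (y : tens U V) (w : W) => tlift (fun u v => tpure u (tpure v w)) y).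
Proof.
split=> [w|y]; first by apply: tlift_linear; apply: tassoc_bilin1.
by apply: tlift_fam => u v; apply: lin_comp; exact: tpure_linr.
Qed.
Lemma tassocV_bilin1 (u : U) : bilin (fun (v : V) (w : W) => tpure (tpure u v) w).
Proof.
split=> [w|v]; last exact: tpure_linr.
exact: (lin_comp (f := fun x => tpure x w) (tpure_linl w) (tpure_linr u)).
Qed.
Lemma tassocV_bilin2 :
  bilin (fun (u : U) (y : tens V W) => tlift (fun v w => tpure (tpure u v) w) y).
Proof.
split=> [y|u]; last by apply: tlift_linear; apply: tassocV_bilin1.
apply: tlift_fam => v w.
exact: (lin_comp (f := fun x => tpure x w) (tpure_linl w) (tpure_linl v)).
Qed.

HB.instance Definition _ :=
  GRing.isLinear.Build K _ _ *:%R tassoc (tlift_linear tassoc_bilin2).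
HB.instance Definition _ :=
  GRing.isLinear.Build K _ _ *:%R tassocV (tlift_linear tassocV_bilin2).

Lemma tassocE (u : U) (v : V) (w : W) : tassoc (tpure (tpure u v) w) = tpure u (tpure v w).
Proof.
by rewrite /tassoc (tlift_pure tassoc_bilin2) (tlift_pure (tassoc_bilin1 w)).
Qed.
Lemma tassocVE (u : U) (v : V) (w : W) : tassocV (tpure u (tpure v w)) = tpure (tpure u v) w.
Proof.
by rewrite /tassocV (tlift_pure tassocV_bilin2) (tlift_pure (tassocV_bilin1 u)).
Qed.

End Assoc.

Section Map.
Variables U U' V V' : lmodType K.

Definition tmap (f : U -> U') (g : V -> V') (x : tens U V) : tens U' V' :=
  tlift (fun u v => tpure (f u) (g v)) x.

Lemma tmap_bilin (f : U -> U') (g : V -> V') : linear f -> linear g ->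
  bilin (fun u v => tpure (f u) (g v)).
Proof.
move=> fl gl; split=> [v|u].
  by apply: (lin_comp (f := fun a => tpure a _)) => //; exact: tpure_linl.
by apply: lin_comp => //; exact: tpure_linr.
Qed.

Lemma tmap_linear (f : U -> U') (g : V -> V') : linear f -> linear g ->
  linear (tmap f g).
Proof. by move=> fl gl; apply: tlift_linear; apply: tmap_bilin. Qed.

Lemma tmap_pure (f : U -> U') (g : V -> V') u v : linear f -> linear g ->
  tmap f g (tpure u v) = tpure (f u) (g v).
Proof.
by move=> fl gl; apply: (tlift_pure (f := fun u v => tpure (f u) (g v)));
  apply: tmap_bilin.
Qed.

HB.instance Definition _ (f : {linear U -> U'}) (g : {linear V -> V'}) :=
  GRing.isLinear.Build K _ _ *:%R (tmap f g) (tmap_linear (lin_of f) (lin_of g)).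

End Map.

Section Product.
Variables U V U' V' W : lmodType K.
Variable F : U -> V -> U' -> V' -> W.

Definition tlift2 (x : tens U V) (y : tens U' V') : W :=
  tlift (fun u v => tlift (F u v) y) x.

Hypothesis Fl : forall u v, bilin (F u v).
Hypothesis Fr : forall u' v', bilin (fun u v => F u v u' v').

Lemma tlift2_bilin y : bilin (fun u v => tlift (F u v) y).
Proof.
split=> [v|u].
  by apply: (tlift_fam (F := fun u => F u v)) => u' v'; case: (Fr u' v') => h _; exact: h.
by apply: (tlift_fam (F := F u)) => u' v'; case: (Fr u' v') => _ h; exact: h.
Qed.

Lemma tlift2_linl y : linear (tlift2^~ y).
Proof. by apply: tlift_linear; apply: tlift2_bilin. Qed.

Lemma tlift2_linr x : linear (tlift2 x).
Proof.
by apply: (tlift_fam (F := fun y u v => tlift (F u v) y)) => u v; apply: tlift_linear.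
Qed.

Lemma tlift2_pure u v u' v' : tlift2 (tpure u v) (tpure u' v') = F u v u' v'.
Proof.
rewrite /tlift2 (tlift_pure (f := fun u v => tlift (F u v) _)).
  by rewrite tlift_pure.
exact: tlift2_bilin.
Qed.

End Product.

End Tensor.

Notation "u \ot v" := (tpure u v) (at level 40, left associativity) : ring_scope.

(* Associative unital algebras in which 1 = 0 is allowed: [algType] excludes  *)
(* the zero algebra, but for instance B / (J_i + J_j) can be zero.            *)
Record uAlg (K : fieldType) := UAlg {
  ua_mod : lmodType K;
  ua_one : ua_mod;
  ua_mul : ua_mod -> ua_mod -> ua_mod;
  ua_mulA : associative ua_mul;
  ua_mul1 : left_id ua_one ua_mul;
  ua_mulr1 : right_id ua_one ua_mul;
  ua_linl : forall y, linear (ua_mul^~ y);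
  ua_linr : forall x, linear (ua_mul x)
}.

Definition ua_car (K : fieldType) (A : uAlg K) : Type := ua_mod A.
Coercion ua_car : uAlg >-> Sortclass.

Section AlgebraTheory.
Variables (K : fieldType) (A : uAlg K).

HB.instance Definition _ := GRing.Lmodule.on (ua_car A).

Lemma ua_mulDl : left_distributive (@ua_mul K A : A -> A -> A) +%R.
Proof. by move=> x y z; exact: (linD (@ua_linl K A z)). Qed.
Lemma ua_mulDr : right_distributive (@ua_mul K A : A -> A -> A) +%R.
Proof. by move=> x y z; exact: (linD (@ua_linr K A x)). Qed.
HB.instance Definition _ := GRing.Zmodule_isPzRing.Build (ua_car A)
  (@ua_mulA K A) (@ua_mul1 K A) (@ua_mulr1 K A) ua_mulDl ua_mulDr.

Lemma ua_scalerAl (a : K) (x y : A) : a *: x * y = a *: (x * y).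
Proof. exact: (linZ a x (@ua_linl K A y)). Qed.
Lemma ua_scalerAr (a : K) (x y : A) : x * (a *: y) = a *: (x * y).
Proof. exact: (linZ a y (@ua_linr K A x)). Qed.
Lemma mul_linl (y : A) : linear (fun x : A => x * y).
Proof. exact: ua_linl. Qed.
Lemma mul_linr (x : A) : linear (fun y : A => x * y).
Proof. exact: ua_linr. Qed.

End AlgebraTheory.

Record alghom (K : fieldType) (A B : uAlg K) := AlgHom {
  alghom_fun :> A -> B;
  alghom_linear : linear alghom_fun;
  alghom_monoid : monoid_morphism alghom_fun
}.

HB.instance Definition _ (K : fieldType) (A B : uAlg K) (f : alghom A B) :=
  GRing.isLinear.Build K A B *:%R (alghom_fun f) (alghom_linear f).
HB.instance Definition _ (K : fieldType) (A B : uAlg K) (f : alghom A B) :=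
  GRing.isMonoidMorphism.Build A B (alghom_fun f) (alghom_monoid f).

Section TensorAlgebra.
Variables (K : fieldType) (A B : uAlg K).

Definition tmulF (a : A) (b : B) (a' : A) (b' : B) := (a * a') \ot (b * b').
Definition tmul (x y : tens A B) : tens A B := tlift2 tmulF x y.

Lemma tmulF_bilinl a b : bilin (tmulF a b).
Proof. exact: (tmap_bilin (mul_linr a) (mul_linr b)). Qed.
Lemma tmulF_bilinr a' b' : bilin (fun a b => tmulF a b a' b').
Proof. exact: (tmap_bilin (mul_linl a') (mul_linl b')). Qed.
Lemma tmulE a b a' b' : tmul (a \ot b) (a' \ot b') = (a * a') \ot (b * b').
Proof. exact: (tlift2_pure tmulF_bilinl tmulF_bilinr). Qed.
Lemma tmul_linl y : linear (tmul^~ y).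
Proof. exact: (tlift2_linl tmulF_bilinr). Qed.
Lemma tmul_linr x : linear (tmul x).
Proof. exact: (tlift2_linr tmulF_bilinl). Qed.

Lemma tmulA : associative tmul.
Proof.
move=> x y z; elim/tens_ind: x => [|x x' hx hx'|a b].
- by rewrite !(lin0 (tmul_linl _)).
- by rewrite !(linD (tmul_linl _)) hx hx'.
elim/tens_ind: y => [|y y' hy hy'|a' b'].
- by rewrite !(lin0 (tmul_linl _), lin0 (tmul_linr _)).
- by rewrite !(linD (tmul_linl _), linD (tmul_linr _)) hy hy'.
elim/tens_ind: z => [|z z' hz hz'|a2 b2].
- by rewrite !(lin0 (tmul_linl _), lin0 (tmul_linr _)).
- by rewrite !(linD (tmul_linl _), linD (tmul_linr _)) hz hz'.
by rewrite !tmulE !mulrA.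
Qed.
Lemma tmul1 : left_id ((1 : A) \ot (1 : B)) tmul.
Proof.
apply: tens_ext => [|//|u v]; first exact: tmul_linr.
by rewrite tmulE !mul1r.
Qed.
Lemma tmulr1 : right_id ((1 : A) \ot (1 : B)) tmul.
Proof.
apply: tens_ext => [|//|u v]; first exact: tmul_linl.
by rewrite tmulE !mulr1.
Qed.

Definition talg : uAlg K := UAlg tmulA tmul1 tmulr1 tmul_linl tmul_linr.

Lemma talgE a b a' b' :
  (a \ot b : talg) * (a' \ot b') = (a * a') \ot (b * b').
Proof. exact: tmulE. Qed.

End TensorAlgebra.

Record ideal (K : fieldType) (A : uAlg K) := Ideal {
  ideal_set :> A -> Prop;
  ideal0 : ideal_set 0;
  idealD : forall x y, ideal_set x -> ideal_set y -> ideal_set (x + y);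
  idealMl : forall a x, ideal_set x -> ideal_set (a * x);
  idealMr : forall a x, ideal_set x -> ideal_set (x * a)
}.

Section Quotient.
Variables (K : fieldType) (A : uAlg K).

Lemma idealN (J : ideal A) x : J x -> J (- x).
Proof. by rewrite -mulN1r; apply: idealMl. Qed.
Lemma idealB (J : ideal A) x y : J x -> J y -> J (x - y).
Proof. by move=> Jx Jy; apply: idealD => //; apply: idealN. Qed.
Lemma idealZ (J : ideal A) (a : K) x : J x -> J (a *: x).
Proof. by rewrite -[x in a *: x]mul1r -ua_scalerAl; apply: idealMl. Qed.

Section Def.
Variable J : ideal A.

Definition qequiv (x y : A) : bool := `[< J (x - y) >].
Lemma qequiv_refl : reflexive qequiv.
Proof. by move=> x; apply/asboolP; rewrite subrr; apply: ideal0. Qed.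
Lemma qequiv_sym : symmetric qequiv.
Proof.
by move=> x y; apply/asboolP/asboolP => /idealN; rewrite opprB.
Qed.
Lemma qequiv_trans : transitive qequiv.
Proof.
move=> y x z /asboolP h1 /asboolP h2; apply/asboolP.
by have := idealD h1 h2; rewrite addrA subrK.
Qed.
Canonical qequiv_equiv := EquivRel qequiv qequiv_refl qequiv_sym qequiv_trans.

Definition quot := {eq_quot qequiv}.
HB.instance Definition _ : EqQuotient _ qequiv quot := EqQuotient.on quot.
HB.instance Definition _ := Choice.on quot.

Definition qpi (x : A) : quot := \pi_quot x.

Lemma qpiP x y : qpi x = qpi y <-> J (x - y).
Proof. by split=> [/eqmodP/asboolP|h]; last by apply/eqmodP/asboolP. Qed.
Lemma qpi_repr (x : quot) : qpi (repr x) = x.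
Proof. exact: reprK. Qed.
Lemma repr_qpi x : J (repr (qpi x) - x).
Proof. by apply/qpiP; rewrite qpi_repr. Qed.
Lemma quot_ind (P : quot -> Prop) : (forall x, P (qpi x)) -> forall x, P x.
Proof. by move=> h x; rewrite -(qpi_repr x). Qed.

Definition qadd (x y : quot) := qpi (repr x + repr y).
Definition qopp (x : quot) := qpi (- repr x).
Definition qscale (a : K) (x : quot) := qpi (a *: repr x).
Definition qmul (x y : quot) := qpi (repr x * repr y).

Lemma qaddE x y : qadd (qpi x) (qpi y) = qpi (x + y).
Proof.
apply/qpiP; rewrite opprD addrACA; apply: idealD; exact: repr_qpi.
Qed.
Lemma qoppE x : qopp (qpi x) = qpi (- x).
Proof. by apply/qpiP; rewrite -opprD; apply/idealN/repr_qpi. Qed.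
Lemma qscaleE a x : qscale a (qpi x) = qpi (a *: x).
Proof. by apply/qpiP; rewrite -scalerBr; apply/idealZ/repr_qpi. Qed.
Lemma qmulE x y : qmul (qpi x) (qpi y) = qpi (x * y).
Proof.
apply/qpiP; set r := repr (qpi x).
have -> : r * repr (qpi y) - x * y = r * (repr (qpi y) - y) + (r - x) * y.
  by rewrite mulrBr mulrBl addrA subrK.
by apply: idealD; [apply/idealMl/repr_qpi|apply/idealMr/repr_qpi].
Qed.

Lemma qaddA : associative qadd.
Proof.
elim/quot_ind=> x; elim/quot_ind=> y; elim/quot_ind=> z.
by rewrite !qaddE addrA.
Qed.
Lemma qaddC : commutative qadd.
Proof. by elim/quot_ind=> x; elim/quot_ind=> y; rewrite !qaddE addrC. Qed.
Lemma qadd0 : left_id (qpi 0) qadd.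
Proof. by elim/quot_ind=> x; rewrite qaddE add0r. Qed.
Lemma qaddN : left_inverse (qpi 0) qopp qadd.
Proof. by elim/quot_ind=> x; rewrite qoppE qaddE addNr. Qed.
HB.instance Definition _ := GRing.isZmodule.Build quot qaddA qaddC qadd0 qaddN.

Lemma qpiD x y : qpi (x + y) = qpi x + qpi y.
Proof. by rewrite -qaddE. Qed.

Lemma qscaleA a b x : qscale a (qscale b x) = qscale (a * b) x.
Proof. by elim/quot_ind: x => x; rewrite !qscaleE scalerA. Qed.
Lemma qscale1 : left_id 1 qscale.
Proof. by elim/quot_ind=> x; rewrite qscaleE scale1r. Qed.
Lemma qscaleDr : right_distributive qscale +%R.
Proof.
move=> a; elim/quot_ind=> x; elim/quot_ind=> y.
by rewrite -qpiD !qscaleE -qpiD scalerDr.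
Qed.
Lemma qscaleDl x : {morph qscale^~ x : a b / a + b}.
Proof.
by elim/quot_ind: x => x a b; rewrite !qscaleE -qpiD scalerDl.
Qed.
HB.instance Definition _ :=
  GRing.Zmodule_isLmodule.Build K quot qscaleA qscale1 qscaleDr qscaleDl.

Lemma qpiZ a x : qpi (a *: x) = a *: qpi x.
Proof. by rewrite -qscaleE. Qed.

Lemma qmulA : associative qmul.
Proof.
elim/quot_ind=> x; elim/quot_ind=> y; elim/quot_ind=> z.
by rewrite !qmulE mulrA.
Qed.
Lemma qmul1 : left_id (qpi 1) qmul.
Proof. by elim/quot_ind=> x; rewrite qmulE mul1r. Qed.
Lemma qmulr1 : right_id (qpi 1) qmul.
Proof. by elim/quot_ind=> x; rewrite qmulE mulr1. Qed.
Lemma qmul_linl y : linear (qmul^~ y).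
Proof.
elim/quot_ind: y => y a; elim/quot_ind=> x; elim/quot_ind=> x'.
by rewrite -qpiZ -qpiD !qmulE -qpiZ -qpiD mulrDl ua_scalerAl.
Qed.
Lemma qmul_linr x : linear (qmul x).
Proof.
elim/quot_ind: x => x a; elim/quot_ind=> y; elim/quot_ind=> y'.
by rewrite -qpiZ -qpiD !qmulE -qpiZ -qpiD mulrDr ua_scalerAr.
Qed.

Definition qalg : uAlg K := UAlg qmulA qmul1 qmulr1 qmul_linl qmul_linr.

Lemma qpi_linear : linear (qpi : A -> qalg).
Proof. by move=> a x y; rewrite qpiD qpiZ. Qed.
Lemma qpi_monoid : monoid_morphism (qpi : A -> qalg).
Proof. by split=> // x y; rewrite -qmulE. Qed.
Definition qproj : alghom A qalg := AlgHom qpi_linear qpi_monoid.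

Lemma qprojP x : qproj x = 0 <-> J x.
Proof. by rewrite -[J x]/(ideal_set J x) -[x in J x]subr0; exact: qpiP. Qed.
Lemma qproj_surj y : exists x, qproj x = y.
Proof. by exists (repr y); apply: qpi_repr. Qed.

End Def.

Section Map.
Variables (J J' : ideal A) (sJ : forall x, J x -> J' x).

Definition qmap_fun (x : qalg J) : qalg J' := qproj J' (repr x).
Lemma qmap_funE x : qmap_fun (qproj J x) = qproj J' x.
Proof. by apply/qpiP; apply/sJ/repr_qpi. Qed.
Lemma qmap_linear : linear qmap_fun.
Proof.
move=> a x y; have [x' <-] := qproj_surj x; have [y' <-] := qproj_surj y.
by rewrite -linearP !qmap_funE linearP.
Qed.
Lemma qmap_monoid : monoid_morphism qmap_fun.
Proof.
split=> [|x y]; first by rewrite -(rmorph1 (qproj J)) qmap_funE rmorph1.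
have [x' <-] := qproj_surj x; have [y' <-] := qproj_surj y.
by rewrite -rmorphM !qmap_funE rmorphM.
Qed.
Definition qmap : alghom (qalg J) (qalg J') := AlgHom qmap_linear qmap_monoid.
Lemma qmapE x : qmap (qproj J x) = qproj J' x.
Proof. exact: qmap_funE. Qed.
End Map.

Section Sum.
Variables J J' : ideal A.

Definition ideal_sum_set (z : A) : Prop := exists2 x, J x & exists2 y, J' y & x + y = z.
Lemma ideal_sum0 : ideal_sum_set 0.
Proof.
by exists 0; [exact: ideal0|exists 0; [exact: ideal0|rewrite addr0]].
Qed.
Lemma ideal_sumD x y :
  ideal_sum_set x -> ideal_sum_set y -> ideal_sum_set (x + y).
Proof.
move=> [a Ja [b Jb <-]] [a' Ja' [b' Jb' <-]]; exists (a + a'); first exact: idealD.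
by exists (b + b'); [exact: idealD|rewrite addrACA].
Qed.
Lemma ideal_sumMl a x : ideal_sum_set x -> ideal_sum_set (a * x).
Proof.
move=> [y Jy [z Jz <-]]; exists (a * y); first exact: idealMl.
by exists (a * z); [exact: idealMl|rewrite mulrDr].
Qed.
Lemma ideal_sumMr a x : ideal_sum_set x -> ideal_sum_set (x * a).
Proof.
move=> [y Jy [z Jz <-]]; exists (y * a); first exact: idealMr.
by exists (z * a); [exact: idealMr|rewrite mulrDl].
Qed.
Definition ideal_sum : ideal A :=
  Ideal ideal_sum0 ideal_sumD ideal_sumMl ideal_sumMr.

Lemma ideal_suml x : J x -> ideal_sum x.
Proof. by move=> Jx; exists x => //; exists 0; [exact: ideal0|rewrite addr0]. Qed.
Lemma ideal_sumr x : J' x -> ideal_sum x.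
Proof. by move=> Jx; exists 0; [exact: ideal0|exists x => //; rewrite add0r]. Qed.

Definition qmapl : alghom (qalg J) (qalg ideal_sum) := qmap ideal_suml.
Definition qmapr : alghom (qalg J') (qalg ideal_sum) := qmap ideal_sumr.
End Sum.

End Quotient.

Section Kernel.
Variables (K : fieldType) (A B : uAlg K) (f : alghom A B).
Lemma ker0 : f 0 = 0.
Proof. exact: raddf0. Qed.
Lemma kerD x y : f x = 0 -> f y = 0 -> f (x + y) = 0.
Proof. by move=> hx hy; rewrite raddfD /= hx hy addr0. Qed.
Lemma kerMl a x : f x = 0 -> f (a * x) = 0.
Proof. by move=> h; rewrite rmorphM /= h mulr0. Qed.
Lemma kerMr a x : f x = 0 -> f (x * a) = 0.
Proof. by move=> h; rewrite rmorphM /= h mul0r. Qed.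
Definition ker_ideal : ideal A := Ideal ker0 kerD kerMl kerMr.
End Kernel.

(* A finite family of ideals with zero intersection such that A is the gluing *)
(* of the A / J_i along the A / (J_i + J_j).                                  *)
Record complete_covering (K : fieldType) (I : finType) (A : uAlg K)
    (J : I -> ideal A) : Prop := {
  covering_inter : forall x, (forall i, J i x) -> x = 0;
  covering_glue : forall a : (forall i, qalg (J i)),
    (forall i j, i != j -> qmapl (J i) (J j) (a i) = qmapr (J i) (J j) (a j)) ->
    exists x, forall i, qproj (J i) x = a i
}.

Record hopfAlg (K : fieldType) := HopfAlg {
  hopf_alg :> uAlg K;
  coprod : alghom hopf_alg (talg hopf_alg hopf_alg);
  counit : {linear hopf_alg -> K^o};
  antipode : {linear hopf_alg -> hopf_alg};
  antipodeV : {linear hopf_alg -> hopf_alg};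
  coprod_coassoc : forall h : hopf_alg, tassoc (tmap (coprod : _ -> tens _ _) idfun (coprod h)) =
                             tmap idfun (coprod : _ -> tens _ _) (coprod h);
  counit_monoid : monoid_morphism (counit : hopf_alg -> K);
  coprod_counitl : forall h : hopf_alg, tlift (fun a b : hopf_alg => counit a *: b) (coprod h) = h;
  coprod_counitr : forall h : hopf_alg, tlift (fun a b : hopf_alg => counit b *: a) (coprod h) = h;
  antipodel : forall h : hopf_alg,
    tlift (fun a b : hopf_alg => antipode a * b : hopf_alg) (coprod h) = counit h *: (1 : hopf_alg);
  antipoder : forall h : hopf_alg,
    tlift (fun a b : hopf_alg => a * antipode b : hopf_alg) (coprod h) = counit h *: (1 : hopf_alg);
  antipodeK : cancel antipode antipodeV;
  antipodeVK : cancel antipodeV antipode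
}.

Definition is_coaction (K : fieldType) (H : hopfAlg K) (V : lmodType K)
    (delta : V -> tens V H) : Prop :=
  (forall v, tassoc (tmap delta idfun (delta v)) =
             tmap idfun (coprod H : H -> tens H H) (delta v)) /\
  (forall v, tlift (fun w h => counit H h *: w) (delta v) = v).

(* A differential algebra Gamma over A. The grading is given by the           *)
(* projections [dg_pr n] onto the homogeneous components, so that             *)
(* Gamma^n = {x | dg_pr n x = x}; [dg_inc] identifies A with Gamma^0.         *)
Record dgAlg (K : fieldType) (A : uAlg K) := DgAlg {
  dg_alg :> uAlg K;
  dg_inc : alghom A dg_alg;
  dg_pr : nat -> {linear dg_alg -> dg_alg};
  dg_d : {linear dg_alg -> dg_alg};
  dg_pr_pr : forall m n x, dg_pr m (dg_pr n x) = if m == n then dg_pr n x else 0;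
  dg_pr_sum : forall x, exists N, x = \sum_(n < N) dg_pr n x;
  dg_pr_one : dg_pr 0 1 = 1;
  dg_pr_mul : forall m n x y, dg_pr m x = x -> dg_pr n y = y ->
    dg_pr (m + n) (x * y) = x * y;
  dg_inc_inj : injective dg_inc;
  dg_inc_im : forall x, dg_pr 0 x = x <-> exists a, dg_inc a = x;
  dg_d_deg : forall n x, dg_pr n x = x -> dg_pr n.+1 (dg_d x) = dg_d x;
  dg_d_d : forall x, dg_d (dg_d x) = 0;
  dg_leibniz : forall n x y, dg_pr n x = x ->
    dg_d (x * y) = dg_d x * y + (-1) ^+ n *: (x * dg_d y)
}.

Definition homog (K : fieldType) (A : uAlg K) (G : dgAlg A) (n : nat) (x : G) : Prop :=
  dg_pr G n x = x.

(* G is a differential calculus: it is generated as an algebra by A and dA.   *)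
Definition is_calculus (K : fieldType) (A : uAlg K) (G : dgAlg A) : Prop :=
  forall S : G -> Prop,
    S 1 -> (forall x y, S x -> S y -> S (x + y)) ->
    (forall (c : K) x, S x -> S (c *: x)) ->
    (forall x y, S x -> S y -> S (x * y)) ->
    (forall a, S (dg_inc G a)) -> (forall a, S (dg_d G (dg_inc G a))) ->
    forall x, S x.

(* F is a homomorphism of differential algebras extending f.                  *)
Definition dg_extends (K : fieldType) (A A' : uAlg K) (G : dgAlg A) (G' : dgAlg A')
    (f : A -> A') (F : alghom G G') : Prop :=
  [/\ forall a, F (dg_inc G a) = dg_inc G' (f a),
      forall n x, F (dg_pr G n x) = dg_pr G' n (F x) &
      forall x, F (dg_d G x) = dg_d G' (F x)].

Definition is_universal (K : fieldType) (A : uAlg K) (Om : dgAlg A) : Prop :=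
  is_calculus Om /\
  forall (A' : uAlg K) (G : dgAlg A') (f : alghom A A'),
    exists F : alghom Om G, dg_extends f F.

Section DgTheory.
Variables (K : fieldType) (A : uAlg K) (G : dgAlg A).
Implicit Types x y : G.

Lemma homog_pr n x : homog n (dg_pr G n x).
Proof. by rewrite /homog dg_pr_pr eqxx. Qed.

Lemma dg_ind (P : G -> Prop) : P 0 -> (forall x y, P x -> P y -> P (x + y)) ->
  (forall n x, homog n x -> P x) -> forall x, P x.
Proof.
move=> P0 PD Ph x; have [N ->] := dg_pr_sum x.
by apply: big_ind => // i _; apply: Ph; exact: homog_pr.
Qed.

Lemma homog0 n : homog n (0 : G).
Proof. exact: raddf0. Qed.
Lemma homogD n x y : homog n x -> homog n y -> homog n (x + y).
Proof. by rewrite /homog => hx hy; rewrite raddfD /= hx hy. Qed.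
Lemma homogZ n (c : K) x : homog n x -> homog n (c *: x).
Proof. by rewrite /homog => hx; rewrite linearZ /= hx. Qed.
Lemma homogM m n x y : homog m x -> homog n y -> homog (m + n) (x * y).
Proof. exact: dg_pr_mul. Qed.
Lemma homog_d n x : homog n x -> homog n.+1 (dg_d G x).
Proof. exact: dg_d_deg. Qed.
Lemma homog_inc a : homog 0 (dg_inc G a).
Proof. by apply/dg_inc_im; exists a. Qed.
Lemma homog1 : homog 0 (1 : G).
Proof. exact: dg_pr_one. Qed.
Lemma homog_prE m n x : homog n x -> dg_pr G m x = if m == n then x else 0.
Proof. by move=> h; rewrite -[x in LHS]h dg_pr_pr h. Qed.

Definition dg_bound x : nat := projT1 (cid (dg_pr_sum x)).

(* x |-> sum_n c_n x_n, where x_n is the component of x in degree n.          *)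
Definition dg_twist (c : nat -> K) x : G :=
  \sum_(n < dg_bound x) c n *: dg_pr G n x.

Lemma dg_pr_bound n x : (dg_bound x <= n)%N -> dg_pr G n x = 0.
Proof.
rewrite /dg_bound; case: cid => N /= -> leNn; rewrite raddf_sum big1 //= => i _.
by rewrite dg_pr_pr gtn_eqF // (leq_trans _ leNn).
Qed.

Lemma dg_twistE c x M : (dg_bound x <= M)%N ->
  dg_twist c x = \sum_(n < M) c n *: dg_pr G n x.
Proof.
move=> leM; rewrite /dg_twist -!(big_mkord xpredT (fun n => c n *: dg_pr G n x)).
rewrite [RHS](big_cat_nat (n := dg_bound x)) //= [X in _ + X]big_nat_cond.
rewrite [X in _ + X]big1 ?addr0 // => i /andP[/andP[le _] _].
by rewrite dg_pr_bound ?scaler0.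
Qed.

Lemma dg_twist_linear c : linear (dg_twist c).
Proof.
move=> a x y.
set M := maxn (dg_bound (a *: x + y)) (maxn (dg_bound x) (dg_bound y)).
rewrite !(@dg_twistE c _ M) ?leq_max ?leqnn ?orbT //.
rewrite scaler_sumr -big_split; apply: eq_bigr => i _ /=.
by rewrite linearP scalerDr !scalerA mulrC.
Qed.
HB.instance Definition _ c :=
  GRing.isLinear.Build K G G *:%R (dg_twist c) (dg_twist_linear c).

Lemma dg_twist_homog c n x : homog n x -> dg_twist c x = c n *: x.
Proof.
move=> h; rewrite (@dg_twistE c x (maxn (dg_bound x) n.+1)) ?leq_maxl //.
have ltn : (n < maxn (dg_bound x) n.+1)%N by rewrite leq_max leqnn orbT.
rewrite (bigD1 (Ordinal ltn)) //= h big1 ?addr0 // => i /negP nin.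
rewrite (homog_prE _ h) ifN ?scaler0 //; apply/negP => /eqP e; apply: nin.
by apply/eqP/val_inj.
Qed.

Definition dg_sign : G -> G := dg_twist (fun n => (-1) ^+ n).
Definition dg_even : G -> G := dg_twist (fun n => (~~ odd n)%:R).
Definition dg_odd : G -> G := dg_twist (fun n => (odd n)%:R).
HB.instance Definition _ := GRing.Linear.on dg_sign.
HB.instance Definition _ := GRing.Linear.on dg_even.
HB.instance Definition _ := GRing.Linear.on dg_odd.

Lemma dg_res_ex x : exists a, dg_inc G a = dg_pr G 0 x.
Proof. by apply/dg_inc_im; exact: homog_pr. Qed.
Definition dg_res x : A := projT1 (cid (dg_res_ex x)).
Lemma dg_resE x : dg_inc G (dg_res x) = dg_pr G 0 x.
Proof. by rewrite /dg_res; case: cid. Qed.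
Lemma dg_res_linear : linear dg_res.
Proof. by move=> a x y; apply: (@dg_inc_inj _ _ G); rewrite linearP /= !dg_resE linearP. Qed.
HB.instance Definition _ := GRing.isLinear.Build K G A *:%R dg_res dg_res_linear.
Lemma dg_incK : cancel (dg_inc G) dg_res.
Proof. by move=> a; apply: (@dg_inc_inj _ _ G); rewrite dg_resE homog_inc. Qed.

End DgTheory.

Section GradedTensor.
Variables (K : fieldType) (A1 A2 : uAlg K) (G1 : dgAlg A1) (G2 : dgAlg A2).

(* (u (x) v)(u' (x) v') = sum_n (-1)^(n m) u u' (x) v_n v' for u' of degree m. *)
Definition gmulF (u : G1) (v : G2) (u' : G1) (v' : G2) : tens G1 G2 :=
  (u * u') \ot (dg_even v * v') + (u * dg_sign u') \ot (dg_odd v * v').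
Definition gmul (x y : tens G1 G2) : tens G1 G2 := tlift2 gmulF x y.

Definition gpr n (x : tens G1 G2) : tens G1 G2 :=
  tlift (fun u v => \sum_(k < n.+1) dg_pr G1 k u \ot dg_pr G2 (n - k) v) x.

Definition gdiff (x : tens G1 G2) : tens G1 G2 :=
  tlift (fun u v => dg_d G1 u \ot v + dg_sign u \ot dg_d G2 v) x.

Lemma bilin_add (U V W : lmodType K) (f g : U -> V -> W) :
  bilin f -> bilin g -> bilin (fun u v => f u v + g u v).
Proof.
by move=> fB gB; split=> [v|u]; apply: lin_add; (apply fB.1 || apply fB.2 || apply gB.1 || apply gB.2).
Qed.

Lemma bilin_sum (U V W : lmodType K) m (f : 'I_m -> U -> V -> W) :
  (forall k, bilin (f k)) -> bilin (fun u v => \sum_(k < m) f k u v).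
Proof.
move=> fB; split=> [v|u] a x y; rewrite scaler_sumr -big_split;
  apply: eq_bigr => k _; have [h1 h2] := fB k; [exact: h1|exact: h2].
Qed.

Lemma gmulF_bilinl u v : bilin (gmulF u v).
Proof.
apply: bilin_add.
  exact: (tmap_bilin (mul_linr u) (mul_linr (dg_even v))).
apply: (tmap_bilin (lin_comp (mul_linr u) _) (mul_linr (dg_odd v))).
exact: lin_of.
Qed.
Lemma gmulF_bilinr u' v' : bilin (fun u v => gmulF u v u' v').
Proof.
apply: bilin_add.
  by apply: (tmap_bilin (mul_linl u') (lin_comp (mul_linl v') _)); exact: lin_of.
by apply: (tmap_bilin (mul_linl (dg_sign u')) (lin_comp (mul_linl v') _));
   exact: lin_of.
Qed.
Lemma gmulE u v u' v' : gmul (u \ot v) (u' \ot v') = gmulF u v u' v'.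
Proof. exact: (tlift2_pure gmulF_bilinl gmulF_bilinr). Qed.
Lemma gmul_linl y : linear (gmul^~ y).
Proof. exact: (tlift2_linl gmulF_bilinr). Qed.
Lemma gmul_linr x : linear (gmul x).
Proof. exact: (tlift2_linr gmulF_bilinl). Qed.

Lemma tpureZl (U V : lmodType K) (a : K) (u : U) (v : V) : (a *: u) \ot v = a *: (u \ot v).
Proof. by rewrite (bilinZl (@tpure_bilin K U V)). Qed.
Lemma tpureZr (U V : lmodType K) (a : K) (u : U) (v : V) : u \ot (a *: v) = a *: (u \ot v).
Proof. by rewrite (bilinZr (@tpure_bilin K U V)). Qed.
Lemma tpure0l (U V : lmodType K) (v : V) : (0 : U) \ot v = 0.
Proof. by rewrite (bilin0l (@tpure_bilin K U V)). Qed.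
Lemma tpure0r (U V : lmodType K) (u : U) : u \ot (0 : V) = 0.
Proof. by rewrite (bilin0r (@tpure_bilin K U V)). Qed.

Lemma gmul_homog n m u v u' v' : homog n v -> homog m u' ->
  gmul (u \ot v) (u' \ot v') = (-1) ^+ (n * m) *: ((u * u') \ot (v * v')).
Proof.
move=> hv hu; rewrite gmulE /gmulF /dg_even /dg_odd /dg_sign.
rewrite !(dg_twist_homog _ hv) !(dg_twist_homog _ hu).
rewrite !(ua_scalerAl, ua_scalerAr, tpureZl, tpureZr) scalerA -scalerDl.
congr (_ *: _); rewrite -[RHS]signr_odd oddM; case: (odd n);
  by rewrite /= ?mul0r ?mulr0 ?mul1r ?mulr1 ?add0r ?addr0 ?signr_odd.
Qed.

Lemma gpr_bilin n :
  bilin (fun u v => \sum_(k < n.+1) dg_pr G1 k u \ot dg_pr G2 (n - k) v).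
Proof.
apply: bilin_sum => k; apply: tmap_bilin; exact: lin_of.
Qed.
Lemma gpr_linear n : linear (gpr n).
Proof. by apply: tlift_linear; apply: gpr_bilin. Qed.
HB.instance Definition _ n :=
  GRing.isLinear.Build K _ _ *:%R (gpr n) (gpr_linear n).

Lemma gdiff_bilin :
  bilin (fun u v => dg_d G1 u \ot v + dg_sign u \ot dg_d G2 v).
Proof.
by apply: bilin_add;
  [apply: (tmap_bilin (g := idfun)) | apply: tmap_bilin]; exact: lin_of.
Qed.
Lemma gdiff_linear : linear gdiff.
Proof. by apply: tlift_linear; apply: gdiff_bilin. Qed.
HB.instance Definition _ :=
  GRing.isLinear.Build K _ _ *:%R gdiff gdiff_linear.

Lemma gt_ind (P : tens G1 G2 -> Prop) : P 0 ->
  (forall x y, P x -> P y -> P (x + y)) ->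
  (forall m n u v, homog m u -> homog n v -> P (u \ot v)) -> forall x, P x.
Proof.
move=> P0 PD Pp; elim/tens_ind => [|x y|u v]; [exact: P0|exact: PD|].
elim/dg_ind: u => [|x y hx hy|m u hu]; first by rewrite tpure0l.
  by rewrite (bilinDl (@tpure_bilin K G1 G2)); apply: PD.
elim/dg_ind: v => [|x y hx hy|n v hv]; first by rewrite tpure0r.
  by rewrite (bilinDr (@tpure_bilin K G1 G2)); apply: PD.
exact: Pp hu hv.
Qed.

Lemma gmulA : associative gmul.
Proof.
move=> x y z; elim/gt_ind: x => [|x x' hx hx'|m n u v hu hv].
- by rewrite !(lin0 (gmul_linl _)).
- by rewrite !(linD (gmul_linl _)) hx hx'.
elim/gt_ind: y => [|y y' hy hy'|m' n' u' v' hu' hv'].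
- by rewrite !(lin0 (gmul_linl _), lin0 (gmul_linr _)).
- by rewrite !(linD (gmul_linl _), linD (gmul_linr _)) hy hy'.
elim/gt_ind: z => [|z z' hz hz'|m2 n2 u2 v2 hu2 hv2].
- by rewrite !(lin0 (gmul_linl _), lin0 (gmul_linr _)).
- by rewrite !(linD (gmul_linl _), linD (gmul_linr _)) hz hz'.
rewrite (gmul_homog _ _ hv' hu2) (gmul_homog _ _ hv hu').
rewrite (linZ _ _ (gmul_linr _)) (linZ _ _ (gmul_linl _)).
rewrite (gmul_homog _ _ hv (homogM hu' hu2)) (gmul_homog _ _ (homogM hv hv') hu2).
rewrite !scalerA !mulrA -!exprD; congr ((-1) ^+ _ *: _).
by rewrite mulnDr mulnDl addnC -addnA.
Qed.

Lemma gmul1 : left_id ((1 : G1) \ot (1 : G2)) gmul.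
Proof.
move=> x; elim/gt_ind: x => [|x y hx hy|m n u v hu hv].
- exact: (lin0 (gmul_linr _)).
- by rewrite (linD (gmul_linr _)) hx hy.
by rewrite (gmul_homog _ _ (@homog1 _ _ G2) hu) mul0n expr0 scale1r !mul1r.
Qed.
Lemma gmulr1 : right_id ((1 : G1) \ot (1 : G2)) gmul.
Proof.
move=> x; elim/gt_ind: x => [|x y hx hy|m n u v hu hv].
- exact: (lin0 (gmul_linl _)).
- by rewrite (linD (gmul_linl _)) hx hy.
by rewrite (gmul_homog _ _ hv (@homog1 _ _ G1)) muln0 expr0 scale1r !mulr1.
Qed.

Definition galg : uAlg K := UAlg gmulA gmul1 gmulr1 gmul_linl gmul_linr.

Lemma gpr_homog k m n u v : homog m u -> homog n v ->
  gpr k (u \ot v) = if k == (m + n)%N then u \ot v else 0.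
Proof.
move=> hu hv; rewrite /gpr (tlift_pure (gpr_bilin k)).
have [->|ne] := eqVneq k (m + n)%N.
  have lt : (m < (m + n).+1)%N by rewrite ltnS leq_addr.
  rewrite (bigD1 (Ordinal lt)) //= addKn hu hv big1 ?addr0 // => i ne.
  rewrite (homog_prE _ hu) ifN ?tpure0l //.
rewrite big1 // => i _; rewrite (homog_prE _ hu) (homog_prE _ hv).
have [im|] := eqVneq (i : nat) m; last by rewrite tpure0l.
have [kin|] := eqVneq (k - i)%N n; last by rewrite tpure0r.
by case/eqP: ne; rewrite -im -kin subnKC // -ltnS.
Qed.

Lemma gpr_pr m n x : gpr m (gpr n x) = if m == n then gpr n x else 0.
Proof.
elim/gt_ind: x => [|x y hx hy|a b u v hu hv].
- by rewrite !linear0 if_same.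
- by rewrite !raddfD /= hx hy; case: ifP; rewrite ?addr0.
rewrite (gpr_homog n hu hv); have [nab|ne] := eqVneq n (a + b)%N.
  by rewrite (gpr_homog m hu hv) -nab.
by rewrite linear0 if_same.
Qed.

Lemma gpr_sum x : exists N, x = \sum_(n < N) gpr n x.
Proof.
suff [N hN] : exists N, forall M, (N <= M)%N -> x = \sum_(n < M) gpr n x.
  by exists N; exact: hN.
elim/gt_ind: x => [|x y [N hN] [N' hN']|a b u v hu hv].
- by exists 0%N => M _; rewrite big1 // => i _; rewrite linear0.
- exists (maxn N N') => M; rewrite geq_max => /andP[le le'].
  rewrite [in LHS](hN M le) [in LHS](hN' M le') -big_split.
  by apply: eq_bigr => i _; rewrite raddfD.
exists (a + b).+1 => M lt; rewrite (bigD1 (Ordinal lt)) //= big1 ?addr0.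
  by rewrite (gpr_homog _ hu hv) eqxx.
move=> i ne; by rewrite (gpr_homog _ hu hv) ifN.
Qed.

Lemma gpr_one : gpr 0 ((1 : G1) \ot (1 : G2)) = (1 : G1) \ot (1 : G2).
Proof. by rewrite (gpr_homog 0 (@homog1 _ _ G1) (@homog1 _ _ G2)). Qed.

Lemma gpr_mul m n (x y : galg) :
  gpr m x = x -> gpr n y = y -> gpr (m + n) (x * y) = x * y.
Proof.
move=> hx hy; rewrite -hx -hy; clear hx hy.
change (gpr (m + n) (gmul (gpr m x) (gpr n y)) = gmul (gpr m x) (gpr n y)).
elim/gt_ind: x => [|x x' hx hx'|a b u v hu hv].
- by rewrite linear0 (lin0 (gmul_linl _)) linear0.
- by rewrite raddfD /= (linD (gmul_linl _)) raddfD /= hx hx'.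
elim/gt_ind: y => [|y y' hy hy'|a' b' u' v' hu' hv'].
- by rewrite linear0 (lin0 (gmul_linr _)) linear0.
- by rewrite raddfD /= (linD (gmul_linr _)) raddfD /= hy hy'.
rewrite (gpr_homog _ hu hv) (gpr_homog _ hu' hv').
have [->|_] := eqVneq m; last by rewrite (lin0 (gmul_linl _)) linear0.
have [->|_] := eqVneq n; last by rewrite (lin0 (gmul_linr _)) linear0.
rewrite (gmul_homog _ _ hv hu') linearZ /=.
by rewrite (gpr_homog _ (homogM hu hu') (homogM hv hv')) addnACA eqxx.
Qed.

Definition ginc : talg A1 A2 -> galg := tmap (dg_inc G1) (dg_inc G2).
Lemma ginc_linear : linear ginc.
Proof. exact: (tmap_linear (lin_of (dg_inc G1)) (lin_of (dg_inc G2))). Qed.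
Lemma gincE a b : ginc (a \ot b) = dg_inc G1 a \ot dg_inc G2 b.
Proof. by apply: tmap_pure; exact: lin_of. Qed.
Lemma ginc_monoid : monoid_morphism ginc.
Proof.
split=> [|x y]; first by rewrite /= gincE !rmorph1.
change (ginc (tmul x y) = gmul (ginc x) (ginc y)).
elim/tens_ind: x => [|x x' hx hx'|a b].
- by rewrite (lin0 (tmul_linl _)) !(lin0 ginc_linear) (lin0 (gmul_linl _)).
- by rewrite (linD (tmul_linl _)) !(linD ginc_linear) (linD (gmul_linl _)) hx hx'.
elim/tens_ind: y => [|y y' hy hy'|a' b'].
- by rewrite (lin0 (tmul_linr _)) !(lin0 ginc_linear) (lin0 (gmul_linr _)).
- by rewrite (linD (tmul_linr _)) !(linD ginc_linear) (linD (gmul_linr _)) hy hy'.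
rewrite tmulE !gincE !rmorphM /=.
rewrite (gmul_homog _ _ (homog_inc G2 b) (homog_inc G1 a')).
by rewrite mul0n expr0 scale1r.
Qed.
Definition ginc_hom : alghom (talg A1 A2) galg := AlgHom ginc_linear ginc_monoid.

Definition gres : tens G1 G2 -> tens A1 A2 := tmap (@dg_res _ _ G1) (@dg_res _ _ G2).
Lemma gincK : cancel ginc gres.
Proof.
apply: tens_ext => [|//|a b].
  by apply: (lin_comp (f := gres) _ ginc_linear); apply: tmap_linear; exact: lin_of.
by rewrite gincE /gres tmap_pure ?dg_incK //; exact: lin_of.
Qed.
Lemma ginc_inj : injective ginc.
Proof. exact: can_inj gincK. Qed.
Lemma ginc_im x : gpr 0 x = x <-> exists a, ginc a = x.
Proof.
have E y : ginc (gres y) = gpr 0 y.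
  move: y; apply: tens_ext; [|exact: lin_of|].
    by apply: (lin_comp (f := ginc) ginc_linear); apply: tmap_linear; exact: lin_of.
  move=> u v; rewrite /gres tmap_pure; try exact: lin_of.
  rewrite gincE !dg_resE /gpr (tlift_pure (gpr_bilin 0)).
  by rewrite big_ord_recl big_ord0 addr0.
split=> [h|[a <-]]; first by exists (gres x); rewrite E.
by rewrite -E gincK.
Qed.

Lemma gdiffE u v m : homog m u ->
  gdiff (u \ot v) = dg_d G1 u \ot v + (-1) ^+ m *: (u \ot dg_d G2 v).
Proof.
move=> hu; rewrite /gdiff (tlift_pure gdiff_bilin).
by rewrite /dg_sign (dg_twist_homog _ hu) tpureZl.
Qed.

Lemma gdiff_deg n x : gpr n x = x -> gpr n.+1 (gdiff x) = gdiff x.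
Proof.
move=> hx; rewrite -hx; clear hx.
elim/gt_ind: x => [|x x' hx hx'|a b u v hu hv].
- by rewrite !linear0.
- by rewrite !raddfD /= hx hx'.
rewrite (gpr_homog _ hu hv); have [->|_] := eqVneq n; last by rewrite !linear0.
rewrite (gdiffE _ hu) (linD (gpr_linear _)) (linZ _ _ (gpr_linear _)).
rewrite (gpr_homog _ (homog_d hu) hv) (gpr_homog _ hu (homog_d hv)).
by rewrite addSn addnS !eqxx.
Qed.

Lemma gdiff_d x : gdiff (gdiff x) = 0.
Proof.
elim/gt_ind: x => [|x x' hx hx'|a b u v hu hv].
- by rewrite !linear0.
- by rewrite !raddfD /= hx hx' addr0.
rewrite (gdiffE _ hu) (linD gdiff_linear) (linZ _ _ gdiff_linear) (gdiffE _ (homog_d hu)) (gdiffE _ hu).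
rewrite !dg_d_d tpure0l tpure0r scaler0 add0r addr0 exprS -scalerA.
by rewrite scaleN1r addNr.
Qed.

Lemma gdiff_leibniz n (x y : galg) : gpr n x = x ->
  gdiff (x * y) = (gdiff x : galg) * y + (-1) ^+ n *: (x * (gdiff y : galg)).
Proof.
move=> hx; rewrite -hx; clear hx.
change (gdiff (gmul (gpr n x) y) =
  gmul (gdiff (gpr n x)) y + (-1) ^+ n *: gmul (gpr n x) (gdiff y)).
elim/gt_ind: x => [|x x' hx hx'|a b u v hu hv].
- by rewrite !linear0 !(lin0 (gmul_linl _)) linear0 scaler0 addr0.
- rewrite !raddfD /= !(linD (gmul_linl _)) raddfD /= hx hx'.
  by rewrite scalerDr addrACA.
rewrite (gpr_homog _ hu hv); have [->|_] := eqVneq n; last first.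
  by rewrite !linear0 !(lin0 (gmul_linl _)) linear0 scaler0 addr0.
elim/gt_ind: y => [|y y' hy hy'|a' b' u' v' hu' hv'].
- by rewrite !linear0 !(lin0 (gmul_linr _)) linear0 scaler0 addr0.
- rewrite !raddfD /= !(linD (gmul_linr _)) raddfD /= hy hy'.
  by rewrite scalerDr addrACA.
rewrite (gdiffE _ hu) (gdiffE _ hu') (linD (gmul_linl _)) (linD (gmul_linr _)).
rewrite (linZ _ _ (gmul_linl _)) (linZ _ _ (gmul_linr _)).
rewrite (gmul_homog _ _ hv hu') (gmul_homog _ _ hv (homog_d hu')).
rewrite (gmul_homog _ _ (homog_d hv) hu').
rewrite linearZ /= (gdiffE _ (homogM hu hu')).
rewrite (dg_leibniz _ hu) (dg_leibniz _ hv).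
rewrite (bilinDl (@tpure_bilin K G1 G2)) (bilinDr (@tpure_bilin K G1 G2)).
rewrite !(tpureZl, tpureZr) !(gmul_homog _ _ hv hu').
rewrite !scalerDr !scalerA -!exprD -!addrA; congr (_ + _).
rewrite [in RHS]addrCA; congr (_ + _); [|congr (_ + _)]; congr (_ *: _);
  rewrite -[LHS]signr_odd -[RHS]signr_odd; congr (_ ^+ _);
  rewrite !(oddD, oddM, oddS) /=;
  by case: (odd a); case: (odd b); case: (odd a').
Qed.

(* Gamma(A1) (x)^ Gamma(A2), a differential algebra over A1 (x) A2. *)
Definition gtens : dgAlg (talg A1 A2) :=
  DgAlg (dg_alg := galg) (dg_inc := ginc_hom) (dg_pr := fun n => gpr n)
    (dg_d := gdiff) gpr_pr gpr_sum gpr_one gpr_mul ginc_inj ginc_im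
    gdiff_deg gdiff_d gdiff_leibniz.

End GradedTensor.

Section DepProduct.
Variables (K : fieldType) (I : finType) (V : I -> lmodType K).

Definition dprod : Type := forall i, V i.

HB.instance Definition _ := gen_eqMixin dprod.
HB.instance Definition _ := gen_choiceMixin dprod.

Definition dadd (x y : dprod) : dprod := fun i => x i + y i.
Definition dopp (x : dprod) : dprod := fun i => - x i.
Definition dzero : dprod := fun i => 0.
Definition dscale (a : K) (x : dprod) : dprod := fun i => a *: x i.

Lemma dprodP (x y : dprod) : (forall i, x i = y i) -> x = y.
Proof. exact: functional_extensionality_dep. Qed.

Lemma daddA : associative dadd.
Proof. by move=> x y z; apply: dprodP => i; apply: addrA. Qed.
Lemma daddC : commutative dadd.
Proof. by move=> x y; apply: dprodP => i; apply: addrC. Qed.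
Lemma dadd0 : left_id dzero dadd.
Proof. by move=> x; apply: dprodP => i; apply: add0r. Qed.
Lemma daddN : left_inverse dzero dopp dadd.
Proof. by move=> x; apply: dprodP => i; apply: addNr. Qed.
HB.instance Definition _ := GRing.isZmodule.Build dprod daddA daddC dadd0 daddN.

Lemma dscaleA a b x : dscale a (dscale b x) = dscale (a * b) x.
Proof. by apply: dprodP => i; apply: scalerA. Qed.
Lemma dscale1 : left_id 1 dscale.
Proof. by move=> x; apply: dprodP => i; apply: scale1r. Qed.
Lemma dscaleDr : right_distributive dscale +%R.
Proof. by move=> a x y; apply: dprodP => i; apply: scalerDr. Qed.
Lemma dscaleDl x : {morph dscale^~ x : a b / a + b}.
Proof. by move=> a b; apply: dprodP => i; apply: scalerDl. Qed.
HB.instance Definition _ :=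
  GRing.Zmodule_isLmodule.Build K dprod dscaleA dscale1 dscaleDr dscaleDl.

End DepProduct.

Record submod (K : fieldType) (V : lmodType K) := Submod {
  submod_set :> V -> Prop;
  submod0 : submod_set 0;
  submodD : forall x y, submod_set x -> submod_set y -> submod_set (x + y);
  submodZ : forall (a : K) x, submod_set x -> submod_set (a *: x)
}.

Section Subspace.
Variables (K : fieldType) (V : lmodType K).

Section Def.
Variable W : submod V.

Record subsp := SubSp { subsp_val : V; subsp_mem : `[< W subsp_val >] }.
HB.instance Definition _ := [isSub for subsp_val].
HB.instance Definition _ := [Choice of subsp by <:].
Lemma subsp_closed : GRing.subsemimod_closed (fun x => `[< W x >] : bool).
Proof.
split; first split.
- by apply/asboolP; exact: submod0.
- by move=> x y /asboolP hx /asboolP hy; apply/asboolP; apply: submodD.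
by move=> a x /asboolP hx; apply/asboolP; apply: submodZ.
Qed.
HB.instance Definition _ :=
  GRing.SubChoice_isSubLmodule.Build K V (fun x => `[< W x >]) subsp subsp_closed.

Definition subsp_of (x : V) (h : W x) : subsp := SubSp (introT (asboolP _) h).
Lemma subspP (x : subsp) : W (subsp_val x).
Proof. exact: (elimT (asboolP _) (subsp_mem x)). Qed.
Lemma subsp_eq (x y : subsp) : subsp_val x = subsp_val y -> x = y.
Proof. exact: val_inj. Qed.
Lemma subsp_val_linear : linear subsp_val.
Proof. by move=> a x y; exact: (linearP (val : subsp -> V)). Qed.
HB.instance Definition _ :=
  GRing.isLinear.Build K subsp V *:%R subsp_val subsp_val_linear.
End Def.

Section Inter.
Variables W W' : submod V.
Lemma submodI0 : W 0 /\ W' 0.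
Proof. by split; exact: submod0. Qed.
Lemma submodID x y : W x /\ W' x -> W y /\ W' y -> W (x + y) /\ W' (x + y).
Proof. by case=> ? ? [? ?]; split; exact: submodD. Qed.
Lemma submodIZ (a : K) x : W x /\ W' x -> W (a *: x) /\ W' (a *: x).
Proof. by case=> ? ?; split; exact: submodZ. Qed.
Definition submodI : submod V :=
  Submod (submod_set := fun x => W x /\ W' x) submodI0 submodID submodIZ.
End Inter.

End Subspace.

Record qpfb (K : fieldType) (H : hopfAlg K) (I : finType) := QPFB {
  qP : uAlg K;
  qcoact : alghom qP (talg qP H);
  qcoactP : is_coaction (qcoact : qP -> tens qP H);
  qB : uAlg K;
  qJ : I -> ideal qB;
  qJ_covering : complete_covering qJ;
  qchi : forall i, alghom qP (talg (qalg (qJ i)) H);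
  qchi_surj : forall i y, exists p, qchi i p = y;
  qiota : alghom qB qP;
  qiota_inj : injective qiota;
  qchi_coact : forall i p,
    tmap idfun (coprod H : H -> tens H H) (qchi i p) =
    tassoc (tmap (qchi i : qP -> tens (qalg (qJ i)) H) idfun (qcoact p));
  qchi_iota : forall i b, qchi i (qiota b) = qproj (qJ i) b \ot (1 : H);
  qker_covering : complete_covering (fun i => ker_ideal (qchi i));
  qcoinv : forall p, (exists b, qiota b = p) <-> qcoact p = p \ot (1 : H);
  (* The transition isomorphisms, determined by [qphiE].                      *)
  qphi : forall i j, alghom (talg (qalg (ideal_sum (qJ i) (qJ j))) H)
                            (talg (qalg (ideal_sum (qJ i) (qJ j))) H);
  qphi_bij : forall i j, bijective (qphi i j);
  qphiE : forall i j p,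
    tmap (qmapl (qJ i) (qJ j)) idfun (qchi i p) =
    qphi i j (tmap (qmapr (qJ i) (qJ j)) idfun (qchi j p))
}.

Definition right_covariant (K : fieldType) (H : hopfAlg K) (GH : dgAlg H)
    (delta : {linear GH -> tens GH H}) : Prop :=
  (forall (h0 : H) (s : seq H),
     delta (dg_inc GH h0 * \prod_(h <- s) dg_d GH (dg_inc GH h)) =
     (tmap (dg_inc GH) idfun (coprod H h0) : talg GH H) *
     \prod_(h <- s) (tmap (dg_d GH \o dg_inc GH) idfun (coprod H h) : talg GH H)) /\
  is_coaction delta.

(* The calculus Omega(A) / \bigcap_i ker (f_i)_{Omega -> Gamma}.              *)
Record inducedCalc (K : fieldType) (I : finType) (A : uAlg K) (C : I -> uAlg K)
    (G : forall i, dgAlg (C i)) (f : forall i, alghom A (C i)) := InducedCalc {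
  ic_univ : dgAlg A;
  ic_univP : is_universal ic_univ;
  ic_univ_map : forall i, alghom ic_univ (G i);
  ic_univ_mapP : forall i, dg_extends (f i) (ic_univ_map i);
  ic_calc :> dgAlg A;
  ic_quot : alghom ic_univ ic_calc;
  ic_quotP : dg_extends idfun ic_quot;
  ic_quot_surj : forall x, exists w, ic_quot w = x;
  ic_quot_ker : forall w, ic_quot w = 0 <-> forall i, ic_univ_map i w = 0;
  ic_map : forall i, alghom ic_calc (G i);
  ic_mapP : forall i, dg_extends (f i) (ic_map i);
  ic_mapE : forall i w, ic_map i (ic_quot w) = ic_univ_map i w
}.

(* Y is the quotient of X by N, via q, which extends f.                       *)
Definition is_quotient (K : fieldType) (A A' : uAlg K) (X : dgAlg A) (Y : dgAlg A')
    (f : A -> A') (N : X -> Prop) (q : alghom X Y) : Prop :=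
  [/\ dg_extends f q, forall y, exists x, q x = y & forall x, q x = 0 <-> N x].

(* The differential structure on P determined by calculi over the B_i and a   *)
(* right covariant calculus over H. All other fields are determined by these  *)
(* up to isomorphism: [ds_P] is Gamma(P), [ds_B] is Gamma(B), [ds_L i j] and  *)
(* [ds_R i j] are Gamma^i(B_ij (x) H) and Gamma^j(B_ij (x) H), and            *)
(* [ds_phi i j] is the extension of [qphi i j].                               *)
Record diffStr (K : fieldType) (H : hopfAlg K) (I : finType) (Q : qpfb H I) :=
    DiffStr {
  ds_GB : forall i, dgAlg (qalg (qJ Q i));
  ds_GB_calc : forall i, is_calculus (ds_GB i);
  ds_GH : dgAlg H;
  ds_GH_calc : is_calculus ds_GH;
  ds_delta : {linear ds_GH -> tens ds_GH H};
  ds_deltaP : right_covariant ds_delta;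
  ds_P : inducedCalc (fun i => gtens (ds_GB i) ds_GH) (qchi Q);
  ds_B : inducedCalc ds_GB (fun i => qproj (qJ Q i));
  ds_L : forall i j, dgAlg (talg (qalg (ideal_sum (qJ Q i) (qJ Q j))) H);
  ds_l : forall i j, alghom (gtens (ds_GB i) ds_GH) (ds_L i j);
  ds_lP : forall i j, is_quotient
    (tmap (qmapl (qJ Q i) (qJ Q j)) idfun : talg _ H -> talg _ H)
    (fun x => exists2 w, ic_map ds_P j w = 0 & ic_map ds_P i w = x) (ds_l i j);
  ds_R : forall i j, dgAlg (talg (qalg (ideal_sum (qJ Q i) (qJ Q j))) H);
  ds_r : forall i j, alghom (gtens (ds_GB j) ds_GH) (ds_R i j);
  ds_rP : forall i j, is_quotient
    (tmap (qmapr (qJ Q i) (qJ Q j)) idfun : talg _ H -> talg _ H)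
    (fun x => exists2 w, ic_map ds_P i w = 0 & ic_map ds_P j w = x) (ds_r i j);
  ds_phi : forall i j, alghom (ds_R i j) (ds_L i j);
  ds_phiP : forall i j, dg_extends (qphi Q i j) (ds_phi i j);
  ds_phi_bij : forall i j, bijective (ds_phi i j)
}.

Lemma ic_calcP (K : fieldType) (I : finType) (A : uAlg K) (C : I -> uAlg K)
    (G : forall i, dgAlg (C i)) (f : forall i, alghom A (C i))
    (X : inducedCalc G f) : is_calculus X.
Proof.
move=> S S1 SD SZ SM Sa Sd x; have [w <-] := ic_quot_surj x.
have [q1 _ q3] := ic_quotP X.
apply: ((ic_univP X).1 (fun w => S (ic_quot X w))).
- by rewrite rmorph1.
- by move=> u v hu hv; rewrite raddfD /=; apply: SD.
- by move=> c u hu; rewrite linearZ /=; apply: SZ.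
- by move=> u v hu hv; rewrite rmorphM /=; apply: SM.
- by move=> a; rewrite q1; exact: Sa.
by move=> a; rewrite q3 q1; exact: Sd.
Qed.

Section Forms.
Variables (K : fieldType) (H : hopfAlg K) (I : finType) (Q : qpfb H I).
Variable G : diffStr Q.

(* Gamma(B_i) (x)^ Gamma(H). *)
Definition locP (i : I) := gtens (ds_GB G i) (ds_GH G).
Definition locPs : lmodType K := dprod (fun i => locP i : lmodType K).
Definition locBs : lmodType K := dprod (fun i => ds_GB G i : lmodType K).

Definition locPs_mul (x y : locPs) : locPs := fun i => (x i : locP i) * y i.
Definition locPs_d (x : locPs) : locPs := fun i => dg_d (locP i) (x i).

Definition GcP_set (x : locPs) : Prop :=
  forall i j, ds_l G i j (x i) = ds_phi G i j (ds_r G i j (x j)).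

Lemma GcP0 : GcP_set 0.
Proof. by move=> i j; rewrite !raddf0. Qed.
Lemma GcPD x y : GcP_set x -> GcP_set y -> GcP_set (x + y).
Proof.
move=> hx hy i j; have -> : (x + y) i = x i + y i by [].
by have -> : (x + y) j = x j + y j by []; rewrite !raddfD /= hx hy.
Qed.
Lemma GcPZ (a : K) x : GcP_set x -> GcP_set (a *: x).
Proof.
move=> hx i j; have -> : (a *: x) i = a *: x i by [].
by have -> : (a *: x) j = a *: x j by []; rewrite !linearZ /= hx.
Qed.
(* Gamma_c(P). *)
Definition GcP : submod locPs := Submod GcP0 GcPD GcPZ.

Lemma GcPM x y : GcP x -> GcP y -> GcP (locPs_mul x y).
Proof. by move=> hx hy i j; rewrite /locPs_mul !rmorphM /= hx hy. Qed.
Lemma GcP_d x : GcP x -> GcP (locPs_d x).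
Proof.
move=> hx i j; have [[_ _ hl] _ _] := ds_lP G i j.
have [[_ _ hr] _ _] := ds_rP G i j; have [_ _ hp] := ds_phiP G i j.
by rewrite /locPs_d hl hr hp hx.
Qed.

Lemma degP0 n : (fun x : locPs => forall i, homog (G := locP i) n (x i)) 0.
Proof. by move=> i; exact: homog0. Qed.
Lemma degPD n (x y : locPs) : (forall i, homog (G := locP i) n (x i)) ->
  (forall i, homog (G := locP i) n (y i)) ->
  forall i, homog (G := locP i) n ((x + y) i).
Proof. by move=> hx hy i; apply: homogD. Qed.
Lemma degPZ n (a : K) (x : locPs) : (forall i, homog (G := locP i) n (x i)) ->
  forall i, homog (G := locP i) n ((a *: x) i).
Proof. by move=> hx i; apply: homogZ. Qed.
Definition degP n : submod locPs := Submod (@degP0 n) (@degPD n) (@degPZ n).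

Definition hor_emb i : tens (ds_GB G i) H -> locP i :=
  tmap idfun (dg_inc (ds_GH G)).
Lemma hor_emb_linear i : linear (@hor_emb i).
Proof. exact: (tmap_linear (f := idfun) _ (lin_of (dg_inc (ds_GH G)))). Qed.
HB.instance Definition _ i :=
  GRing.isLinear.Build K (tens (ds_GB G i) H) (locP i) *:%R (@hor_emb i)
    (@hor_emb_linear i).

Definition horizontal (x : locPs) : Prop := forall i, exists y, @hor_emb i y = x i.
Lemma horizontal0 : horizontal 0.
Proof. by move=> i; exists 0; rewrite linear0. Qed.
Lemma horizontalD x y : horizontal x -> horizontal y -> horizontal (x + y).
Proof.
move=> hx hy i; have [x' ex] := hx i; have [y' ey] := hy i.
by exists (x' + y'); rewrite raddfD /= ex ey.
Qed.
Lemma horizontalZ (a : K) x : horizontal x -> horizontal (a *: x).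
Proof.
by move=> hx i; have [x' ex] := hx i; exists (a *: x'); rewrite linearZ /= ex.
Qed.
Definition hor_sub : submod locPs := Submod horizontal0 horizontalD horizontalZ.

(* hor Gamma_c(P), Gamma_c^1(P) and hor Gamma_c^1(P). *)
Definition horP : submod locPs := submodI GcP hor_sub.
Definition GcP1 : submod locPs := submodI GcP (degP 1).
Definition horP1 : submod locPs := submodI horP (degP 1).

Lemma horizontalM x y :
  horizontal x -> horizontal y -> horizontal (locPs_mul x y).
Proof.
move=> hx hy i; rewrite /locPs_mul; have [x' <-] := hx i; have [y' <-] := hy i.
elim/tens_ind: x' => [|a b ha hb|u h].
- by exists 0; rewrite !linear0 mul0r.
- have [c ec] := ha; have [c' ec'] := hb; exists (c + c').
  by rewrite !raddfD /= mulrDl ec ec'.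
elim/tens_ind: y' => [|a b ha hb|u' h'].
- by exists 0; rewrite !linear0 mulr0.
- have [c ec] := ha; have [c' ec'] := hb; exists (c + c').
  by rewrite !raddfD /= mulrDr ec ec'.
suff E : forall w k, @hor_emb i (w \ot k) = w \ot dg_inc (ds_GH G) k.
  elim/dg_ind: u' => [|a b ha hb|n u' hu'].
  - by exists 0; rewrite tpure0l !linear0 mulr0.
  - have [c ec] := ha; have [c' ec'] := hb; exists (c + c').
    by rewrite (bilinDl (@tpure_bilin _ _ _)) !raddfD /= mulrDr ec ec'.
  exists ((u * u') \ot (h * h')); rewrite !E.
  rewrite [RHS](gmul_homog _ _ (homog_inc _ _) hu') mul0n expr0 scale1r.
  by rewrite rmorphM.
move=> w k; rewrite /hor_emb tmap_pure //; exact: lin_of.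
Qed.

(* The identification of P with the degree zero part of Gamma_c(P). *)
Definition embP (p : qP Q) : locPs := fun i => dg_inc (locP i) (qchi Q i p).

Lemma embP_GcP p : GcP (embP p).
Proof.
move=> i j; have [[hl _ _] _ _] := ds_lP G i j.
have [[hr _ _] _ _] := ds_rP G i j; have [hp _ _] := ds_phiP G i j.
by rewrite /embP hl hr hp qphiE.
Qed.
Lemma embP_hor p : horizontal (embP p).
Proof.
move=> i; rewrite /embP; move: (qchi Q i p) => x.
elim/tens_ind: x => [|x y [x' ex] [y' ey]|b h].
- by exists 0; rewrite !linear0.
- by exists (x' + y'); rewrite !raddfD /= ex ey.
exists (dg_inc (ds_GB G i) b \ot h); rewrite /hor_emb tmap_pure //.
  by rewrite /= gincE.
exact: lin_of.
Qed.
Lemma embP_deg p : degP 0 (embP p).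
Proof. by move=> i; exact: homog_inc. Qed.
Lemma embP_horP p : horP (embP p).
Proof. by split; [exact: embP_GcP|exact: embP_hor]. Qed.

(* p, as an element of hor Gamma_c(P), and dp, as an element of Gamma_c^1(P). *)
Definition toHor (p : qP Q) : subsp horP := subsp_of (embP_horP p).
Lemma dP_GcP1 p : GcP1 (locPs_d (embP p)).
Proof.
by split=> [|i]; [apply/GcP_d/embP_GcP|apply: homog_d; exact: homog_inc].
Qed.
Definition toGcP1 (p : qP Q) : subsp GcP1 := subsp_of (dP_GcP1 p).

Lemma actl_GcP1 p (x : subsp GcP1) : GcP1 (locPs_mul (embP p) (subsp_val x)).
Proof.
have [hx dx] := subspP x; split; first by apply: GcPM => //; exact: embP_GcP.
by move=> i; apply: (homogM (m := 0) (n := 1)); [exact: homog_inc|exact: dx].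
Qed.
Definition actl (p : qP Q) (x : subsp GcP1) : subsp GcP1 :=
  subsp_of (actl_GcP1 p x).
Lemma actr_GcP1 p (x : subsp GcP1) : GcP1 (locPs_mul (subsp_val x) (embP p)).
Proof.
have [hx dx] := subspP x; split; first by apply: GcPM => //; exact: embP_GcP.
by move=> i; apply: (homogM (m := 1) (n := 0)); [exact: dx|exact: homog_inc].
Qed.
Definition actr (x : subsp GcP1) (p : qP Q) : subsp GcP1 :=
  subsp_of (actr_GcP1 p x).

Lemma horP1_GcP1 (x : subsp horP1) : GcP1 (subsp_val x).
Proof. by have [[? _] ?] := subspP x. Qed.
Definition horP1_incl (x : subsp horP1) : subsp GcP1 := subsp_of (horP1_GcP1 x).

Definition GcB_set (g : locBs) : Prop := forall i j,
  exists w w' : ds_B G,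
    [/\ ic_map (ds_B G) i w = g i, ic_map (ds_B G) j w' = g j &
        exists k k' : ds_B G,
          [/\ ic_map (ds_B G) i k = 0, ic_map (ds_B G) j k' = 0 &
              w - w' = k + k']].
Lemma GcB0 : GcB_set 0.
Proof.
move=> i j; exists 0, 0; rewrite !raddf0; split=> //; exists 0, 0.
by rewrite !raddf0 ?subr0 ?addr0.
Qed.
Lemma GcBD g h : GcB_set g -> GcB_set h -> GcB_set (g + h).
Proof.
move=> hg hh i j.
have [w [w' [e1 e2 [k [k' [e3 e4 e5]]]]]] := hg i j.
have [v [v' [f1 f2 [l [l' [f3 f4 f5]]]]]] := hh i j.
exists (w + v), (w' + v'); split;
  [by rewrite raddfD /= e1 f1|by rewrite raddfD /= e2 f2|].
exists (k + l), (k' + l'); split.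
- by rewrite raddfD /= e3 f3 addr0.
- by rewrite raddfD /= e4 f4 addr0.
by rewrite opprD addrACA e5 f5 addrACA.
Qed.
Lemma GcBZ (a : K) g : GcB_set g -> GcB_set (a *: g).
Proof.
move=> hg i j; have [w [w' [e1 e2 [k [k' [e3 e4 e5]]]]]] := hg i j.
exists (a *: w), (a *: w'); split;
  [by rewrite linearZ /= e1|by rewrite linearZ /= e2|].
exists (a *: k), (a *: k'); split.
- by rewrite linearZ /= e3 scaler0.
- by rewrite linearZ /= e4 scaler0.
by rewrite -scalerBr e5 scalerDr.
Qed.
(* Gamma_c(B): g i and g j have the same image in                             *)
(* Gamma(B) / (ker (pi_i)_Gamma + ker (pi_j)_Gamma).                          *)
Definition GcB : submod locBs := Submod GcB0 GcBD GcBZ.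

Definition iotaGc (g : locBs) : locPs := fun i => g i \ot (1 : ds_GH G).

Lemma emb1_linear i : linear (fun w : ds_GB G i => w \ot (1 : ds_GH G) : locP i).
Proof. exact: tpure_linl. Qed.
Lemma emb1M i (w v : ds_GB G i) :
  (w * v) \ot (1 : ds_GH G) =
  (w \ot (1 : ds_GH G) : locP i) * (v \ot (1 : ds_GH G)) :> locP i.
Proof.
elim/dg_ind: v => [|v v' hv hv'|n v hv].
- by rewrite mulr0 !tpure0l mulr0.
- by rewrite mulrDr !(bilinDl (@tpure_bilin _ _ _)) mulrDr hv hv'.
by rewrite [RHS](gmul_homog _ _ (@homog1 _ _ _) hv) mul0n expr0 scale1r mulr1.
Qed.

Lemma dg_d1 (A : uAlg K) (X : dgAlg A) : dg_d X 1 = 0.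
Proof.
have := dg_leibniz (1 : X) (@homog1 _ _ X).
rewrite expr0 scale1r !(mulr1, mul1r) => h.
by apply: (addrI (dg_d X 1)); rewrite -h addr0.
Qed.
Lemma emb1_d i (w : ds_GB G i) :
  dg_d (ds_GB G i) w \ot (1 : ds_GH G) =
  dg_d (locP i) (w \ot (1 : ds_GH G)) :> locP i.
Proof.
rewrite /= /gdiff (tlift_pure (gdiff_bilin _ _)).
by rewrite dg_d1 tpure0r addr0.
Qed.

Lemma ic_map_compat i j (w : ds_P G) :
  ds_l G i j (ic_map (ds_P G) i w) =
  ds_phi G i j (ds_r G i j (ic_map (ds_P G) j w)).
Proof.
have [[l1 _ l3] _ _] := ds_lP G i j; have [[r1 _ r3] _ _] := ds_rP G i j.
have [p1 _ p3] := ds_phiP G i j.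
have [mi1 _ mi3] := ic_mapP (ds_P G) i; have [mj1 _ mj3] := ic_mapP (ds_P G) j.
have E p : ds_l G i j (ic_map (ds_P G) i (dg_inc (ds_P G) p)) =
  ds_phi G i j (ds_r G i j (ic_map (ds_P G) j (dg_inc (ds_P G) p))).
  by rewrite mi1 mj1 l1 r1 p1 qphiE.
apply: ((ic_calcP (X := ds_P G)) (fun w => ds_l G i j (ic_map (ds_P G) i w) =
  ds_phi G i j (ds_r G i j (ic_map (ds_P G) j w)))).
- by rewrite !rmorph1.
- by move=> x y hx hy; rewrite !raddfD /= hx hy.
- by move=> c x hx; rewrite !linearZ /= hx.
- by move=> x y hx hy; rewrite !rmorphM /= hx hy.
- exact: E.
by move=> p; rewrite mi3 mj3 l3 r3 p3 E.
Qed.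

Lemma iotaGc_GcP g : GcB g -> GcP (iotaGc g).
Proof.
move=> hg i j; have [w [w' [e1 e2 [k [k' [e3 e4 e5]]]]]] := hg i j.
pose v := w - k.
have vi : ic_map (ds_B G) i v = g i by rewrite raddfB /= e1 e3 subr0.
have vj : ic_map (ds_B G) j v = g j.
  have -> : v = w' + k' by rewrite /v -[w](subrK w') e5 addrAC [k + k']addrC addrK addrC.
  by rewrite raddfD /= e2 e4 addr0.
have [om eom] := ic_quot_surj v.
have [F [F1 _ F3]] := (ic_univP (ds_B G)).2 _ (ds_P G) (qiota Q).
have E l : ic_map (ds_P G) l (F om) =
    ic_univ_map (ds_B G) l om \ot (1 : ds_GH G) :> locP l.
  have [m1 _ m3] := ic_mapP (ds_P G) l.
  have [u1 _ u3] := ic_univ_mapP (ds_B G) l.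
  have E0 b : ic_map (ds_P G) l (F (dg_inc _ b)) =
      ic_univ_map (ds_B G) l (dg_inc _ b) \ot (1 : ds_GH G) :> locP l.
    by rewrite F1 m1 u1 qchi_iota /= gincE rmorph1.
  apply: ((ic_univP (ds_B G)).1 (fun om => ic_map (ds_P G) l (F om) =
    ic_univ_map (ds_B G) l om \ot (1 : ds_GH G) :> locP l)).
  - by rewrite !rmorph1.
  - by move=> x y hx hy; rewrite !raddfD /= (bilinDl (@tpure_bilin _ _ _)) hx hy.
  - by move=> c x hx; rewrite !linearZ /= tpureZl hx.
  - by move=> x y hx hy; rewrite !rmorphM /= emb1M hx hy.
  - exact: E0.
  by move=> b; rewrite F3 m3 u3 E0 emb1_d.
by rewrite /iotaGc -vi -vj -eom !ic_mapE -!E; exact: ic_map_compat.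
Qed.

Lemma iotaGc_hor g : horizontal (iotaGc g).
Proof.
move=> i; exists (g i \ot (1 : H)); rewrite /hor_emb tmap_pure ?rmorph1 //.
exact: lin_of.
Qed.

Lemma iotaGc_horP (g : subsp GcB) : horP (iotaGc (subsp_val g)).
Proof. by split; [apply/iotaGc_GcP/subspP|exact: iotaGc_hor]. Qed.

Lemma horPM x y : horP x -> horP y -> horP (locPs_mul x y).
Proof.
by move=> [? ?] [? ?]; split; [exact: GcPM|exact: horizontalM].
Qed.

Definition hor_mull (g : subsp GcB) (x : subsp horP) : subsp horP :=
  subsp_of (horPM (iotaGc_horP g) (subspP x)).
Definition hor_mulr (x : subsp horP) (g : subsp GcB) : subsp horP :=
  subsp_of (horPM (subspP x) (iotaGc_horP g)).

(* id (x) Delta^Gamma. *)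
Definition locP_coact i (x : locP i) : tens (locP i) H :=
  tassocV (tmap idfun (ds_delta G) x : tens (ds_GB G i) (tens (ds_GH G) H)).

(* The restriction of (chi_i)_{Gamma_c} to W. *)
Definition chiGc (W : submod locPs) i (x : subsp W) : locP i := subsp_val x i.

(* t in W (x) H is the image of x in W under the right coaction of Gamma_c(P):*)
(* the latter is id (x) Delta^Gamma in each component and W (x) H embeds into *)
(* the sum of the (Gamma(B_i) (x)^ Gamma(H)) (x) H, so t is unique. The W used*)
(* below are subcomodules, for which t exists.                                *)
Definition coact_eq (W : submod locPs) (x : subsp W) (t : tens (subsp W) H) : Prop :=
  forall i, tmap (@chiGc W i) idfun t = locP_coact (chiGc i x).

Definition covariant (W W' : submod locPs) (f : subsp W -> subsp W') : Prop :=
  forall x t, coact_eq x t -> coact_eq (f x) (tmap f idfun t).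

Definition ker_preserving (W W' : submod locPs) (f : subsp W -> subsp W') : Prop :=
  forall i x, chiGc i x = 0 -> chiGc i (f x) = 0.

Record is_covder (D : {linear subsp horP -> subsp horP}) : Prop := {
  covder_deg : forall n x, degP n (subsp_val x) -> degP n.+1 (subsp_val (D x));
  covder_one : D (toHor 1) = 0;
  covder_covariant : covariant D;
  covder_ker : ker_preserving D
}.

Definition is_lcovder (D : {linear subsp horP -> subsp horP}) : Prop :=
  is_covder D /\
  forall n (g : subsp GcB) (x : subsp horP),
    (forall i, homog n (subsp_val g i : ds_GB G i)) ->
    subsp_val (D (hor_mull g x)) =
    locPs_mul (locPs_d (iotaGc (subsp_val g))) (subsp_val x) +
    (-1) ^+ n *: locPs_mul (iotaGc (subsp_val g)) (subsp_val (D x)).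

Definition is_rcovder (D : {linear subsp horP -> subsp horP}) : Prop :=
  is_covder D /\
  forall n (g : subsp GcB) (x : subsp horP),
    degP n (subsp_val x) ->
    subsp_val (D (hor_mulr x g)) =
    locPs_mul (subsp_val (D x)) (iotaGc (subsp_val g)) +
    (-1) ^+ n *: locPs_mul (subsp_val x) (locPs_d (iotaGc (subsp_val g))).

(* A(h) = - (id (x) eps) D_i(1 (x) h), where D_i o chi_i = chi_i o D.         *)
Definition corresponding (D : {linear subsp horP -> subsp horP}) i
    (A : {linear H -> ds_GB G i}) : Prop :=
  exists2 Di : {linear tens (ds_GB G i) H -> tens (ds_GB G i) H},
    (forall (x : subsp horP) y, hor_emb y = chiGc i x ->
       hor_emb (Di y) = chiGc i (D x)) &
    (forall h, A h =
       - tlift (fun (w : ds_GB G i) (k : H) => counit H k *: w)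
           (Di ((1 : ds_GB G i) \ot h))).

Definition maps_vanish_on (D : {linear subsp horP -> subsp horP}) (S : set H) : Prop :=
  exists2 A : forall i, {linear H -> ds_GB G i},
    (forall i, corresponding D (A i)) &
    (forall i, S `<=` [set h | A i h = 0]).

Record is_conn_projection (h : {linear subsp GcP1 -> subsp horP1}) : Prop := {
  conn_surj : forall y, exists x, h x = y;
  conn_idem : forall x, h (horP1_incl (h x)) = h x;
  conn_covariant : covariant h;
  conn_ker : ker_preserving h
}.

Definition is_lconn (h : {linear subsp GcP1 -> subsp horP1}) : Prop :=
  is_conn_projection h /\
  forall p x, subsp_val (h (actl p x)) = locPs_mul (embP p) (subsp_val (h x)).

Definition is_rconn (h : {linear subsp GcP1 -> subsp horP1}) : Prop :=
  is_conn_projection h /\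
  forall p x, subsp_val (h (actr x p)) = locPs_mul (subsp_val (h x)) (embP p).

(* The right ideal R of H corresponding to Gamma(H). *)
Definition rcideal : set H :=
  [set r | counit H r = 0 /\
    tlift (fun a b : H =>
      dg_inc (ds_GH G) (antipodeV H b) * dg_d (ds_GH G) (dg_inc (ds_GH G) a))
      (coprod H r) = 0].

End Forms.

(* Main.v *)
(* A connection hor and a covariant derivative D correspond when hor(dp) =    *)
(* D(p) for p in P. Both sides define a covariant first order operator on P,  *)
(* so in the trivialization i it is determined by a linear map A_i : H ->     *)
(* Gamma^1(B_i), namely by 1 (x) h |-> - A_i(h_1) (x) h_2.                    *)
(*                                                                            *)
(* From the A_i one recovers D on horizontal forms trivialization by          *)
(* trivialization. The result is compatible with the gluing: a compatible     *)
(* horizontal family differs from a sum of products of forms on B and         *)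
(* elements of P, to which the Leibniz rule applies, by a family vanishing at *)
(* i; its component at j lies in chi_j(ker chi_i), whose horizontal part is a *)
(* Hopf module, hence of the form N (x) H with N a differential ideal of      *)
(* Gamma(B_j), and such a subspace is stable under every local D_j.           *)
(*                                                                            *)
(* From the A_i one recovers hor on the vertical forms a dh as - A_i(h_1) (x) *)
(* a h_2. This is well defined exactly if A_i vanishes on R, because          *)
(* Gamma^1(H) is a free H-module over the right invariant forms S^-1(h_2)     *)
(* dh_1, and R is the set of h in ker eps for which these vanish. In the      *)
(* right case the invariant forms are (dh_1) S(h_2), which are, up to sign,   *)
(* the previous ones at S(h), whence S^-1(R).                                 *)

From HB Require Import structures.
Require Import Defs.
From mathcomp Require Import all_boot all_order all_algebra.
From mathcomp Require Import all_classical reals complex.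

Set Implicit Arguments.
Unset Strict Implicit.
Unset Printing Implicit Defensive.

Import GRing.Theory.
Local Open Scope ring_scope.

(** * Linear algebra *)

(** Connections and covariant derivatives restrict to the same kind of operator on P: linear,
    covariant, preserving the kernels of the trivializations, with horizontal one-forms as values
    and a Leibniz rule over B ([preconnection]). A covariant derivative D gives p |-> D(p)
    ([covder_preconnection]). A connection gives p |-> hor(dp), and the Leibniz rule holds because
    forms such as (db) p are horizontal and hence fixed by hor ([conn_preconnection]). Covariance
    forces such an operator to be, in chart i, 1 (x) h |-> - A_i(h_1) (x) h_2 for one map A_i
    ([preconnection_potential]).

    Every preconnection extends to a covariant derivative ([potential_covder]). It extends to a
    connection only if A_i vanishes on R: the connection must kill S^-1(r_2) dr_1 = 0, but the
    formula gives - A_i(r) ([conn_vanish]). If A_i does vanish there, it factors through the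
    invariant forms and defines a linear projection in each chart ([conn_potential]).

    Extensions are unique because, up to a form vanishing in chart i, a horizontal form is a sum of
    products of base forms with elements of P, and a one-form is a sum of p dp' ([hor_lift],
    [one_form_lift]). The same decomposition reduces gluing to elements vanishing at i, whose
    component at j lies in chi_j(ker chi_i). This space is treated by the Hopf module argument
    [horizontal_kernel_ext] for derivatives, and by lifting to one-forms on P for connections.

    Left and right cases run in parallel through a boolean s. The identity [eta_antipode] turns R
    into S^-1(R). *)

Lemma projection_onto (K : fieldType) (V : lmodType K) (U : submod V) :
  exists p : {linear V -> V}, (forall v, U (p v)) /\ (forall u, U u -> p u = u).
Proof.
(* Zorn's lemma gives a maximal complement of U. Membership of 0 is not demanded, so that the union
   of the empty chain qualifies; hence the alternative [A w \/ w = 0] below. *)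
pose P (A : set V) := [/\ forall x y, A x -> A y -> A (x + y),
  forall (a : K) x, A x -> A (a *: x) & forall x, A x -> U x -> x = 0].
have [|A [[AD AZ A0] Amax]] := @Zorn_bigcup V P.
  move=> F FP Ftot; split.
  - move=> x y [X FX Xx] [Y FY Yy].
    have [XY|YX] := Ftot X Y FX FY.
      by exists Y => //; have [h _ _] := FP Y FY; apply: h => //; exact: XY.
    by exists X => //; have [h _ _] := FP X FX; apply: h => //; exact: YX.
  - by move=> a x [X FX Xx]; exists X => //; have [_ h _] := FP X FX; exact: h.
  by move=> x [X FX Xx]; have [_ _ h] := FP X FX; exact: h.
have UN x : U x -> U (- x) by move=> h; rewrite -scaleN1r; exact: submodZ.
have dec v : exists u w, [/\ U u, A w \/ w = 0 & v = u + w].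
  apply: contrapT => nv.
  (* If v were outside U + A, the span of A and v would contradict maximality. *)
  pose B : set V := fun x => exists a w, (A w \/ w = 0) /\ x = a *: v + w.
  have AD' w w' : A w \/ w = 0 -> A w' \/ w' = 0 -> A (w + w') \/ w + w' = 0.
    move=> [Aw|->] [Aw'|->]; rewrite ?addr0 ?add0r; auto.
  have AZ' (a : K) w : A w \/ w = 0 -> A (a *: w) \/ a *: w = 0.
    by move=> [Aw|->]; rewrite ?scaler0; auto.
  apply: (Amax B); first split.
  - by move=> w Aw; exists 0, w; rewrite scale0r add0r; split => //; left.
  - move=> BA; apply: nv; exists 0, v; rewrite add0r; split=> //; first exact: submod0.
    by left; apply: BA; exists 1, 0; rewrite scale1r addr0; split=> //; right.
  split.
  - move=> x y [a [w [Aw ->]]] [b [w' [Aw' ->]]].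
    exists (a + b), (w + w'); split; first exact: AD'.
    by rewrite scalerDl addrACA.
  - move=> a x [b [w [Aw ->]]]; exists (a * b), (a *: w); split; first exact: AZ'.
    by rewrite scalerDr scalerA.
  move=> x [a [w [Aw ->]]] Ux.
  have [a0|an0] := eqVneq a 0.
    rewrite a0 scale0r add0r in Ux *; case: Aw => [Aw|->//]; exact: A0.
  case: nv; exists (a^-1 *: (a *: v + w)), (- (a^-1 *: w)); split.
  - exact: submodZ.
  - by rewrite -scaleN1r; apply/AZ'/AZ'.
  by rewrite scalerDr scalerA mulVf // scale1r addrK.
have uniq u w : U u -> A w \/ w = 0 -> u + w = 0 -> u = 0.
  move=> Uu [Aw|->]; last by rewrite addr0.
  move=> /eqP; rewrite addr_eq0 => /eqP e; apply/eqP.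
  by rewrite e oppr_eq0; apply/eqP/A0 => //; rewrite -[w]opprK -e; exact: UN.
pose p v := projT1 (cid (dec v)).
have pP v : U (p v) /\ (A (v - p v) \/ v - p v = 0).
  rewrite /p; case: cid => u /= [w [Uu Aw ->]]; split=> //.
  by rewrite addrC addKr.
have pE v u w : U u -> A w \/ w = 0 -> v = u + w -> p v = u.
  move=> Uu Aw e; have [Up Ap] := pP v.
  apply/eqP; rewrite -subr_eq0; apply/eqP.
  apply: (uniq _ (v - p v - w)).
  - by apply: submodD => //; exact: UN.
  - rewrite -[- w]scaleN1r; case: Ap => [Ap|->]; case: Aw => [Aw|->];
      rewrite ?scaler0 ?add0r ?addr0; auto.
  by rewrite addrACA -opprD -e subrKC subrr.
have pl : linear p.
  move=> a x y; have [Ux Ax] := pP x; have [Uy Ay] := pP y.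
  apply: (pE _ _ (a *: (x - p x) + (y - p y))).
  - by apply: submodD => //; exact: submodZ.
  - by case: Ax => [Ax|->]; case: Ay => [Ay|->]; rewrite ?scaler0 ?add0r ?addr0; auto.
  by rewrite addrACA -scalerDr !subrKC.
pose pB := GRing.isLinear.Build K V V *:%R p pl.
pose pL : {linear V -> V} := HB.pack p pB.
exists pL; split=> [v|u Uu]; first exact: (pP v).1.
by apply: (pE u u 0) => //; [right|rewrite addr0].
Qed.

Section Descent.
Variable K : fieldType.

Definition mkLin (V W : lmodType K) (f : V -> W) (fl : linear f) : {linear V -> W} :=
  HB.pack f (GRing.isLinear.Build K V W *:%R f fl).

Lemma ker_submod (V W : lmodType K) (f : V -> W) : linear f ->
  exists U : submod V, forall x, U x <-> f x = 0.
Proof.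
move=> fl; have h0 : f 0 = 0 by exact: lin0.
have hD x y : f x = 0 -> f y = 0 -> f (x + y) = 0.
  by move=> hx hy; rewrite (linD fl) hx hy addr0.
have hZ (a : K) x : f x = 0 -> f (a *: x) = 0.
  by move=> hx; rewrite (linZ _ _ fl) hx scaler0.
by exists (Submod h0 hD hZ).
Qed.

Lemma im_submod (V W : lmodType K) (f : V -> W) : linear f ->
  exists U : submod W, forall x, U x <-> exists y, f y = x.
Proof.
move=> fl; have h0 : exists y, f y = 0 by exists 0; exact: lin0.
have hD x y : (exists z, f z = x) -> (exists z, f z = y) -> exists z, f z = x + y.
  by move=> [a <-] [b <-]; exists (a + b); rewrite (linD fl).
have hZ (a : K) x : (exists z, f z = x) -> exists z, f z = a *: x.
  by move=> [b <-]; exists (a *: b); rewrite (linZ _ _ fl).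
by exists (Submod h0 hD hZ).
Qed.

(** Choose preimages [s y] of the projection of y to the image of f. The choice need not be linear,
    but [s y - p (s y)], with p a projection onto ker f, depends only on [f (s y)], which makes it
    linear. *)
Lemma generalized_inverse (V W : lmodType K) (f : V -> W) : linear f ->
  exists g : {linear W -> V}, forall x, f (g (f x)) = f x.
Proof.
move=> fl.
have [U hU] := ker_submod fl; have [U' hU'] := im_submod fl.
have [p [pU pid]] := projection_onto U; have [q [qU qid]] := projection_onto U'.
have ex y : exists x, f x = q y by apply/hU'; exact: qU.
pose s y := projT1 (cid (ex y)).
have sE y : f (s y) = q y by rewrite /s; case: cid.
have pE x x' : f x = f x' -> x - p x = x' - p x'.
  move=> e; have : p (x - x') = x - x'.
    by apply/pid/hU; rewrite (linD fl) -scaleN1r (linZ _ _ fl) e scaleN1r subrr.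
  rewrite raddfB /= => h; apply/eqP.
  by rewrite -subr_eq0 opprD addrACA -opprD h subrr.
have gl : linear (fun y => s y - p (s y)).
  move=> a x y; have e : f (s (a *: x + y)) = f (a *: s x + s y).
    by rewrite (linD fl) (linZ _ _ fl) !sE linearP.
  by rewrite (pE _ _ e) linearP scalerBr opprD addrACA.
exists (mkLin gl) => x /=.
have fp y : f (p y) = 0 by apply/hU; exact: pU.
rewrite (linD fl) -scaleN1r (linZ _ _ fl) fp scaler0 addr0 sE.
by apply: qid; apply/hU'; exists x.
Qed.

(** With f' a generalized inverse of f, take g o f': x and f' (f x) differ by an element of ker f,
    which g kills. The result lives on all of W, so it can be tensored with H without regard to the
    image of f. *)
Lemma linear_descend (V W U : lmodType K) (f : V -> W) (g : V -> U) :
  linear f -> linear g -> (forall x, f x = 0 -> g x = 0) ->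
  exists q : {linear W -> U}, forall x, q (f x) = g x.
Proof.
move=> fl gl h; have [f' f'E] := generalized_inverse fl.
exists (mkLin (lin_comp gl (lin_of f'))) => x /=.
apply/eqP; rewrite -subr_eq0 -scaleN1r -(linZ _ _ gl) -(linD gl); apply/eqP/h.
by rewrite (linD fl) (linZ _ _ fl) f'E scaleN1r subrr.
Qed.

End Descent.

Section LinearCombinators.
Variable K : fieldType.
Implicit Types U V W Z : lmodType K.

Lemma lin_id V : linear (fun x : V => x).
Proof. by []. Qed.
Lemma lin_opp V W (f : V -> W) : linear f -> linear (fun x => - f x).
Proof. by move=> fl a x y; rewrite fl opprD scalerN. Qed.
Lemma linN V W (f : V -> W) x : linear f -> f (- x) = - f x.
Proof. by move=> fl; rewrite -scaleN1r linZ // scaleN1r. Qed.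
Lemma linB V W (f : V -> W) x y : linear f -> f (x - y) = f x - f y.
Proof. by move=> fl; rewrite linD // linN. Qed.
Lemma lin_scale V W (c : K) (f : V -> W) : linear f -> linear (fun x => c *: f x).
Proof. by move=> fl a x y; rewrite fl scalerDr !scalerA mulrC. Qed.
Lemma lin_scalel V W (f : V -> K^o) (c : W) : linear f -> linear (fun x => (f x : K) *: c).
Proof. by move=> fl a x y; rewrite fl scalerDl scalerA. Qed.
Lemma lin_mull (A : uAlg K) V (f : V -> A) (c : A) : linear f -> linear (fun x => f x * c).
Proof. by move=> fl; exact: (lin_comp (mul_linl c) fl). Qed.
Lemma lin_mulr (A : uAlg K) V (f : V -> A) (c : A) : linear f -> linear (fun x => c * f x).
Proof. by move=> fl; exact: (lin_comp (mul_linr c) fl). Qed.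
Lemma lin_tpurel V W Z (f : Z -> V) (c : W) : linear f -> linear (fun x => f x \ot c).
Proof. by move=> fl; exact: (lin_comp (tpure_linl c) fl). Qed.
Lemma lin_tpurer V W Z (f : Z -> W) (c : V) : linear f -> linear (fun x => c \ot f x).
Proof. by move=> fl; exact: (lin_comp (tpure_linr c) fl). Qed.
Lemma lin_tlift U V W Z (F : U -> V -> W) (f : Z -> tens U V) :
  bilin F -> linear f -> linear (fun x => tlift F (f x)).
Proof. by move=> FB fl; exact: (lin_comp (tlift_linear FB) fl). Qed.
Lemma lin_tmap U V U' V' Z (g : U -> U') (h : V -> V') (f : Z -> tens U V) :
  linear g -> linear h -> linear f -> linear (fun x => tmap g h (f x)).
Proof. by move=> gl hl fl; exact: (lin_comp (tmap_linear gl hl) fl). Qed.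
Lemma lin_tmapl U V U' V' Z (g : Z -> U -> U') (h : V -> V') (x : tens U V) :
  (forall u, linear (fun z => g z u)) -> linear h -> linear (fun z => tmap (g z) h x).
Proof.
move=> gl hl; apply: tlift_fam => u v.
exact: (lin_comp (tpure_linl (h v)) (gl u)).
Qed.
End LinearCombinators.

Record trilin (K : fieldType) (U V W Z : lmodType K) (F : U -> V -> W -> Z) : Prop := {
  tri1 : forall v w, linear (fun u => F u v w);
  tri2 : forall u w, linear (fun v => F u v w);
  tri3 : forall u v, linear (fun w => F u v w)
}.

(* The side s selects left (s = true) or right (s = false) structures, so that *)
(* both halves of the theorem are treated at once.                            *)
Definition smul (K : fieldType) (A : uAlg K) (s : bool) (x y : A) : A :=
  if s then x * y else y * x.

Lemma lin_smull (K : fieldType) (V : lmodType K) (A : uAlg K) s (f : V -> A) (c : A) :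
  linear f -> linear (fun x => smul s (f x) c).
Proof. by case: s => fl; [exact: lin_mull|exact: lin_mulr]. Qed.
Lemma lin_smulr (K : fieldType) (V : lmodType K) (A : uAlg K) s (f : V -> A) (c : A) :
  linear f -> linear (fun x => smul s c (f x)).
Proof. by case: s => fl; [exact: lin_mulr|exact: lin_mull]. Qed.

(* Sweedler's sum: [sw f h] is the sum of the f h_1 h_2.                      *)
Definition sw (K : fieldType) (H : hopfAlg K) (W : lmodType K) (f : H -> H -> W)
  (h : H) : W := tlift f (coprod H h).

(** Solves linearity goals by recursion on the shape of the function; [lin_app] uses hypotheses
    stating linearity, bilinearity or trilinearity, and falls back on composition. *)
Ltac lin :=
  cbv beta delta [sw];
  lazymatch goal with
  | |- bilin _ => split; let v := fresh in move=> v; lin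
  | |- trilin _ => split; let v := fresh in let w := fresh in move=> v w; lin
  | |- GRing.linear_for _ (fun x => x) => exact: lin_id
  | |- GRing.linear_for _ idfun => exact: lin_id
  | |- GRing.linear_for _ (fun x => _ + _) => apply: lin_add; lin
  | |- GRing.linear_for _ (fun x => - _) => apply: lin_opp; lin
  | |- GRing.linear_for _ (fun x => _ *: _) =>
      first [apply: lin_scale | apply: lin_scalel]; lin
  | |- GRing.linear_for _ (fun x => tpure _ _) =>
      first [apply: lin_tpurel | apply: lin_tpurer]; lin
  | |- GRing.linear_for _ (fun x => _ * _) =>
      first [apply: lin_mull | apply: lin_mulr]; lin
  | |- GRing.linear_for _ (GRing.mul ?c) => exact: (mul_linr c)
  | |- GRing.linear_for _ (tpure ?c) => exact: (tpure_linr c)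
  | |- GRing.linear_for _ (GRing.scale ?c) => apply: (lin_scale c (@lin_id _ _))
  | |- GRing.linear_for _ (smul ?s ?c) => apply: (@lin_smulr _ _ _ s _ c (@lin_id _ _))
  | |- GRing.linear_for _ (fun x => smul _ _ _) =>
      first [apply: lin_smull | apply: lin_smulr]; lin
  | |- GRing.linear_for _ (fun x => tlift _ _) =>
      first [apply: lin_tlift | apply: tlift_fam; let u := fresh in let v := fresh in move=> u v]; lin
  | |- GRing.linear_for _ (GRing.Linear.sort ?f) => exact: (lin_of f)
  | |- GRing.linear_for _ (alghom_fun ?f) => exact: (alghom_linear f)
  | |- GRing.linear_for _ (tlift _) => apply: tlift_linear; lin
  | |- GRing.linear_for _ (fun x => tmap _ _ _) =>
      first [apply: lin_tmap | apply: lin_tmapl; [let u := fresh in move=> u|]]; lin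
  | |- GRing.linear_for _ (tmap _ _) => apply: tmap_linear; lin
  | |- _ => first [assumption | exact: (lin_of _) | lin_app]
  end
with lin_app :=
  match goal with
  | H : bilin _ |- _ => first [ exact: (proj1 H) | exact: (proj2 H)
       | apply: (lin_comp (proj1 H _)); lin | apply: (lin_comp (proj2 H _)); lin ]
  | H : trilin _ |- _ => first [ exact: (tri1 H) | exact: (tri2 H) | exact: (tri3 H)
       | apply: (lin_comp (tri1 H _ _)); lin | apply: (lin_comp (tri2 H _ _)); lin
       | apply: (lin_comp (tri3 H _ _)); lin ]
  | H : forall _, linear _ |- _ => first [ exact: H | apply: (lin_comp (H _)); lin ]
  | |- GRing.linear_for _ (fun x => ?f (@?E x)) =>
       apply: (@lin_comp _ _ _ _ f E); lin
  end.

Section LiftCalculus.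
Variable K : fieldType.
Implicit Types U V W Z : lmodType K.

Lemma eq_tlift U V W (f g : U -> V -> W) x :
  (forall u v, f u v = g u v) -> tlift f x = tlift g x.
Proof. by move=> e; apply: eq_bigr => p _; exact: e. Qed.

Lemma tlift_add U V W (f g : U -> V -> W) x :
  tlift f x + tlift g x = tlift (fun u v => f u v + g u v) x.
Proof. by rewrite /tlift big_split. Qed.

Lemma tlift_sub U V W (f g : U -> V -> W) x :
  tlift f x - tlift g x = tlift (fun u v => f u v - g u v) x.
Proof. by rewrite /tlift sumrB. Qed.

Lemma tlift_exchange U V U' V' W (F : U -> V -> U' -> V' -> W) x y :
  tlift (fun u v => tlift (F u v) y) x =
  tlift (fun u' v' => tlift (fun u v => F u v u' v') x) y.
Proof. exact: exchange_big. Qed.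

Lemma lin_tliftE U V W Z (f : U -> V -> W) (g : W -> Z) x : linear g ->
  g (tlift f x) = tlift (fun u v => g (f u v)) x.
Proof.
move=> gl; rewrite /tlift; elim: (repr x) => [|p s IH]; first by rewrite !big_nil lin0.
by rewrite !big_cons linD // IH.
Qed.

Lemma tlift_tmap U V U' V' W (f : U' -> V' -> W) (g : U -> U') (h : V -> V') x :
  bilin f -> linear g -> linear h ->
  tlift f (tmap g h x) = tlift (fun u v => f (g u) (h v)) x.
Proof.
move=> fB gl hl; rewrite /tmap lin_tliftE; last exact: tlift_linear.
by apply: eq_tlift => u v; rewrite tlift_pure.
Qed.

Lemma tlift_tpure U V (x : tens U V) : tlift (fun u v => u \ot v) x = x.
Proof. by symmetry; exact: tpure_sum. Qed.

Lemma tmap_tmap U V U' V' U2 V2 (f' : U' -> U2) (g' : V' -> V2) (f : U -> U') (g : V -> V') x :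
  linear f' -> linear g' -> linear f -> linear g ->
  tmap f' g' (tmap f g x) = tmap (fun u => f' (f u)) (fun v => g' (g v)) x.
Proof.
by move=> f'l g'l fl gl; rewrite {1}/tmap tlift_tmap //; apply: tmap_bilin.
Qed.

Lemma eq_tmap U V U' V' (f f' : U -> U') (g g' : V -> V') x :
  f =1 f' -> g =1 g' -> tmap f g x = tmap f' g' x.
Proof. by move=> ef eg; apply: eq_tlift => u v; rewrite ef eg. Qed.

Lemma tmap_id U V (x : tens U V) : tmap idfun idfun x = x.
Proof. exact: tlift_tpure. Qed.

End LiftCalculus.

(** * Hopf algebras *)

Section Sweedler.
Variables (K : fieldType) (H : hopfAlg K).
Implicit Types a b c h : H.
Implicit Types V W Z : lmodType K.

Lemma eq_sw W (f g : H -> H -> W) h : (forall a b, f a b = g a b) -> sw f h = sw g h.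
Proof. exact: eq_tlift. Qed.

Lemma lin_swE W Z (f : H -> H -> W) (g : W -> Z) h : linear g ->
  g (sw f h) = sw (fun a b => g (f a b)) h.
Proof. exact: lin_tliftE. Qed.

Lemma sw_tpure h : sw (fun a b => a \ot b) h = coprod H h.
Proof. exact: tlift_tpure. Qed.

(** The extension [Phi] of F to H (x) (H (x) H) is applied to both sides of [coprod_coassoc]. *)
Lemma sw_coassoc W (F : H -> H -> H -> W) h : trilin F ->
  sw (fun a b => sw (fun c d => F c d b) a) h =
  sw (fun a b => sw (fun c d => F a c d) b) h.
Proof.
move=> Ft; pose Phi x := tlift (fun u y => tlift (F u) y) x.
have PhiB : bilin (fun u y => tlift (F u) y) by lin.
have Pl : linear Phi by apply: tlift_linear.
transitivity (Phi (tmap idfun (coprod H : H -> tens H H) (coprod H h))); last first.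
  by rewrite /Phi tlift_tmap //; lin.
rewrite -coprod_coassoc.
rewrite /tmap /tassoc (lin_tliftE _ _ (tlift_linear (@tassoc_bilin2 _ _ _ _))).
rewrite (lin_tliftE _ _ Pl); apply: eq_tlift => a b.
rewrite (tlift_pure (@tassoc_bilin2 _ _ _ _)) (lin_tliftE _ _ Pl).
by apply: eq_tlift => c d; rewrite /Phi tlift_pure // tlift_pure //; lin.
Qed.

Lemma sw_mul W (f : H -> H -> W) a b : bilin f ->
  sw f (a * b) = sw (fun a1 a2 => sw (fun b1 b2 => f (a1 * b1) (a2 * b2)) b) a.
Proof.
move=> fB; have fl := tlift_linear fB.
rewrite {1}/sw rmorphM /= -[coprod H a * coprod H b]/(tmul (coprod H a) (coprod H b)).
rewrite /tmul /tlift2 (lin_tliftE _ _ fl); apply: eq_tlift => a1 a2.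
rewrite (lin_tliftE _ _ fl); apply: eq_tlift => b1 b2.
by rewrite /tmulF tlift_pure.
Qed.

Lemma sw1 W (f : H -> H -> W) : bilin f -> sw f 1 = f 1 1.
Proof. by move=> fB; rewrite /sw rmorph1 tlift_pure. Qed.

Lemma sw_counitl W (f : H -> W) h : linear f -> sw (fun a b => counit H a *: f b) h = f h.
Proof.
move=> fl; rewrite -[in RHS](coprod_counitl h) (lin_tliftE _ _ fl).
by apply: eq_tlift => a b; rewrite linZ.
Qed.
Lemma sw_counitr W (f : H -> W) h : linear f -> sw (fun a b => counit H b *: f a) h = f h.
Proof.
move=> fl; rewrite -[in RHS](coprod_counitr h) (lin_tliftE _ _ fl).
by apply: eq_tlift => a b; rewrite linZ.
Qed.

Lemma sw_antipodel h : sw (fun a b => antipode H a * b) h = counit H h *: (1 : H).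
Proof. exact: antipodel. Qed.
Lemma sw_antipoder h : sw (fun a b => a * antipode H b) h = counit H h *: (1 : H).
Proof. exact: antipoder. Qed.

Lemma counitM a b : counit H (a * b) = counit H a * counit H b :> K.
Proof. by have [_ h] := counit_monoid H; exact: h. Qed.
Lemma counit1 : counit H 1 = 1 :> K.
Proof. by have [h _] := counit_monoid H. Qed.

Lemma antipode1 : antipode H 1 = 1.
Proof.
have := sw_antipodel 1; rewrite sw1; last by lin.
by rewrite mulr1 counit1 scale1r.
Qed.

End Sweedler.

Section Antipode.
Variables (K : fieldType) (H : hopfAlg K).
Implicit Types a b c h : H.
Local Notation S := (antipode H).
Local Notation V := (antipodeV H).

Lemma sw_exchange (H' : hopfAlg K) (W : lmodType K) (F : H -> H -> H' -> H' -> W) x y :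
  sw (fun u v => sw (F u v) y) x =
  sw (fun u' v' => sw (fun u v => F u v u' v') x) y.
Proof. exact: exchange_big. Qed.

(** Collapses a Sweedler sum inside a larger expression: the antipode axioms have the shape of the
    premise, and g is the surrounding context. *)
Lemma sw_scale (W Z : lmodType K) (g : W -> Z) (f : H -> H -> W) h (e : K) x :
  linear g -> sw f h = e *: x -> sw (fun a b => g (f a b)) h = e *: g x.
Proof. by move=> gl fE; rewrite -lin_swE // fE linZ. Qed.

(** Both sides are convolution inverses of the product of H. In the sum of S(a_1 b_1) a_2 b_2 S(b_3)
    S(a_3), contracting a_2 b_2 S(b_3) S(a_3) leaves the left side, and contracting S(a_1 b_1) a_2
    b_2 leaves the right side. *)
Lemma antipodeM a b : S (a * b) = S b * S a.
Proof.
pose Q a1 a2 a3 b1 b2 b3 := S (a1 * b1) * (a2 * b2 * (S b3 * S a3)).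
transitivity (sw (fun a1 a' => sw (fun b1 b' =>
    sw (fun a2 a3 => sw (fun b2 b3 => Q a1 a2 a3 b1 b2 b3) b') a') b) a).
  have Y x y z : sw (fun a2 a3 => sw (fun b2 b3 => z * (a2 * b2 * (S b3 * S a3))) y) x =
               counit H x *: (counit H y *: z).
    transitivity (sw (fun a2 a3 => counit H y *: (z * (a2 * S a3))) x).
      apply: eq_sw => a2 a3.
      have gl : linear (fun u : H => z * (a2 * u * S a3)) by lin.
      have := sw_scale gl (sw_antipoder y); rewrite mulr1 => <-.
      by apply: eq_sw => b2 b3; rewrite !mulrA.
    have gl : linear (fun u : H => counit H y *: (z * u)) by lin.
    by have := sw_scale gl (sw_antipoder x); rewrite mulr1.
  transitivity (sw (fun a1 a' => sw (fun b1 b' =>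
      counit H a' *: (counit H b' *: S (a1 * b1))) b) a).
    transitivity (sw (fun a1 a' => counit H a' *: S (a1 * b)) a).
      by symmetry; apply: (sw_counitr a (f := fun x => S (x * b))); lin.
    apply: eq_sw => a1 a'.
    rewrite -(lin_swE _ _ (lin_scale _ (@lin_id _ _))); congr (_ *: _).
    by symmetry; apply: (sw_counitr b (f := fun x => S (a1 * x))); lin.
  by apply: eq_sw => a1 a'; apply: eq_sw => b1 b'; rewrite -Y.
transitivity (sw (fun a' a3 => sw (fun a1 a2 => sw (fun b' b3 =>
    sw (fun b1 b2 => Q a1 a2 a3 b1 b2 b3) b') b) a') a).
  rewrite (sw_coassoc (F := fun a1 a2 a3 => sw (fun b' b3 =>
    sw (fun b1 b2 => Q a1 a2 a3 b1 b2 b3) b') b)); last by rewrite /Q; lin.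
  apply: eq_sw => a1 a'; rewrite sw_exchange; apply: eq_sw => a2 a3.
  by rewrite (sw_coassoc (F := fun b1 b2 b3 => Q a1 a2 a3 b1 b2 b3)) // /Q; lin.
have E a' b' a3 b3 : sw (fun a1 a2 => sw (fun b1 b2 => Q a1 a2 a3 b1 b2 b3) b') a' =
    counit H a' *: (counit H b' *: (S b3 * S a3)).
  have gl : linear (fun u : H => u * (S b3 * S a3)) by lin.
  have := sw_scale gl (sw_antipodel (a' * b')); rewrite mul1r counitM -scalerA => <-.
  rewrite sw_mul; last by lin.
  by apply: eq_sw => a1 a2; apply: eq_sw => b1 b2; rewrite /Q !mulrA.
transitivity (sw (fun a' a3 => sw (fun b' b3 =>
    counit H a' *: (counit H b' *: (S b3 * S a3))) b) a).
  by apply: eq_sw => a' a3; rewrite sw_exchange; apply: eq_sw => b' b3.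
transitivity (sw (fun a' a3 => counit H a' *: (S b * S a3)) a).
  apply: eq_sw => a' a3.
  rewrite -(lin_swE _ _ (lin_scale _ (@lin_id _ _))); congr (_ *: _).
  by apply: (sw_counitl b (f := fun x => S x * S a3)); lin.
by apply: (sw_counitl a (f := fun x => S b * S x)); lin.
Qed.

(** Uniqueness of convolution inverses: h |-> Delta(S h) is a left inverse of Delta, and [T] is a
    right inverse by [Y]. *)
Lemma antipode_anticomul h : coprod H (S h) = sw (fun a b => S b \ot S a) h.
Proof.
pose HH := talg H H.
pose T b : HH := sw (fun c d => S d \ot S c) b.
have Tl : linear T by rewrite /T; lin.
have Dl : linear (fun a : H => coprod H (S a) : HH).
  exact: (lin_comp (alghom_linear (coprod H)) (lin_of S)).
have Y a : sw (fun b c => (coprod H b : HH) * T c) a = counit H a *: (1 : HH).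
  transitivity (sw (fun b c => sw (fun b1 b2 => sw (fun c1 c2 =>
     (b1 * S c2) \ot (b2 * S c1)) c) b) a : HH).
    apply: eq_sw => b c; rewrite -[X in X * _]sw_tpure.
    rewrite (lin_swE _ _ (mul_linl (T c))); apply: eq_sw => b1 b2.
    rewrite /T (lin_swE _ _ (mul_linr _)); apply: eq_sw => c1 c2.
    exact: talgE.
  rewrite (sw_coassoc (F := fun b1 b2 c => sw (fun c1 c2 =>
     (b1 * S c2) \ot (b2 * S c1)) c)); last by lin.
  transitivity (sw (fun b c => (b * S c) \ot (1 : H)) a : HH).
    apply: eq_sw => b b'.
    rewrite -(sw_coassoc (F := fun b2 c1 c2 => (b * S c2) \ot (b2 * S c1))); last by lin.
    transitivity (sw (fun e c2 => (counit H e : K) *: ((b * S c2) \ot (1 : H) : tens H H)) b' : HH).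
      by apply: eq_sw => e c2; apply: (sw_scale (tpure_linr _) (sw_antipoder e)).
    by apply: (sw_counitl b' (f := fun c => (b * S c) \ot (1 : H))); lin.
  by apply: (sw_scale (tpure_linl (1 : H)) (sw_antipoder a)).
transitivity (sw (fun a b => sw (fun c d => (coprod H (S a) : HH) * ((coprod H c : HH) * T d)) b) h : HH).
  transitivity (sw (fun a b => counit H b *: (coprod H (S a) : HH)) h : HH).
    by symmetry; apply: (sw_counitr h Dl).
  apply: eq_sw => a b; have := sw_scale (mul_linr (coprod H (S a) : HH)) (Y b).
  by rewrite mulr1.
have Dl' : linear (fun a : H => coprod H a : HH) := alghom_linear (coprod H).
rewrite -(sw_coassoc (F := fun a c d => (coprod H (S a) : HH) * ((coprod H c : HH) * T d))).
  transitivity (sw (fun a b => counit H a *: T b) h); last exact: sw_counitl.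
  apply: eq_sw => a b.
  have Ml : linear (fun x : H => (coprod H x : HH) * T b).
    exact: (lin_comp (mul_linl (T b)) Dl').
  have := sw_scale Ml (sw_antipodel a); rewrite rmorph1 mul1r => <-.
  by apply: eq_sw => c d; rewrite rmorphM mulrA.
split=> u v.
- exact: (lin_comp (mul_linl _) Dl).
- exact: (lin_comp (mul_linr _) (lin_comp (mul_linl _) Dl')).
exact: (lin_comp (mul_linr _) (lin_comp (mul_linr _) Tl)).
Qed.

Lemma sw_antipode (W : lmodType K) (f : H -> H -> W) h : bilin f ->
  sw f (S h) = sw (fun a b => f (S b) (S a)) h.
Proof.
move=> fB; rewrite {1}/sw antipode_anticomul (lin_swE _ _ (tlift_linear fB)).
by apply: eq_sw => a b; rewrite tlift_pure.
Qed.

Lemma counit_antipode h : counit H (S h) = counit H h.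
Proof.
have el : linear (fun x : H => counit H x : K^o) := lin_of (counit H).
have := sw_scale el (sw_antipodel h); rewrite counit1 => e.
transitivity (sw (fun a b => counit H b *: (counit H (S a) : K^o)) h : K^o).
  by symmetry; apply: (sw_counitr h (f := fun a => counit H (S a) : K^o)); lin.
rewrite -[RHS]mulr1; apply: etrans e.
by apply: eq_sw => a b; rewrite counitM mulrC.
Qed.

Lemma antipodeVM a b : V (a * b) = V b * V a.
Proof. by apply: (can_inj (@antipodeK K H)); rewrite antipodeM !antipodeVK. Qed.

Lemma sw_antipodeV h : sw (fun a b => V b * a) h = counit H h *: (1 : H).
Proof.
apply: (can_inj (@antipodeK K H)); rewrite linearZ /= antipode1 -sw_antipodel.
by rewrite (lin_swE _ _ (lin_of S)); apply: eq_sw => a b; rewrite antipodeM antipodeVK.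
Qed.

(** Chosen so that S^-1(h_2) h_1 = eps(h) and h_1 S(h_2) = eps(h) become the single identity
    [sw_santipode]. *)
Definition santipode (s : bool) : {linear H -> H} := if s then V else S.

Lemma santipodeM s a b : santipode s (a * b) = santipode s b * santipode s a.
Proof. by case: s; [exact: antipodeVM|exact: antipodeM]. Qed.

Lemma sw_santipode s h :
  sw (fun a b => smul s (santipode s b) a) h = counit H h *: (1 : H).
Proof. by case: s; [exact: sw_antipodeV|exact: sw_antipoder]. Qed.

Section InvariantForm.
Variable X : dgAlg H.

(* The one-forms S^-1(h_2) d h_1 for s = true and (d h_1) S(h_2) for s = false. *)
Definition eta (s : bool) h : X :=
  sw (fun a b => smul s (dg_inc X (santipode s b)) (dg_d X (dg_inc X a))) h.

Lemma eta_linear s : linear (eta s).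
Proof. by rewrite /eta; lin. Qed.

Lemma eta_homog s h : homog 1 (eta s h).
Proof.
rewrite /homog (lin_swE _ _ (lin_of (dg_pr X 1))); apply: eq_sw => a b.
have hd : homog 1 (dg_d X (dg_inc X a)) by apply: homog_d; exact: homog_inc.
have hi := homog_inc X (santipode s b).
by case: s hi => hi; [exact: (homogM hi hd)|exact: (homogM hd hi)].
Qed.

(** The left side is h_1 dS(h_2), and differentiating h_1 S(h_2) = eps(h) shows that it cancels
    (dh_1) S(h_2). This is how S^-1(R) enters the right case. *)
Lemma eta_antipode h : eta true (S h) = - eta false h.
Proof.
rewrite /eta sw_antipode; last by lin.
apply/eqP; rewrite -subr_eq0 opprK; apply/eqP.
have /= := sw_scale (lin_comp (lin_of (dg_d X)) (alghom_linear (dg_inc X))) (sw_antipoder h).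
rewrite rmorph1 dg_d1 scaler0 => e; rewrite -{}[RHS]e.
rewrite /sw /tlift -big_split /=; apply: eq_bigr => p _ /=.
by rewrite antipodeK rmorphM /= (dg_leibniz _ (homog_inc X _)) expr0 scale1r addrC.
Qed.

End InvariantForm.
End Antipode.

(** * Differential calculi *)

Section Calculus.
Variables (K : fieldType) (A : uAlg K) (X : dgAlg A).
Hypothesis calcX : is_calculus X.
Implicit Types (x y : X) (a b : A).
Local Notation inc := (dg_inc X).
Local Notation d := (dg_d X).
Local Notation pr := (dg_pr X).

(** The induction on x proves that P y implies P (x y) for all y, and is then used at y = 1;
    products of generators become successive left multiplications. *)
Lemma calculus_left_ind (P : X -> Prop) :
  P 1 -> (forall x y, P x -> P y -> P (x + y)) -> (forall c x, P x -> P (c *: x)) ->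
  (forall a x, P x -> P (inc a * x)) -> (forall a x, P x -> P (d (inc a) * x)) ->
  forall x, P x.
Proof.
move=> P1 PD PZ Pi Pd x; rewrite -[x]mulr1; move: x (1 : X) P1.
apply: calcX => [y Py|x x' hx hx' y Py|c x hx y Py|x x' hx hx' y Py|a y|a y].
- by rewrite mul1r.
- by rewrite mulrDl; apply: PD; [exact: hx|exact: hx'].
- by rewrite ua_scalerAl; apply/PZ/hx.
- by rewrite -mulrA; apply/hx/hx'.
- exact: Pi.
exact: Pd.
Qed.

Lemma d_mul_inc a b : d (inc a) * inc b = d (inc (a * b)) - inc a * d (inc b).
Proof. by rewrite rmorphM /= (dg_leibniz _ (homog_inc X a)) expr0 scale1r addrK. Qed.

(** The rule (da) b = d(ab) - a db moves functions to the left, so the monomials a db_1 ... db_n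
    span. *)
Lemma calculus_monomial_ind (P : X -> Prop) :
  (forall x y, P x -> P y -> P (x + y)) -> (forall c x, P x -> P (c *: x)) ->
  (forall a (s : seq A), P (inc a * \prod_(b <- s) d (inc b))) -> forall x, P x.
Proof.
(* The predicate is quantified inside the induction, because left multiplication by a needs the
   hypothesis for y |-> Q (a y). *)
pose good (Q : X -> Prop) := [/\ forall x y, Q x -> Q y -> Q (x + y),
  forall c x, Q x -> Q (c *: x) & forall a s, Q (inc a * \prod_(b <- s) d (inc b))].
move=> PD PZ Pm x; have : good P by [].
move: x P {PD PZ Pm}; apply: calculus_left_ind => [|x y hx hy|c x hx|a x hx|a x hx] Q gQ;
  have [QD QZ Qm] := gQ.
- by have := Qm 1 [::]; rewrite big_nil rmorph1 mulr1.
- by apply: QD; [exact: hx|exact: hy].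
- by apply: QZ; exact: hx.
- apply: (hx (fun y => Q (inc a * y))); split.
  + by move=> y z hy hz; rewrite mulrDr; exact: QD.
  + by move=> c y hy; rewrite ua_scalerAr; exact: QZ.
  by move=> b s; rewrite mulrA -rmorphM; exact: Qm.
apply: (hx (fun y => Q (d (inc a) * y))); split.
- by move=> y z hy hz; rewrite mulrDr; exact: QD.
- by move=> c y hy; rewrite ua_scalerAr; exact: QZ.
move=> b s; rewrite mulrA d_mul_inc mulrBl -mulrA; apply: QD.
  by have := Qm 1 (a * b :: s); rewrite big_cons rmorph1 mul1r.
by rewrite -scaleN1r; apply: QZ; have := Qm a (b :: s); rewrite big_cons.
Qed.

Lemma pr_mulD m n x y : homog m x -> pr (m + n) (x * y) = x * pr n y.
Proof.
move=> hx; elim/dg_ind: y => [|y z hy hz|k y hy].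
- by rewrite mulr0 !linear0 mulr0.
- by rewrite mulrDr !raddfD /= mulrDr hy hz.
rewrite (homog_prE _ (homogM hx hy)) (homog_prE _ hy) eqn_add2l.
by case: ifP; rewrite ?mulr0.
Qed.

Lemma pr_mul_lt m n x y : homog m x -> (n < m)%N -> pr n (x * y) = 0.
Proof.
move=> hx lt; elim/dg_ind: y => [|y z hy hz|k y hy].
- by rewrite mulr0 linear0.
- by rewrite mulrDr raddfD /= hy hz addr0.
rewrite (homog_prE _ (homogM hx hy)) ifN //; apply/eqP => e.
by move: lt; rewrite e ltnNge leq_addr.
Qed.

Lemma d_inc_homog a : homog 1 (d (inc a)).
Proof. by apply: homog_d; exact: homog_inc. Qed.

Lemma homog0P x : homog 0 x -> exists a, inc a = x.
Proof. by move/dg_inc_im. Qed.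

Lemma degree1_left_ind (P : X -> Prop) : P 0 ->
  (forall x y, P x -> P y -> P (x + y)) ->
  (forall a b, P (inc a * d (inc b))) -> forall x, homog 1 x -> P x.
Proof.
pose good (Q : X -> Prop) := [/\ Q 0, forall x y, Q x -> Q y -> Q (x + y) &
  forall a b, Q (inc a * d (inc b))].
move=> P0 PD Pm x hx; rewrite -hx; have : good P by [].
move: x P {P0 PD Pm hx}; apply: calculus_left_ind => [|x y hx hy|c x hx|a x hx|a x hx] Q gQ;
  have [Q0 QD Qm] := gQ.
- by rewrite (homog_prE _ (@homog1 _ _ X)).
- by rewrite raddfD /=; apply: QD; [exact: hx|exact: hy].
- rewrite linearZ /=; apply: (hx (fun y => Q (c *: y))); split.
  + by rewrite scaler0.
  + by move=> y z hy hz; rewrite scalerDr; exact: QD.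
  by move=> a b; rewrite -ua_scalerAl -linearZ; exact: Qm.
- rewrite -[1%N]add0n pr_mulD; last exact: homog_inc.
  apply: (hx (fun y => Q (inc a * y))); split.
  + by rewrite mulr0.
  + by move=> y z hy hz; rewrite mulrDr; exact: QD.
  by move=> b c; rewrite mulrA -rmorphM; exact: Qm.
rewrite -[1%N]addn0 pr_mulD; last exact: d_inc_homog.
have [b <-] := homog0P (homog_pr 0 x); rewrite d_mul_inc; apply: QD.
  by have := Qm 1 (a * b); rewrite rmorph1 mul1r.
by rewrite -mulNr -rmorphN; exact: Qm.
Qed.

(** The right-handed generators suffice because a db = d(ab) 1 - (da) b. *)
Lemma degree1_ind s (P : X -> Prop) : P 0 ->
  (forall x y, P x -> P y -> P (x + y)) ->
  (forall a b, P (smul s (inc a) (d (inc b)))) -> forall x, homog 1 x -> P x.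
Proof.
case: s => P0 PD Pm; first exact: degree1_left_ind.
apply: degree1_left_ind => // a b.
have -> : inc a * d (inc b) = d (inc (a * b)) * inc 1 + d (inc (- a)) * inc b.
  rewrite rmorph1 mulr1 !raddfN /= mulNr d_mul_inc opprB addrC.
  by rewrite subrK.
by apply: PD; exact: Pm.
Qed.

End Calculus.

Section TensorMult.
Variable K : fieldType.

Lemma tmap_mul (A B A' B' : uAlg K) (f : A -> A') (g : B -> B') (x y : talg A B) :
  linear f -> linear g -> {morph f : a b / a * b} -> {morph g : a b / a * b} ->
  tmap f g (x * y) = (tmap f g x : talg A' B') * tmap f g y.
Proof.
move=> fl gl fM gM; have tl := tmap_linear fl gl.
elim/tens_ind: x => [|x x' hx hx'|a b].
- by rewrite mul0r (lin0 tl) mul0r.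
- by rewrite mulrDl !(linD tl) hx hx' mulrDl.
elim/tens_ind: y => [|y y' hy hy'|a' b'].
- by rewrite mulr0 (lin0 tl) mulr0.
- by rewrite mulrDr !(linD tl) hy hy' mulrDr.
by rewrite talgE !tmap_pure // fM gM talgE.
Qed.

Lemma tmap_derivation (A A' B : uAlg K) (f D : A -> A') (x y : talg A B) :
  linear f -> linear D -> (forall a b, D (a * b) = D a * f b + f a * D b) ->
  tmap D idfun (x * y) =
  (tmap D idfun x : talg A' B) * tmap f idfun y + (tmap f idfun x : talg A' B) * tmap D idfun y.
Proof.
move=> fl Dl DM; have tl := tmap_linear fl (@lin_id _ B); have Tl := tmap_linear Dl (@lin_id _ B).
elim/tens_ind: x => [|x x' hx hx'|a b].
- by rewrite mul0r !(lin0 tl, lin0 Tl) !mul0r addr0.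
- by rewrite mulrDl !(linD tl, linD Tl) hx hx' !mulrDl addrACA.
elim/tens_ind: y => [|y y' hy hy'|a' b'].
- by rewrite mulr0 !(lin0 tl, lin0 Tl) !mulr0 addr0.
- by rewrite mulrDr !(linD tl, linD Tl) hy hy' !mulrDr addrACA.
by rewrite talgE !tmap_pure // DM !talgE (bilinDl (@tpure_bilin _ _ _)).
Qed.

End TensorMult.

Section RightCovariant.
Variables (K : fieldType) (H : hopfAlg K) (X : dgAlg H).
Hypothesis calcX : is_calculus X.
Variable delta : {linear X -> tens X H}.
Hypothesis covX : right_covariant delta.
Local Notation inc := (dg_inc X).
Local Notation d := (dg_d X).
Local Notation pr := (dg_pr X).
Local Notation XH := (talg X H).

Lemma delta_inc h : delta (inc h) = tmap inc idfun (coprod H h).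
Proof. by have := covX.1 h [::]; rewrite !big_nil !mulr1. Qed.

Lemma delta_d_inc h : delta (d (inc h)) = tmap (fun a => d (inc a)) idfun (coprod H h).
Proof.
have := covX.1 1 [:: h]; rewrite !big_seq1 !rmorph1 mul1r => ->.
by rewrite [tmap _ _ (1 : talg H H)]tmap_pure ?rmorph1 ?mul1r //; lin.
Qed.

Lemma delta_mul_inc h x : delta (inc h * x) = (delta (inc h) : XH) * delta x.
Proof.
have il : linear inc := alghom_linear inc.
elim/(calculus_monomial_ind calcX): x => [x y hx hy|c x hx|a s].
- by rewrite mulrDr !raddfD /= hx hy mulrDr.
- by rewrite ua_scalerAr !linearZ /= hx; exact: (esym (@ua_scalerAr _ XH c _ _)).
rewrite mulrA -rmorphM !covX.1 delta_inc.
rewrite [coprod H (h * a)]rmorphM /= tmap_mul ?mulrA //; exact: rmorphM.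
Qed.

(** Right covariance prescribes delta only on monomials a dh_1 ... dh_n. The product with dh is
    brought to this form by (dh) a = d(ha) - h da, and the Leibniz rule for d (x) id matches the
    resulting terms. *)
Lemma delta_mul_d_inc h x : delta (d (inc h) * x) = (delta (d (inc h)) : XH) * delta x.
Proof.
have il : linear inc := alghom_linear inc.
have dl : linear (fun a => d (inc a)) := lin_comp (lin_of d) il.
elim/(calculus_monomial_ind calcX): x => [x y hx hy|c x hx|a s].
- by rewrite mulrDr !raddfD /= hx hy mulrDr.
- by rewrite ua_scalerAr !linearZ /= hx; exact: (esym (@ua_scalerAr _ XH c _ _)).
rewrite mulrA d_mul_inc mulrBl raddfB /=.
have := covX.1 1 (h * a :: s); rewrite !big_cons rmorph1 mul1r => ->.
rewrite -mulrA; have := covX.1 h (a :: s); rewrite !big_cons => ->.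
rewrite covX.1 delta_d_inc [coprod H 1]rmorph1 [tmap _ _ (1 : talg H H)]tmap_pure //.
rewrite rmorph1 mul1r [RHS]mulrA [_ * (_ * \prod_(_ <- _) _)]mulrA.
rewrite [coprod H (h * a)]rmorphM /= (@tmap_derivation _ _ _ _ inc (d \o inc)) //.
  by rewrite mulrDl; exact: addrK.
by move=> b c; rewrite /= rmorphM /= (dg_leibniz _ (homog_inc X b)) expr0 scale1r.
Qed.

Lemma delta1 : delta 1 = (1 : XH).
Proof. by rewrite -(rmorph1 inc) delta_inc rmorph1 tmap_pure ?rmorph1 //; lin. Qed.

Lemma deltaM x y : delta (x * y) = (delta x : XH) * delta y.
Proof.
move: x y; apply: calcX => [y|x x' hx hx' y|c x hx y|x x' hx hx' y|h y|h y].
- by rewrite delta1 !mul1r.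
- by rewrite mulrDl !raddfD /= hx hx' mulrDl.
- by rewrite ua_scalerAl !linearZ /= hx; exact: (esym (@ua_scalerAl _ XH c _ _)).
- by rewrite -mulrA !hx hx' mulrA.
- exact: delta_mul_inc.
exact: delta_mul_d_inc.
Qed.

(** Each generator h or dh goes to a sum of generators of the same degree tensored with H, so
    degrees are kept along products. *)
Lemma delta_pr n x : delta (pr n x) = tmap (pr n) idfun (delta x).
Proof.
have prl k : linear (tmap (pr k) (@idfun H)) by lin.
have prM k (g : X -> X) (f : H -> X) (a : tens H H) (y : XH) : linear g -> linear f ->
    (forall h z, pr k (f h * z) = f h * g z) ->
    tmap (pr k) idfun ((tmap f idfun a : XH) * y) = (tmap f idfun a : XH) * tmap g idfun y.
  move=> gl fl fE; have gL : linear (tmap g (@idfun H)) by lin.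
  have fl' : linear (tmap f (@idfun H)) by lin.
  elim/tens_ind: a => [|a b ha hb|a b].
  - by rewrite (lin0 fl') !mul0r (lin0 (prl k)).
  - by rewrite (linD fl') !mulrDl (linD (prl k)) ha hb.
  elim/tens_ind: y => [|y z hy hz|u v].
  - by rewrite (lin0 gL) !mulr0 (lin0 (prl k)).
  - by rewrite (linD gL) !mulrDr (linD (prl k)) hy hz.
  by rewrite tmap_pure // tmap_pure ?talgE ?tmap_pure ?fE ?talgE //; lin.
have il : linear inc := alghom_linear inc.
have dl : linear (fun a => d (inc a)) := lin_comp (lin_of d) il.
move: x n; apply: (calculus_left_ind calcX) => [n|x y hx hy n|c x hx n|h x hx n|h x hx n].
- rewrite (homog_prE _ (@homog1 _ _ X)) delta1 [tmap _ _ (1 : XH)]tmap_pure; [|lin|lin].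
  by rewrite (homog_prE _ (@homog1 _ _ X)); case: ifP; rewrite ?delta1 // linear0 tpure0l.
- by rewrite !raddfD /= hx hy.
- by rewrite !linearZ /= hx.
- rewrite -[n]add0n (pr_mulD _ _ (homog_inc X h)) !deltaM hx delta_inc.
  rewrite (prM _ (pr n)) //; [lin|] => a z; rewrite -[X in pr X]add0n; exact: (pr_mulD _ _ (homog_inc X a)).
rewrite !deltaM delta_d_inc; case: n => [|n].
  rewrite (pr_mul_lt _ (d_inc_homog X h)) // linear0.
  rewrite (prM _ (fun=> 0)) // => [|a y z|a z]; last first.
  - by rewrite (pr_mul_lt _ (d_inc_homog X a)) // mulr0.
  - by rewrite scaler0 addr0.
  rewrite [tmap (fun=> 0) _ _]/tmap /tlift big1 ?mulr0 // => p _.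
  by rewrite tpure0l.
rewrite -[n.+1]add1n (pr_mulD _ _ (d_inc_homog X h)) deltaM hx delta_d_inc.
by rewrite (prM _ (pr n)) //; [lin|] => a z; exact: (pr_mulD _ _ (d_inc_homog X a)).
Qed.

End RightCovariant.

(** * Coactions on forms *)

Section TrivialCalculus.
Variables (K : fieldType) (A : uAlg K).

Definition triv_pr (n : nat) (x : A) : A := if n == 0%N then x else 0.
Lemma triv_pr_linear n : linear (triv_pr n).
Proof. by move=> c x y; rewrite /triv_pr; case: ifP; rewrite // scaler0 addr0. Qed.
Lemma idfun_monoid : monoid_morphism (fun x : A => x).
Proof. by []. Qed.
Lemma zero_linear : linear (fun _ : A => 0 : A).
Proof. by move=> c x y; rewrite scaler0 addr0. Qed.

Lemma triv_pr_pr m n x :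
  mkLin (triv_pr_linear m) (mkLin (triv_pr_linear n) x) =
  if m == n then mkLin (triv_pr_linear n) x else 0.
Proof. by rewrite /= /triv_pr; case: m n => [|m] [|n] //=; rewrite if_same. Qed.
Lemma triv_pr_sum x : exists N, x = \sum_(n < N) mkLin (triv_pr_linear n) x.
Proof. by exists 1%N; rewrite big_ord1. Qed.
Lemma triv_pr_mul m n x y : mkLin (triv_pr_linear m) x = x ->
  mkLin (triv_pr_linear n) y = y -> mkLin (triv_pr_linear (m + n)) (x * y) = x * y.
Proof.
rewrite /= /triv_pr; case: m => [|m] /=.
  by case: n => [|n] //= _ <-; rewrite mulr0.
by move=> <- _; rewrite mul0r.
Qed.
Lemma triv_inc_inj : injective (AlgHom (@lin_id _ A) idfun_monoid).
Proof. by []. Qed.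
Lemma triv_inc_im x : mkLin (triv_pr_linear 0) x = x <->
  exists a, AlgHom (@lin_id _ A) idfun_monoid a = x.
Proof. by split=> // _; exists x. Qed.
Lemma triv_d_deg n x : mkLin (triv_pr_linear n) x = x ->
  mkLin (triv_pr_linear n.+1) (mkLin zero_linear x) = mkLin zero_linear x.
Proof. by []. Qed.
Lemma triv_d_d x : mkLin zero_linear (mkLin zero_linear x) = 0.
Proof. by []. Qed.
Lemma triv_leibniz n x y : mkLin (triv_pr_linear n) x = x ->
  mkLin zero_linear (x * y) =
  mkLin zero_linear x * y + (-1) ^+ n *: (x * mkLin zero_linear y).
Proof. by rewrite /= mul0r mulr0 scaler0 addr0. Qed.

(* With [A := H] this makes Omega(P) (x) H a differential algebra, to which   *)
(* the coaction P -> P (x) H extends by universality of Omega(P).             *)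
Definition triv_calc : dgAlg A :=
  DgAlg triv_pr_pr triv_pr_sum (erefl : mkLin (triv_pr_linear 0) 1 = 1)
    triv_pr_mul triv_inc_inj triv_inc_im triv_d_deg triv_d_d triv_leibniz.

Lemma triv_homog x : homog 0 (x : triv_calc).
Proof. by []. Qed.

(** The second factor sits in degree zero, so no sign appears. *)
Lemma gmul_triv (A' : uAlg K) (X : dgAlg A') (x y : tens X A) :
  gmul (G2 := triv_calc) x y = tmul x y.
Proof.
have glx z : linear (fun x => gmul (G2 := triv_calc) x z) := @gmul_linl _ _ _ X triv_calc z.
have gly z : linear (gmul (G2 := triv_calc) z) := @gmul_linr _ _ _ X triv_calc z.
elim/tens_ind: x => [|x x' hx hx'|u a].
- by rewrite (lin0 (glx y)) (lin0 (tmul_linl _)).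
- by rewrite (linD (glx y)) (linD (tmul_linl _)) hx hx'.
elim/tens_ind: y => [|y y' hy hy'|u' a'].
- by rewrite (lin0 (gly _)) (lin0 (tmul_linr _)).
- by rewrite (linD (gly _)) (linD (tmul_linr _)) hy hy'.
elim/dg_ind: u' => [|v w hv hw|n v hv].
- by rewrite !tpure0l (lin0 (gly _)) (lin0 (tmul_linr _)).
- rewrite (bilinDl (@tpure_bilin _ _ _)) (linD (gly _)) (linD (tmul_linr _)).
  by rewrite hv hw.
by rewrite (gmul_homog u (a' : triv_calc) (triv_homog a) hv) mul0n expr0 scale1r tmulE.
Qed.

End TrivialCalculus.

Section Assoc.
Variable K : fieldType.
Implicit Types U V W : lmodType K.

Lemma tassocK U V W (x : tens (tens U V) W) : tassocV (tassoc x) = x.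
Proof.
elim/tens_ind: x => [|x y hx hy|x w]; first by rewrite !linear0.
  by rewrite !raddfD /= hx hy.
elim/tens_ind: x => [|x y hx hy|u v]; first by rewrite tpure0l !linear0.
  by rewrite (bilinDl (@tpure_bilin _ _ _)) !raddfD /= hx hy.
by rewrite tassocE tassocVE.
Qed.

Lemma tassocV_pure U V W (u : U) (y : tens V W) :
  tassocV (u \ot y) = tmap (fun v => u \ot v) idfun y.
Proof. by rewrite /tassocV (tlift_pure (@tassocV_bilin2 _ _ _ _)). Qed.

Variable H : hopfAlg K.
(** The coaction of the cofree comodule V (x) H. By [coP_emb] the horizontal forms in a chart are of
    this kind. *)
Definition coH V (x : tens V H) : tens (tens V H) H :=
  tassocV (tmap idfun (coprod H : H -> tens H H) x).

Lemma coH_linear V : linear (@coH V).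
Proof.
apply: (lin_comp (lin_of (@tassocV K V H H))).
by apply: tmap_linear => //; exact: (alghom_linear (coprod H)).
Qed.

Lemma coH_pure V (v : V) h : coH (v \ot h) = sw (fun a b => (v \ot a) \ot b) h.
Proof.
rewrite /coH tmap_pure //; last exact: (alghom_linear (coprod H)).
by rewrite tassocV_pure.
Qed.

Lemma tmap_coH V W (f : V -> W) (x : tens V H) : linear f ->
  coH (tmap f idfun x) = tmap (tmap f idfun) idfun (coH x).
Proof.
move=> fl; move: x; apply: tens_ext => [||v h].
- by apply: (lin_comp (@coH_linear W)); lin.
- by apply: (@lin_comp _ _ _ _ _ (@coH V)) (@coH_linear V); lin.
have tl : linear (tmap (tmap f (@idfun H)) (@idfun H)) by lin.
rewrite tmap_pure // !coH_pure (lin_swE _ _ tl).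
by apply: eq_sw => a b; rewrite !tmap_pure //; lin.
Qed.

End Assoc.

Section Local.
Variables (K : fieldType) (H : hopfAlg K) (I : finType) (Q : qpfb H I).
Variable G : diffStr Q.
Local Notation GH := (ds_GH G).
Local Notation GB := (ds_GB G).
Local Notation delta := (ds_delta G).
Local Notation coP := (@locP_coact _ _ _ _ G _).
Implicit Type i j : I.

Lemma coP_pure i (u : GB i) (v : GH) :
  coP (u \ot v : locP G i) = tmap (fun w => u \ot w : locP G i) idfun (delta v).
Proof.
rewrite /locP_coact tmap_pure //; last exact: lin_of.
exact: tassocV_pure.
Qed.

Lemma coP_linear i : linear (@locP_coact _ _ _ _ G i).
Proof.
apply: (lin_comp (lin_of (@tassocV K (GB i) GH H))).
by apply: tmap_linear => //; exact: lin_of.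
Qed.

Lemma emb_pure i (w : GB i) (h : H) : hor_emb (G := G) (w \ot h) = w \ot dg_inc GH h.
Proof. by rewrite /hor_emb tmap_pure //; exact: lin_of. Qed.

Lemma coP_emb i (y : tens (GB i) H) : coP (hor_emb y) = tmap (@hor_emb _ _ _ _ G i) idfun (coH y).
Proof.
have el : linear (@hor_emb _ _ _ _ G i) := lin_of (@hor_emb _ _ _ _ G i).
move: y; apply: tens_ext => [||u h].
- exact: (lin_comp (@coP_linear i) el).
- by apply: (lin_comp (tmap_linear el _) (@coH_linear _ _ _)).
have tl : linear (tmap (@hor_emb _ _ _ _ G i) (@idfun H)) by lin.
rewrite emb_pure coP_pure (delta_inc (ds_deltaP G)) coH_pure (lin_swE _ _ tl).
rewrite tmap_tmap //; [|exact: tpure_linr|exact: alghom_linear].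
by rewrite /tmap; apply: eq_tlift => a b; rewrite tlift_pure ?emb_pure //; apply: tmap_bilin.
Qed.

(** The sign of the graded product depends on the degree of v, which the coaction preserves by
    [delta_pr]; hence the signs on both sides agree. *)
Lemma coPM i (x y : locP G i) :
  coP (x * y) = (coP x : talg (locP G i) H) * coP y.
Proof.
have cl := @coP_linear i.
pose J (u : GB i) (t : tens GH H) : talg (locP G i) H := tmap (fun w => u \ot w : locP G i) idfun t.
have Jl u : linear (J u) by rewrite /J; lin.
elim/gt_ind: x => [|x x' hx hx'|m n u v hu hv].
- by rewrite mul0r (lin0 cl) mul0r.
- by rewrite mulrDl !(linD cl) hx hx' mulrDl.
elim/gt_ind: y => [|y y' hy hy'|m' n' u' v' hu' hv'].
- by rewrite mulr0 (lin0 cl) mulr0.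
- by rewrite mulrDr !(linD cl) hy hy' mulrDr.
rewrite [X in coP X](gmul_homog u v' hv hu') (linZ _ _ cl) !coP_pure.
rewrite (deltaM (@ds_GH_calc _ _ _ _ G) (ds_deltaP G)).
rewrite -[in LHS]hv -[in RHS]hv (delta_pr (@ds_GH_calc _ _ _ _ G) (ds_deltaP G)).
rewrite -/(J (u * u') _) -/(J u _) -/(J u' _).
have pl : linear (tmap (dg_pr GH n) (@idfun H)) by lin.
elim/tens_ind: (delta v) => [|t s ht hs|w a].
- by rewrite (lin0 pl) mul0r !(lin0 (Jl _)) scaler0 mul0r.
- by rewrite (linD pl) mulrDl !(linD (Jl _)) scalerDr ht hs mulrDl.
elim/tens_ind: (delta v') => [|t s ht hs|w' a'].
- by rewrite mulr0 !(lin0 (Jl _)) scaler0 mulr0.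
- by rewrite mulrDr !(linD (Jl _)) scalerDr ht hs mulrDr.
rewrite [tmap (dg_pr GH n) _ _]tmap_pure ?[(_ \ot _ : talg GH H) * _]talgE /J ?tmap_pure //; try by lin.
apply: etrans (esym (@talgE _ (locP G i) H _ _ _ _)).
by rewrite -tpureZl -(gmul_homog u w' (homog_pr n w) hu').
Qed.

End Local.

Section GradedProduct.
Variables (K : fieldType) (A1 A2 : uAlg K) (G1 : dgAlg A1) (G2 : dgAlg A2).
Local Notation GG := (gtens G1 G2).

Lemma gmul_incl u a u' v' :
  (u \ot dg_inc G2 a : GG) * (u' \ot v') = (u * u') \ot (dg_inc G2 a * v') :> GG.
Proof.
elim/dg_ind: u' => [|x y hx hy|n u' hu].
- by rewrite tpure0l !mulr0 tpure0l.
- by rewrite (bilinDl (@tpure_bilin _ _ _)) !mulrDr hx hy (bilinDl (@tpure_bilin _ _ _)).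
by rewrite [LHS](gmul_homog u v' (homog_inc G2 a) hu) mul0n expr0 scale1r.
Qed.

Lemma gmul_incr u v b v' :
  (u \ot v : GG) * (dg_inc G1 b \ot v') = (u * dg_inc G1 b) \ot (v * v') :> GG.
Proof.
elim/dg_ind: v => [|x y hx hy|n v hv].
- by rewrite tpure0r !mul0r tpure0r.
- by rewrite (bilinDr (@tpure_bilin _ _ _)) !mulrDl hx hy (bilinDr (@tpure_bilin _ _ _)).
by rewrite [LHS](gmul_homog u v' hv (homog_inc G1 b)) muln0 expr0 scale1r.
Qed.

Lemma gmul_1l u u' v' :
  (u \ot (1 : G2) : GG) * (u' \ot v') = (u * u') \ot v' :> GG.
Proof. by have := gmul_incl u 1 u' v'; rewrite rmorph1 mul1r. Qed.

Lemma gmul_1r u v v' :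
  (u \ot v : GG) * ((1 : G1) \ot v') = u \ot (v * v') :> GG.
Proof. by have := gmul_incr u v 1 v'; rewrite rmorph1 mulr1. Qed.

End GradedProduct.

(** * Kernels of the trivializations under the coaction *)

Section Subcomodule.
Variables (K : fieldType) (H : hopfAlg K) (I : finType) (Q : qpfb H I).
Variable G : diffStr Q.
Local Notation GH := (ds_GH G).
Local Notation GB := (ds_GB G).
Local Notation coP := (@locP_coact _ _ _ _ G _).
Local Notation Om := (ic_univ (ds_P G)).
Implicit Type i j : I.

(** Universality of Omega(P) is applied to [qcoact] with target Omega(P) (x)^ [triv_calc H], where d
    acts on the first factor only. *)
Lemma universal_coaction : exists F : Om -> tens Om H,
  [/\ linear F, F 1 = (1 : talg Om H),
      forall x y, F (x * y) = (F x : talg Om H) * F y,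
      forall p, F (dg_inc Om p) = tmap (dg_inc Om) idfun (qcoact Q p) &
      forall p, F (dg_d Om (dg_inc Om p)) =
        tmap (fun q => dg_d Om (dg_inc Om q)) idfun (qcoact Q p)].
Proof.
have [F [F1 _ F3]] := (ic_univP (ds_P G)).2 _ (gtens Om (triv_calc H)) (qcoact Q).
exists F; split.
- exact: (alghom_linear F).
- exact: (rmorph1 F).
- by move=> x y; rewrite rmorphM; exact: gmul_triv.
- by move=> p; rewrite F1.
move=> p; rewrite F3 F1 /= /ginc.
have il : linear (dg_inc Om) := alghom_linear _.
have gl : linear (@gdiff _ _ _ Om (triv_calc H)) := @gdiff_linear _ _ _ _ _.
move: (qcoact Q p); apply: tens_ext => [||q h].
- by apply: (lin_comp gl); exact: tmap_linear.
- by apply: tmap_linear => //; exact: (lin_comp (lin_of (dg_d Om))).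
rewrite tmap_pure //.
rewrite tmap_pure //; last exact: (lin_comp (lin_of (dg_d Om))).
by rewrite /gdiff (tlift_pure (gdiff_bilin _ _)) /= tpure0r addr0.
Qed.

Lemma coP_chi i p : coP (dg_inc (locP G i) (qchi Q i p)) =
  tmap (fun q => dg_inc (locP G i) (qchi Q i q)) idfun (qcoact Q p).
Proof.
have E y : coP (dg_inc (locP G i) y) = tmap (dg_inc (locP G i)) idfun (coH y).
  have il : linear (dg_inc (locP G i)) := alghom_linear _.
  move: y; apply: tens_ext => [||b h].
  - exact: (lin_comp (@coP_linear _ _ _ _ G i) il).
  - by apply: (lin_comp (tmap_linear il _) (@coH_linear _ _ _)).
  rewrite /= gincE -emb_pure coP_emb !coH_pure.
  have tl : linear (tmap (@hor_emb _ _ _ _ G i) (@idfun H)) by lin.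
  have tl' : linear (tmap (ginc (GB i) GH) (@idfun H)).
    by apply: tmap_linear => //; exact: (@ginc_linear _ _ _ (GB i) GH).
  rewrite (lin_swE _ _ tl) (lin_swE _ _ tl'); apply: eq_sw => a c.
  rewrite !tmap_pure //; [|exact: lin_of].
  by rewrite emb_pure [ginc _ _ _]gincE.
rewrite E /coH qchi_coact tassocK tmap_tmap //; exact: alghom_linear.
Qed.

Lemma coP_d_chi i p : coP (dg_d (locP G i) (dg_inc (locP G i) (qchi Q i p))) =
  tmap (fun q => dg_d (locP G i) (dg_inc (locP G i) (qchi Q i q))) idfun (qcoact Q p).
Proof.
have il : linear (dg_inc (locP G i)) := alghom_linear _.
have dl : linear (fun y => dg_d (locP G i) (dg_inc (locP G i) y)).
  exact: (lin_comp (lin_of (dg_d (locP G i))) il).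
have E y : coP (dg_d (locP G i) (dg_inc (locP G i) y)) =
    tmap (fun y => dg_d (locP G i) (dg_inc (locP G i) y)) idfun (coH y).
  move: y; apply: tens_ext => [||b h].
  - exact: (lin_comp (@coP_linear _ _ _ _ G i) dl).
  - by apply: (lin_comp (tmap_linear dl _) (@coH_linear _ _ _)).
  have dE c : dg_d (locP G i) (dg_inc (locP G i) (b \ot c)) =
    dg_d (GB i) (dg_inc (GB i) b) \ot dg_inc GH c +
    dg_inc (GB i) b \ot dg_d GH (dg_inc GH c) :> locP G i.
    by rewrite /= gincE (gdiffE _ (homog_inc (GB i) b)) expr0 scale1r.
  have tl : linear (tmap (fun y => dg_d (locP G i) (dg_inc (locP G i) y)) (@idfun H)).
    exact: tmap_linear.
  rewrite dE (linD (@coP_linear _ _ _ _ G i)) coH_pure (lin_swE _ _ tl).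
  rewrite !coP_pure (delta_inc (ds_deltaP G)) (delta_d_inc (ds_deltaP G)).
  rewrite !tmap_tmap //; try exact: tpure_linr; try exact: alghom_linear; last first.
    exact: (lin_comp (lin_of (dg_d GH)) (alghom_linear _)).
  transitivity (sw (fun a c => dg_d (locP G i) (dg_inc (locP G i) (b \ot a)) \ot c) h).
    rewrite /sw /tmap tlift_add; apply: eq_tlift => a c.
    by rewrite dE (bilinDl (@tpure_bilin _ _ _)).
  by apply: eq_sw => a c; rewrite tmap_pure.
rewrite E /coH qchi_coact tassocK tmap_tmap //; exact: alghom_linear.
Qed.

(** This says that chi_j(ker chi_i) is a subcomodule, tested against linear maps r vanishing on it.
    The coactions in all charts come from the one on Omega(P); there r o chi_j factors through chi_i
    by [linear_descend], and the coaction of chi_i(w) = 0 is zero. *)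
Lemma ker_subcomodule i j (W : lmodType K) (r : locP G j -> W) : linear r ->
  (forall w, ic_map (ds_P G) i w = 0 -> r (ic_map (ds_P G) j w) = 0) ->
  forall w, ic_map (ds_P G) i w = 0 -> tmap r idfun (coP (ic_map (ds_P G) j w)) = 0.
Proof.
move=> rl hr w; have [F [Fl F1 FM Fi Fd]] := universal_coaction.
have ul k : linear (ic_univ_map (ds_P G) k) := alghom_linear _.
have E k om : coP (ic_univ_map (ds_P G) k om) = tmap (ic_univ_map (ds_P G) k) idfun (F om).
  have [u1 _ u3] := ic_univ_mapP (ds_P G) k.
  have cl := @coP_linear _ _ _ _ G k.
  have tl : linear (tmap (ic_univ_map (ds_P G) k) (@idfun H)) by apply: tmap_linear; [exact: ul|].
  have il : linear (dg_inc Om) := alghom_linear _.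
  move: om; apply: (ic_univP (ds_P G)).1 => [|x y hx hy|c x hx|x y hx hy|p|p].
  - have m1 := rmorph1 (ic_univ_map (ds_P G) k).
    rewrite m1 F1 [RHS]tmap_pure ?m1 //; last exact: ul.
    have := @coP_emb _ _ _ _ G k ((1 : GB k) \ot (1 : H)).
    rewrite emb_pure rmorph1 => ->; rewrite coH_pure sw1; last by lin.
    by rewrite tmap_pure ?emb_pure ?rmorph1 //; exact: lin_of.
  - by rewrite (linD (ul k)) (linD cl) (linD Fl) hx hy (linD tl).
  - by rewrite (linZ _ _ (ul k)) (linZ _ _ cl) (linZ _ _ Fl) hx (linZ _ _ tl).
  - have mM := rmorphM (ic_univ_map (ds_P G) k).
    rewrite mM coPM hx hy FM; symmetry.
    by apply: tmap_mul => //; exact: ul.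
  - rewrite u1 coP_chi Fi (tmap_tmap _ (ul k) (@lin_id _ H) il (@lin_id _ H)).
    by apply: eq_tmap => // q; rewrite u1.
  have dl : linear (fun q => dg_d Om (dg_inc Om q)) := lin_comp (lin_of (dg_d Om)) il.
  rewrite u3 u1 coP_d_chi Fd (tmap_tmap _ (ul k) (@lin_id _ H) dl (@lin_id _ H)).
  by apply: eq_tmap => // q; rewrite u3 u1.
have [om <-] := ic_quot_surj w; rewrite !ic_mapE => h0.
have rul : linear (fun om => r (ic_univ_map (ds_P G) j om)) := lin_comp rl (ul j).
have [|q qE] := linear_descend (ul i) rul.
  by move=> o ho; rewrite -ic_mapE; apply: hr; rewrite ic_mapE.
rewrite E (tmap_tmap _ rl (@lin_id _ H) (ul j) (@lin_id _ H)); transitivity (tmap (fun o => q (ic_univ_map (ds_P G) i o)) idfun (F om)).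
  by apply: eq_tmap => // o; rewrite qE.
have ql := lin_of q; rewrite -(tmap_tmap _ ql (@lin_id _ H) (ul i) (@lin_id _ H)) -E h0.
by rewrite (lin0 (@coP_linear _ _ _ _ G i)) (lin0 (tmap_linear ql (@lin_id _ H))).
Qed.

(* The kernel of [ds_r G i j] on horizontal forms is a sub-Hopf module of     *)
(* Gamma(B_j) (x) H, hence of the form N (x) H.                               *)
Lemma horizontal_kernel_ext i j (W : lmodType K) (T : tens (GB j) H -> W) :
  linear T ->
  (forall (k : GB j) h, ds_r G i j (k \ot (1 : GH)) = 0 -> T (k \ot h) = 0) ->
  forall y, ds_r G i j (hor_emb y) = 0 -> T y = 0.
Proof.
move=> Tl hT y hy; pose r := ds_r G i j; pose f (k : GB j) := r (k \ot (1 : GH)).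
have rl : linear r := alghom_linear _.
have fl : linear f by apply: (lin_comp rl); exact: tpure_linl.
have el : linear (@hor_emb _ _ _ _ G j) := lin_of (@hor_emb _ _ _ _ G j).
have rel : linear (fun y => r (hor_emb y)) := lin_comp rl el.
have [_ _ rP] := ds_rP G i j.
have fy0 : tmap f idfun y = 0.
  have [w wi wj] := (rP _).1 hy.
  have t0 : tmap (fun y => r (hor_emb y)) idfun (coH y) = 0.
    rewrite -(tmap_tmap _ rl (@lin_id _ H) el (@lin_id _ H)) -coP_emb -wj.
    by apply: (ker_subcomodule rl _ wi) => v vi; apply/rP; exists v.
  (* [C] sends x (x) a (x) b to x S(a) (x) b. After two coactions it returns r(g h_1 S(h_2)) (x) h_3
     = f(g) (x) h, as in the structure theorem for Hopf modules. *)
  pose C (t : tens (tens (ds_R G i j) H) H) : tens (ds_R G i j) H :=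
    tlift (fun t b => tlift (fun (x : ds_R G i j) a =>
      x * r ((1 : GB j) \ot dg_inc GH (antipode H a))) t \ot b) t.
  have gl : linear (fun a : H => r ((1 : GB j) \ot dg_inc GH (antipode H a))).
    apply: (lin_comp rl); apply: (@lin_comp _ _ _ _ _ _ (tpure_linr _)).
    exact: (lin_comp (alghom_linear _) (lin_of _)).
  have C1 : bilin (fun (x : ds_R G i j) a =>
      x * r ((1 : GB j) \ot dg_inc GH (antipode H a))).
    split=> [a|x]; first exact: mul_linl.
    exact: (lin_comp (mul_linr x) gl).
  have C2 : bilin (fun (t : tens (ds_R G i j) H) (b : H) => tlift (fun (x : ds_R G i j) a =>
      x * r ((1 : GB j) \ot dg_inc GH (antipode H a))) t \ot b).
    split=> [b|t]; last exact: tpure_linr.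
    by apply: (lin_comp (tpure_linl b)); exact: tlift_linear.
  have Cl : linear C by apply: tlift_linear.
  have cl := @coH_linear _ H (ds_R G i j).
  suff <- : C (coH (tmap (fun y => r (hor_emb y)) idfun (coH y))) = tmap f idfun y.
    by rewrite t0 (lin0 cl) (lin0 Cl).
  have tl : linear (tmap (fun y => r (hor_emb y)) (@idfun H)) by exact: tmap_linear.
  move: (y); apply: tens_ext => [||g h].
  - apply: (lin_comp Cl); apply: (lin_comp cl); apply: (lin_comp tl).
    exact: coH_linear.
  - exact: tmap_linear.
  have Ccl : linear (fun x => C (coH (tmap (fun y => r (hor_emb y)) idfun x))).
    by apply: (lin_comp Cl); exact: (lin_comp cl).
  rewrite coH_pure (lin_swE _ _ Ccl).
  pose E a := r (g \ot dg_inc GH a).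
  have El : linear E.
    by apply: (lin_comp rl); exact: (lin_comp (tpure_linr g) (alghom_linear _)).
  transitivity (sw (fun a b => sw (fun c e => E (a * antipode H c) \ot e) b) h).
    apply: eq_sw => a b; rewrite tmap_pure // coH_pure (lin_swE _ _ Cl).
    apply: eq_sw => c e; rewrite /C (tlift_pure C2) (tlift_pure C1) emb_pure.
    by rewrite -rmorphM gmul_1r -rmorphM.
  rewrite -(sw_coassoc (F := fun a c e => E (a * antipode H c) \ot e)); last by lin.
  transitivity (sw (fun b e => (counit H b : K) *: (f g \ot e)) h); last first.
    by rewrite tmap_pure //; exact: (sw_counitl h (tpure_linr (f g))).
  apply: eq_sw => b e.
  have Etl : linear (fun x => E x \ot e) by lin.
  by have := sw_scale Etl (sw_antipoder b); rewrite /E rmorph1.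
(* T kills ker f (x) H, and 1 - f' f maps into ker f, so T y depends only on (f' f (x) id) y, which
   is zero. *)
have [f' f'E] := generalized_inverse fl; have f'l := lin_of f'.
pose p k := k - f' (f k).
have pl : linear p by apply: lin_add => //; apply: lin_opp; exact: lin_comp.
have Tp k h : T (p k \ot h) = 0.
  by apply: hT; rewrite -/(f _) /p (linD fl) -scaleN1r (linZ _ _ fl) f'E scaleN1r subrr.
have yE z : T z = T (tmap (fun k => f' (f k)) idfun z).
  have tl' : linear (tmap (fun k => f' (f k)) (@idfun H)).
    by apply: tmap_linear => //; exact: lin_comp.
  move: z; apply: tens_ext => [||k h] //; first exact: lin_comp.
  rewrite tmap_pure //; last exact: lin_comp.
  have := Tp k h; rewrite /p (bilinDl (@tpure_bilin _ _ _)) (linD Tl).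
  rewrite (bilinNl (@tpure_bilin _ _ _)) -scaleN1r (linZ _ _ Tl) scaleN1r.
  by move/eqP; rewrite subr_eq0 => /eqP.
rewrite yE -(tmap_tmap _ f'l (@lin_id _ H) fl (@lin_id _ H)) fy0.
by rewrite (lin0 (tmap_linear f'l (@lin_id _ H))) (lin0 Tl).
Qed.

End Subcomodule.

(** * Local covariant derivatives *)

#[local] Hint Extern 0 (GRing.linear_for _ (GRing.Linear.sort ?f)) => exact (lin_of f) : core.
#[local] Hint Extern 0 (GRing.linear_for _ (alghom_fun ?f)) => exact (alghom_linear f) : core.

Section LocalDerivative.
Variables (K : fieldType) (H : hopfAlg K) (I : finType) (Q : qpfb H I).
Variable G : diffStr Q.
Variable i : I.
Local Notation GH := (ds_GH G).
Local Notation X := (ds_GB G i).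
Local Notation inc := (dg_inc GH).
Local Notation coP := (@locP_coact _ _ _ _ G i).
Local Notation emb := (@hor_emb _ _ _ _ G i).

Lemma emb_lin : linear emb.
Proof. exact: (lin_of emb). Qed.

(** A left inverse of [emb] on the whole of Gamma(B_i) (x)^ Gamma(H): forms of positive degree along
    H are dropped. *)
Definition hor_ret (x : locP G i) : tens X H := tmap idfun (@dg_res _ _ GH) x.
Lemma hor_ret_linear : linear hor_ret.
Proof. by apply: tmap_linear => //; exact: (lin_of (@dg_res _ _ GH)). Qed.
HB.instance Definition _ :=
  GRing.isLinear.Build K (locP G i) (tens X H) *:%R hor_ret hor_ret_linear.

Lemma hor_retE u h : hor_ret (u \ot inc h) = u \ot h.
Proof.
by rewrite /hor_ret tmap_pure ?dg_incK //; exact: (lin_of (@dg_res _ _ GH)).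
Qed.
Lemma hor_embK : cancel emb hor_ret.
Proof.
apply: tens_ext => [|//|u h]; last by rewrite emb_pure hor_retE.
exact: (lin_comp hor_ret_linear emb_lin).
Qed.
Lemma hor_emb_inj : injective emb.
Proof. exact: can_inj hor_embK. Qed.

Lemma pr_emb n y : dg_pr (locP G i) n (emb y) = emb (tmap (dg_pr X n) idfun y).
Proof.
move: y; apply: tens_ext => [||u h].
- exact: (lin_comp (lin_of (dg_pr (locP G i) n)) emb_lin).
- by apply: (lin_comp emb_lin); lin.
rewrite tmap_pure // !emb_pure.
elim/dg_ind: u => [|x y hx hy|m u hu].
- by rewrite linear0 !tpure0l linear0.
- by rewrite raddfD /= !(bilinDl (@tpure_bilin _ _ _)) raddfD /= hx hy.
rewrite [LHS](gpr_homog n hu (homog_inc GH h)) (homog_prE _ hu) addn0.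
by case: ifP; rewrite ?tpure0l.
Qed.

Definition stwist (s : bool) (x : X) : X := if s then dg_sign x else x.
Lemma stwist_linear s : linear (stwist s).
Proof. by case: s; [exact: (lin_of (@dg_sign _ _ X))|exact: lin_id]. Qed.
Lemma stwist_homog s n x : homog n x -> stwist s x = (if s then (-1) ^+ n else 1) *: x.
Proof. by case: s => hx; [exact: (dg_twist_homog _ hx)|rewrite scale1r]. Qed.

Variables (s : bool) (A : {linear H -> X}).

(* D(w (x) h) = dw (x) h - (-1)^n w A(h_1) (x) h_2 for w of degree n in the   *)
(* left case, and dw (x) h - A(h_1) w (x) h_2 in the right case.              *)
Definition covF (w : X) (h : H) : tens X H :=
  dg_d X w \ot h - sw (fun a b => smul s (stwist s w) (A a) \ot b) h.
Definition covD (y : tens X H) : tens X H := tlift covF y.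

Lemma covF_bilin : bilin covF.
Proof. have sl := stwist_linear s; rewrite /covF; lin. Qed.
Lemma covD_linear : linear covD.
Proof. exact: tlift_linear covF_bilin. Qed.
HB.instance Definition _ :=
  GRing.isLinear.Build K (tens X H) (tens X H) *:%R covD covD_linear.

Lemma covD_pure w h : covD (w \ot h) = covF w h.
Proof. by rewrite /covD tlift_pure //; exact: covF_bilin. Qed.

Lemma emb_covF w h : emb (covF w h) =
  dg_d X w \ot inc h - sw (fun a b => smul s (stwist s w) (A a) \ot inc b) h :> locP G i.
Proof.
rewrite /covF (linB _ _ emb_lin) emb_pure.
by rewrite (lin_swE _ _ emb_lin); congr (_ - _); apply: eq_sw => a b; rewrite emb_pure.
Qed.

Lemma covD_one h : covD ((1 : X) \ot h) = - sw (fun a b => A a \ot b) h.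
Proof.
rewrite covD_pure /covF dg_d1 tpure0l sub0r; congr (- _); apply: eq_sw => a b.
rewrite (stwist_homog s (@homog1 _ _ X)) expr0 if_same scale1r.
by case: (s); rewrite /smul ?mul1r ?mulr1.
Qed.

(** The value on 1 (x) h is - A(h_1) (x) h_2, from which eps recovers A; so A is the map
    corresponding to [covD]. *)
Lemma covD_counit h :
  - tlift (fun (w : X) (k : H) => counit H k *: w) (covD ((1 : X) \ot h)) = A h.
Proof.
have el : linear (fun x : H => counit H x : K^o) := lin_of (counit H).
pose F (w : X) (k : H) : X := (counit H k : K) *: w.
have fB : bilin F by rewrite /F; lin.
transitivity (- tlift F (- sw (fun a b => A a \ot b) h)); first by rewrite covD_one.
rewrite (linN _ (tlift_linear fB)) opprK.
rewrite (lin_swE _ _ (tlift_linear fB)) -[RHS](sw_counitr h (lin_of A)).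
by apply: eq_sw => a b; rewrite tlift_pure.
Qed.

(** Coassociativity: A takes the first leg of h, whereas the coaction splits off the last one. *)
Lemma coH_covD y : coH (covD y) = tmap covD idfun (coH y).
Proof.
have cl := @coH_linear _ H X; have Dl := covD_linear; have sl := stwist_linear s.
have tl : linear (tmap covD (@idfun H)) by lin.
move: y; apply: tens_ext => [||w h].
- exact: (lin_comp cl Dl).
- exact: (lin_comp tl cl).
rewrite coH_pure (lin_swE _ _ tl) covD_pure /covF (linB _ _ cl).
rewrite coH_pure (lin_swE _ _ cl).
transitivity (sw (fun a b => (dg_d X w \ot a) \ot b) h -
    sw (fun a b => sw (fun c e => (smul s (stwist s w) (A c) \ot e) \ot b) a) h).
  congr (_ - _).
  rewrite (sw_coassoc (F := fun a c e => (smul s (stwist s w) (A a) \ot c) \ot e)); last by lin.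
  by apply: eq_sw => a b; rewrite coH_pure.
rewrite {1 2}/sw tlift_sub.
apply: eq_tlift => a b; rewrite tmap_pure // covD_pure /covF.
rewrite (bilinDl (@tpure_bilin _ _ _)) (bilinNl (@tpure_bilin _ _ _)).
by rewrite (lin_swE _ _ (tpure_linl b)).
Qed.

Lemma coP_covD y : coP (emb (covD y)) = tmap (fun x => emb (covD (hor_ret x))) idfun (coP (emb y)).
Proof.
rewrite !coP_emb coH_covD (tmap_tmap _ emb_lin (@lin_id _ H) covD_linear (@lin_id _ H)).
rewrite (tmap_tmap _ _ (@lin_id _ H) emb_lin (@lin_id _ H)); last first.
  exact: (lin_comp emb_lin (lin_comp covD_linear hor_ret_linear)).
by apply: eq_tmap => // x; rewrite hor_embK.
Qed.

Lemma emb_mull (w : X) y : ((w \ot (1 : GH)) : locP G i) * emb y = emb (tmap (fun u : X => w * u) idfun y).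
Proof.
move: y; apply: tens_ext => [||u h].
- exact: (lin_comp (mul_linr _) emb_lin).
- by apply: (lin_comp emb_lin); lin.
by rewrite tmap_pure ?emb_pure ?gmul_1l //; exact: mul_linr.
Qed.
Lemma emb_mulr (w : X) y : emb y * ((w \ot (1 : GH)) : locP G i) = emb (tmap (fun u : X => u * w) idfun y).
Proof.
move: y; apply: tens_ext => [||u h].
- exact: (lin_comp (mul_linl _) emb_lin).
- by apply: (lin_comp emb_lin); lin.
rewrite tmap_pure // ?emb_pure; last exact: mul_linl.
by rewrite gmul_incl mulr1.
Qed.

Lemma covD_homog n y : (forall h, homog 1 (A h)) ->
  homog n (emb y) -> homog n.+1 (emb (covD y)).
Proof.
move=> hA; rewrite /homog !pr_emb => /hor_emb_inj <-; congr emb.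
have sl := stwist_linear s; have Dl := covD_linear.
have tl k : linear (tmap (dg_pr X k) (@idfun H)) by lin.
move: y; apply: tens_ext => [||w h].
- exact: (lin_comp (tl n.+1) (lin_comp Dl (tl n))).
- exact: (lin_comp Dl (tl n)).
have hw := homog_pr n w; rewrite tmap_pure // covD_pure /covF.
rewrite (linB _ _ (tl _)) tmap_pure // (homog_d hw).
congr (_ - _); rewrite (lin_swE _ _ (tl _)); apply: eq_sw => a b.
rewrite tmap_pure //; congr (_ \ot _); rewrite (stwist_homog s hw).
have hw' : homog n ((if s then (-1) ^+ n else 1) *: dg_pr X n w) by exact: homogZ.
by case: (s) hw' => hw' /=; rewrite ?[smul _ _ _](homogM hw' (hA a));
  [have := homogM hw' (hA a)|have := homogM (hA a) hw']; rewrite ?addn1.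
Qed.

End LocalDerivative.

Section Leibniz.
Variables (K : fieldType) (H : hopfAlg K) (I : finType) (Q : qpfb H I).
Variable G : diffStr Q.
Variable i : I.
Local Notation GH := (ds_GH G).
Local Notation X := (ds_GB G i).
Local Notation inc := (dg_inc GH).
Local Notation emb := (@hor_emb _ _ _ _ G i).
Variable A : {linear H -> X}.

Lemma sign_mul n (w u : X) : homog n w -> dg_sign (w * u) = (-1) ^+ n *: (w * dg_sign u).
Proof.
move=> hw; elim/dg_ind: u => [|x y hx hy|m u hu].
- by rewrite mulr0 !linear0 mulr0 scaler0.
- by rewrite mulrDr !raddfD /= mulrDr scalerDr hx hy.
rewrite [LHS](dg_twist_homog _ (homogM hw hu)) [dg_sign u](dg_twist_homog _ hu).
by rewrite ua_scalerAr scalerA exprD.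
Qed.

Lemma covD_leibniz_left n (w : X) y : homog n w ->
  emb (covD true A (tmap (fun u : X => w * u) idfun y)) =
  ((dg_d X w \ot (1 : GH)) : locP G i) * emb y +
  (-1) ^+ n *: (((w \ot (1 : GH)) : locP G i) * emb (covD true A y)).
Proof.
move=> hw; have el := @emb_lin _ _ _ _ G i; have Dl := covD_linear true A.
have tl : linear (tmap (fun u : X => w * u) (@idfun H)) by lin.
move: y; apply: tens_ext => [||u h].
- exact: (lin_comp el (lin_comp Dl tl)).
- apply: lin_add; first exact: (lin_comp (mul_linr _) el).
  by apply: lin_scale; apply: (lin_comp (mul_linr _)); exact: (lin_comp el Dl).
rewrite tmap_pure; [|exact: mul_linr|by []].
rewrite !covD_pure !emb_covF emb_pure gmul_1l mulrBr gmul_1l.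
rewrite (dg_leibniz _ hw) (bilinDl (@tpure_bilin _ _ _)) tpureZl.
rewrite -addrA; congr (_ + _); rewrite scalerBr; congr (_ - _).
rewrite (lin_swE _ _ (mul_linr _)).
rewrite (lin_swE _ _ (lin_scale _ (@lin_id _ _))); apply: eq_sw => a b.
by rewrite /smul /stwist (sign_mul _ hw) gmul_1l ua_scalerAl tpureZl mulrA.
Qed.

Lemma covD_leibniz_right n (w : X) y : homog n (emb y) ->
  emb (covD false A (tmap (fun u : X => u * w) idfun y)) =
  emb (covD false A y) * ((w \ot (1 : GH)) : locP G i) +
  (-1) ^+ n *: (emb y * ((dg_d X w \ot (1 : GH)) : locP G i)).
Proof.
rewrite /homog pr_emb => /hor_emb_inj <-.
have el := @emb_lin _ _ _ _ G i; have Dl := covD_linear false A.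
have tl : linear (tmap (fun u : X => u * w) (@idfun H)) by lin.
have pl : linear (tmap (dg_pr X n) (@idfun H)) by lin.
move: y; apply: tens_ext => [||u h].
- exact: (lin_comp el (lin_comp Dl (lin_comp tl pl))).
- apply: lin_add; first exact: (lin_comp (mul_linl _) (lin_comp el (lin_comp Dl pl))).
  by apply: lin_scale; apply: (lin_comp (mul_linl _)); exact: (lin_comp el pl).
rewrite (@tmap_pure _ _ _ _ _ _ _ u h (lin_of (dg_pr X n)) (@lin_id _ _)).
move: (dg_pr X n u) (homog_pr n u) => v hv.
rewrite tmap_pure; [|exact: mul_linl|by []].
rewrite !covD_pure !emb_covF emb_pure mulrBl !gmul_incl !mulr1.
rewrite (dg_leibniz _ hv) (bilinDl (@tpure_bilin _ _ _)) tpureZl.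
rewrite addrAC; congr (_ - _ + _).
rewrite (lin_swE _ _ (mul_linl _)); apply: eq_sw => a b.
by rewrite /smul /stwist gmul_incl mulr1 mulrA.
Qed.

(** Each term of D(k (x) h) has dk, or k up to signs, as a factor, and r kills both. This supplies
    the premise of [horizontal_kernel_ext] for the map r o D. *)
Lemma covD_kernel s (B : uAlg K) (Y : dgAlg B) (f : talg _ H -> B)
    (r : alghom (locP G i) Y) (k : X) h :
  dg_extends f r -> r (k \ot (1 : GH)) = 0 -> r (emb (covD s A (k \ot h))) = 0.
Proof.
move=> [_ rpr rd] k0.
have rl : linear r := alghom_linear r.
have kd : r (dg_d X k \ot (1 : GH)) = 0 by rewrite emb1_d rd k0 linear0.
have kt : r (stwist s k \ot (1 : GH)) = 0.
  (* The sign twist is a combination of the homogeneous components of k; r respects degrees, hence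
     kills each of them. *)
  case: s => //=; rewrite /dg_sign /dg_twist.
  have fl : linear (fun x : X => r (x \ot (1 : GH))) := lin_comp rl (tpure_linl _).
  rewrite -[LHS]/(mkLin fl _) linear_sum big1 // => m _; rewrite linearZ /=.
  have e1 x : x \ot (1 : GH) = emb (x \ot (1 : H)) by rewrite emb_pure rmorph1.
  have := pr_emb m (k \ot (1 : H)); rewrite tmap_pure // -!e1 => <-.
  by rewrite rpr k0 linear0 scaler0.
rewrite covD_pure emb_covF raddfB /=.
have -> : dg_d X k \ot inc h =
    ((dg_d X k \ot (1 : GH)) : locP G i) * ((1 : X) \ot inc h) :> locP G i.
  by rewrite gmul_1r mul1r.
rewrite rmorphM /= kd mul0r sub0r (lin_swE _ _ rl).
rewrite /sw /tlift big1 ?oppr0 // => p _; case: s kt => kt; rewrite /smul /=.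
  by rewrite -gmul_1l rmorphM /= kt mul0r.
have -> : (A p.1 * k) \ot inc p.2 =
    ((A p.1 \ot inc p.2) : locP G i) * (k \ot (1 : GH)) :> locP G i.
  by rewrite gmul_incl mulr1.
by rewrite rmorphM /= kt mulr0.
Qed.

End Leibniz.

(** * From local to global *)

Section Lifts.
Variables (K : fieldType) (H : hopfAlg K) (I : finType) (Q : qpfb H I).
Variable G : diffStr Q.
Local Notation GH := (ds_GH G).
Local Notation GB := (ds_GB G).
Implicit Types (i j : I) (s : bool).

(** Gamma(B_i) is generated by B_i and dB_i, and B maps onto B_i. *)
Lemma base_form_lift i n (g : GB i) : homog n g ->
  exists2 w : ds_B G, homog n w & ic_map (ds_B G) i w = g.
Proof.
have [m1 m2 m3] := ic_mapP (ds_B G) i; have ml := alghom_linear (ic_map (ds_B G) i).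
suff [w wE] : exists w, ic_map (ds_B G) i w = g.
  by move=> hg; exists (dg_pr _ n w); [exact: homog_pr|rewrite m2 wE].
move: g; apply: (@ds_GB_calc _ _ _ _ G i) => [|x y [w <-] [v <-]|c x [w <-]|x y [w <-] [v <-]|a|a].
- by exists 1; exact: (rmorph1 (ic_map (ds_B G) i)).
- by exists (w + v); rewrite (linD ml).
- by exists (c *: w); rewrite (linZ _ _ ml).
- by exists (w * v); exact: (rmorphM (ic_map (ds_B G) i)).
- by have [b <-] := qproj_surj a; exists (dg_inc _ b); rewrite m1.
by have [b <-] := qproj_surj a; exists (dg_d _ (dg_inc _ b)); rewrite m3 m1.
Qed.

Lemma base_form_GcB (w : ds_B G) : GcB G (fun i => ic_map (ds_B G) i w : ds_GB G i).
Proof.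
by move=> i j; exists w, w; split=> //; exists 0, 0; rewrite !raddf0 subrr addr0.
Qed.
Definition base_form (w : ds_B G) : subsp (GcB G) := subsp_of (base_form_GcB w).

Definition hor_smul s (g : subsp (GcB G)) (x : subsp (horP G)) : subsp (horP G) :=
  if s then hor_mull g x else hor_mulr x g.
Definition sact s (p : qP Q) (x : subsp (GcP1 G)) : subsp (GcP1 G) :=
  if s then actl p x else actr x p.

Lemma hor_smulE s g x i : subsp_val (hor_smul s g x) i =
  smul s (subsp_val g i \ot (1 : GH) : locP G i) (subsp_val x i).
Proof. by case: s. Qed.
Lemma sactE s p x i : subsp_val (sact s p x) i =
  smul s (embP G p i : locP G i) (subsp_val x i).
Proof. by case: s. Qed.

Definition chiH i p : tens (GB i) H := tmap (dg_inc (GB i)) idfun (qchi Q i p).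
Lemma emb_chiH i p : hor_emb (chiH i p) = embP G p i.
Proof.
rewrite /embP /chiH; move: (qchi Q i p); apply: tens_ext => [||b h].
- apply: (lin_comp (@emb_lin _ _ _ _ G i)); apply: tmap_linear => //.
- exact: (alghom_linear (dg_inc (locP G i))).
by rewrite tmap_pure // emb_pure /= gincE.
Qed.
Lemma chiH_pure i p b h : qchi Q i p = b \ot h -> chiH i p = dg_inc (GB i) b \ot h.
Proof. by move=> e; rewrite /chiH e tmap_pure. Qed.
Lemma embP_pure i p b h : qchi Q i p = b \ot h ->
  embP G p i = dg_inc (GB i) b \ot dg_inc GH h.
Proof. by move=> e; rewrite -emb_chiH (chiH_pure e) emb_pure. Qed.

(** In chart i, w (x) h is the component of the product of a base form lifting w and an element of P
    lifting 1 (x) h. The predicate stands for any property of sums of such global products. *)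
Lemma hor_lift s (P : subsp (horP G) -> Prop) : P 0 ->
  (forall x y, P x -> P y -> P (x + y)) ->
  (forall n w p, homog n w -> P (hor_smul s (base_form w) (toHor G p))) ->
  forall i y, exists2 z, P z & chiGc i z = hor_emb y.
Proof.
move=> P0 PD Pm i y; elim/tens_ind: y => [|x y [z Pz zE] [z' Pz' zE']|g h].
- by exists 0 => //; rewrite linear0.
- by exists (z + z'); [exact: PD|rewrite raddfD /= -zE -zE'].
elim/dg_ind: g => [|x y [z Pz zE] [z' Pz' zE']|n g hg].
- by exists 0 => //; rewrite tpure0l linear0.
- exists (z + z'); [exact: PD|rewrite (bilinDl (@tpure_bilin _ _ _)) raddfD /=].
  by rewrite -zE -zE'.
have [w hw wE] := base_form_lift hg.
have [p pE] := @qchi_surj _ _ _ Q i ((1 : qalg (qJ Q i)) \ot h).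
exists (hor_smul s (base_form w) (toHor G p)); first exact: Pm hw.
rewrite /chiGc hor_smulE /= wE (embP_pure pE) emb_pure rmorph1.
by case: s {Pm} => /=; rewrite /smul ?gmul_1l ?gmul_incl ?mulr1 ?mul1r.
Qed.

Lemma d_embP i p : subsp_val (toGcP1 G p) i = dg_d (locP G i) (embP G p i).
Proof. by []. Qed.

Lemma d_pure i (b : qalg (qJ Q i)) h :
  dg_d (locP G i) (dg_inc (GB i) b \ot dg_inc GH h) =
  dg_d (GB i) (dg_inc (GB i) b) \ot dg_inc GH h +
  dg_inc (GB i) b \ot dg_d GH (dg_inc GH h) :> locP G i.
Proof. by rewrite /= (gdiffE _ (homog_inc (GB i) b)) expr0 scale1r. Qed.

(** The two bidegrees are spanned by b (x) a dc and a db (x) h, with the factors reversed in the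
    right case. Lifting b (x) a and 1 (x) c, or a (x) h and b (x) 1, makes them components of p
    dp'. *)
Lemma one_form_lift s (P : subsp (GcP1 G) -> Prop) : P 0 ->
  (forall x y, P x -> P y -> P (x + y)) ->
  (forall p p', P (sact s p (toGcP1 G p'))) ->
  forall i (x : locP G i), homog 1 x -> exists2 z, P z & chiGc i z = x.
Proof.
move=> P0 PD Pm i x; rewrite /homog => <-.
have pl : linear (dg_pr (locP G i) 1) := lin_of _.
have D1 : dg_d GH 1 = 0 := dg_d1 GH; have D1' : dg_d (GB i) 1 = 0 := dg_d1 (GB i).
elim/gt_ind: x => [|x y [z Pz zE] [z' Pz' zE']|m n u v hu hv].
- by exists 0 => //; rewrite (lin0 pl).
- by exists (z + z'); [exact: PD|rewrite (linD pl) -zE -zE'].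
rewrite [dg_pr _ _ _](gpr_homog 1 hu hv); case: eqP => [|_]; last by exists 0; rewrite ?linear0.
case: m hu => [|[|m]] hu; rewrite ?addSn ?add0n // => e.
- rewrite -e {n e} in hv; have [b bE] := homog0P hu; rewrite -{u hu}bE.
  move: v hv; apply: (degree1_ind (@ds_GH_calc _ _ _ _ G) (s := s)).
  + by exists 0 => //; rewrite tpure0r.
  + move=> x y [z Pz zE] [z' Pz' zE']; exists (z + z'); first exact: PD.
    by rewrite (bilinDr (@tpure_bilin _ _ _)) -zE -zE'.
  move=> a c; have [p pE] := @qchi_surj _ _ _ Q i (b \ot a).
  have [p' pE'] := @qchi_surj _ _ _ Q i ((1 : qalg (qJ Q i)) \ot c).
  exists (sact s p (toGcP1 G p')) => //.
  rewrite /chiGc sactE d_embP (embP_pure pE) (embP_pure pE') d_pure rmorph1 D1' tpure0l add0r.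
  case: s {Pm}; first by rewrite /smul gmul_incl mulr1.
  by rewrite /smul gmul_incr mul1r.
have {e} n0 : n = 0%N by case: e.
rewrite n0 {n n0} in hv; have [h hE] := homog0P hv; rewrite -{v hv}hE.
move: u hu; apply: (degree1_ind (@ds_GB_calc _ _ _ _ G i) (s := s)).
- by exists 0 => //; rewrite tpure0l.
- move=> x y [z Pz zE] [z' Pz' zE']; exists (z + z'); first exact: PD.
  by rewrite (bilinDl (@tpure_bilin _ _ _)) -zE -zE'.
move=> a b; have [p pE] := @qchi_surj _ _ _ Q i (a \ot h).
have [p' pE'] := @qchi_surj _ _ _ Q i (b \ot (1 : H)).
exists (sact s p (toGcP1 G p')) => //.
rewrite /chiGc sactE d_embP (embP_pure pE) (embP_pure pE') d_pure rmorph1 D1 tpure0r addr0.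
case: s {Pm}; first by rewrite /smul gmul_incl mulr1.
by rewrite /smul gmul_1l.
Qed.

End Lifts.

(** * Preconnections and their potentials *)

Section Preconnection.
Variables (K : fieldType) (H : hopfAlg K) (I : finType) (Q : qpfb H I).
Variable G : diffStr Q.
Local Notation GH := (ds_GH G).
Local Notation GB := (ds_GB G).
Local Notation coP := (@locP_coact _ _ _ _ G _).
Implicit Types (i j : I).

Lemma smul_lin1 (A : uAlg K) s (c : A) : linear (fun x : A => smul s x c).
Proof. exact: (lin_smull s c (@lin_id _ _)). Qed.
Lemma smul_lin2 (A : uAlg K) s (c : A) : linear (fun x : A => smul s c x).
Proof. exact: (lin_smulr s c (@lin_id _ _)). Qed.

(* What a connection, via p |-> hor(dp), and a covariant derivative, via its  *)
(* restriction to degree zero, have in common.                                *)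
Record preconnection (s : bool) (dl : qP Q -> locPs G) : Prop := {
  pre_linear : linear dl;
  pre_hor : forall p, horP G (dl p);
  pre_deg : forall p, degP G 1 (dl p);
  pre_one : dl 1 = 0;
  pre_cov : forall p i, tmap (fun q => dl q i : locP G i) idfun (qcoact Q p) = coP (dl p i);
  pre_ker : forall p i, qchi Q i p = 0 -> dl p i = 0;
  pre_leibniz : forall b p i, dl (smul s (qiota Q b) p) i =
    smul s (dg_d (locP G i) (embP G (qiota Q b) i)) (embP G p i) +
    smul s (embP G (qiota Q b) i : locP G i) (dl p i)
}.

Lemma tmap_counit_coH (V : lmodType K) (y : tens V H) :
  tmap (tlift (fun (w : V) (k : H) => (counit H k : K) *: w)) idfun (coH y) = y.
Proof.
have el : linear (fun x : H => counit H x : K^o) := lin_of (counit H).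
have El : linear (tlift (fun (w : V) (k : H) => (counit H k : K) *: w)) by lin.
have tl : linear (tmap (tlift (fun (w : V) (k : H) => (counit H k : K) *: w)) (@idfun H)).
  exact: tmap_linear.
move: y; apply: tens_ext => [|//|w h].
  exact: (lin_comp tl (@coH_linear _ _ _)).
rewrite coH_pure (lin_swE _ _ tl) -[RHS](sw_counitl h (tpure_linr w)).
apply: eq_sw => a b; rewrite tmap_pure // tlift_pure; last by lin.
by rewrite tpureZl.
Qed.

(** A_i(h) is - (id (x) eps) of the value on 1 (x) h. Covariance recovers that value as - A_i(h_1)
    (x) h_2, and the Leibniz rule over B extends the formula to b (x) h. *)
Lemma preconnection_potential s dl : preconnection s dl ->
  exists A : forall i, {linear H -> GB i},
    (forall i h, homog 1 (A i h)) /\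
    (forall i p, dl p i = hor_emb (covD s (A i) (chiH G i p))).
Proof.
case=> dll dlH dlD _ dlC dlK dlL.
suff P i : exists A : {linear H -> GB i}, (forall h, homog 1 (A h)) /\
    forall p, dl p i = hor_emb (covD s A (chiH G i p)).
  exists (fun i => projT1 (cid (P i))).
  by split=> i; case: (projT2 (cid (P i))).
have il : linear (fun p => dl p i) by move=> c x y; rewrite dll.
(* Preservation of ker chi_i makes the i-th component a function of chi_i(p). *)
have [di diE] := linear_descend (alghom_linear (qchi Q i)) il (fun p => @dlK p i).
have rl := @hor_ret_linear _ _ _ _ G i; have el := @emb_lin _ _ _ _ G i.
pose E := tlift (fun (w : GB i) (k : H) => (counit H k : K) *: w).
have cl : linear (fun x : H => counit H x : K^o) := lin_of (counit H).
have El : linear E by rewrite /E; lin.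
have yl : linear (fun h : H => hor_ret (di ((1 : qalg (qJ Q i)) \ot h))).
  exact: (lin_comp rl (lin_comp (lin_of di) (tpure_linr _))).
have yE h : hor_emb (hor_ret (di ((1 : qalg (qJ Q i)) \ot h))) = di ((1 : qalg (qJ Q i)) \ot h).
  have [p pE] := @qchi_surj _ _ _ Q i ((1 : qalg (qJ Q i)) \ot h).
  by rewrite -pE diE; have [_ /(_ i) [y <-]] := dlH p; rewrite hor_embK.
pose A := mkLin (lin_opp (lin_comp El yl)).
have yA h : di ((1 : qalg (qJ Q i)) \ot h) = - hor_emb (sw (fun a b => A a \ot b) h).
  (* The value at h is recovered from its coaction by eps on the middle leg, and by covariance this
     coaction is the value at h_1 tensored with h_2. *)
  rewrite -yE -[hor_ret _]tmap_counit_coH.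
  have -> : coH (hor_ret (di ((1 : qalg (qJ Q i)) \ot h))) =
      sw (fun a b => hor_ret (di ((1 : qalg (qJ Q i)) \ot a)) \ot b) h.
    have [p pE] := @qchi_surj _ _ _ Q i ((1 : qalg (qJ Q i)) \ot h).
    have := dlC p i; rewrite -diE pE -yE coP_emb.
    move/(congr1 (tmap (@hor_ret _ _ _ _ G i) (@idfun H))).
    rewrite [RHS](tmap_tmap _ rl (@lin_id _ H) el (@lin_id _ H)).
    rewrite (tmap_tmap _ rl (@lin_id _ H) il (@lin_id _ H)).
    rewrite [RHS](eq_tmap (f' := idfun) (g' := idfun)) //; last exact: hor_embK.
    rewrite tmap_id => e; rewrite hor_embK; apply: (etrans (esym e)) => {e}.
    rewrite (eq_tmap (f' := fun q => hor_ret (di (qchi Q i q))) (g' := idfun)) //; last first.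
      by move=> q; rewrite diE.
    have rdl : linear (fun x => hor_ret (di x)) := lin_comp rl (lin_of di).
    rewrite -(tmap_tmap _ rdl (@lin_id _ H) (alghom_linear (qchi Q i)) (@lin_id _ H)).
    have -> : tmap (qchi Q i) idfun (qcoact Q p) = coH (qchi Q i p).
      by rewrite /coH qchi_coact tassocK.
    rewrite pE coH_pure (lin_swE _ _ (tmap_linear rdl (@lin_id _ H))).
    by apply: eq_sw => a b; rewrite tmap_pure.
  rewrite (lin_swE _ _ (tmap_linear El (@lin_id _ H))) -(linN _ el); congr hor_emb.
  have ol : linear (fun x : tens (GB i) H => - x) by lin.
  apply: etrans (esym (lin_swE _ _ ol)).
  apply: eq_sw => a b; rewrite tmap_pure //=.
  by rewrite (bilinNl (@tpure_bilin _ _ _)) opprK.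
exists A; split.
- move=> h; have [p pE] := @qchi_surj _ _ _ Q i ((1 : qalg (qJ Q i)) \ot h).
  have := dlD p i; rewrite -diE pE -yE /homog pr_emb => /hor_emb_inj.
  rewrite /A /= raddfN /= => e; congr (- _).
  move: (hor_ret _) e => y e; rewrite -[in RHS]e.
  rewrite /E (lin_tliftE _ _ (lin_of (dg_pr (GB i) 1))) [RHS]tlift_tmap //; last by lin.
  by apply: eq_tlift => w k; rewrite linearZ.
move=> p; rewrite -diE /chiH.
have Dl := covD_linear s A.
move: (qchi Q i p); apply: tens_ext => [||b h].
- exact: (lin_of di).
- by apply: (lin_comp el); apply: (lin_comp Dl); exact: tmap_linear.
(* A pure tensor b (x) h is chi_i of a product of iota(b') and p', to which the Leibniz rule
   applies. *)
have [b' bE] := qproj_surj b; have [p' pE] := @qchi_surj _ _ _ Q i ((1 : qalg (qJ Q i)) \ot h).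
have cE : qchi Q i (smul s (qiota Q b') p') = b \ot h.
  by case: (s); rewrite /smul rmorphM /= qchi_iota bE pE talgE ?mul1r ?mulr1.
rewrite -cE diE dlL cE -diE pE yA tmap_pure // covD_pure emb_covF.
rewrite (embP_pure G pE) (@embP_pure _ _ _ _ G i (qiota Q b') b 1); last first.
  by rewrite qchi_iota bE.
rewrite d_pure !rmorph1 (dg_d1 GH) tpure0r addr0.
congr (_ + _); first by case: (s); rewrite /smul ?gmul_1l ?gmul_incl ?mul1r ?mulr1.
rewrite (linN _ (smul_lin2 s _)); congr (- _).
rewrite (lin_swE _ _ el) (lin_swE _ _ (smul_lin2 s _)); apply: eq_sw => a c.
rewrite emb_pure (stwist_homog s (homog_inc _ b)) expr0 if_same scale1r.
by case: (s); rewrite /smul ?gmul_1l ?gmul_incl ?mul1r ?mulr1.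
Qed.

End Preconnection.

(** * Gluing the local derivatives *)

Section FromPotential.
Variables (K : fieldType) (H : hopfAlg K) (I : finType) (Q : qpfb H I).
Variable G : diffStr Q.
Local Notation GB := (ds_GB G).
Implicit Types (i j : I).

Lemma hor_retK (x : locPs G) i : horizontal x -> hor_emb (hor_ret (x i : locP G i)) = x i.
Proof. by move=> /(_ i) [y <-]; rewrite hor_embK. Qed.

Lemma subspB (V : lmodType K) (W : submod V) (x y : V) : W x -> W y -> W (x - y).
Proof. by move=> hx hy; rewrite -scaleN1r; apply: submodD => //; exact: submodZ. Qed.

Section Global.
Variables (s : bool) (A : forall i, {linear H -> GB i}).

Definition covG (x : locPs G) : locPs G := fun i => hor_emb (covD s (A i) (hor_ret (x i : locP G i))).

Lemma covG_linear : linear covG.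
Proof.
move=> a x y; apply: dprodP => i.
exact: (lin_comp (@emb_lin _ _ _ _ G i) (lin_comp (covD_linear s (A i)) (@hor_ret_linear _ _ _ _ G i))).
Qed.

Lemma covG_hor x : horizontal (covG x).
Proof. by move=> i; exists (covD s (A i) (hor_ret (x i : locP G i))). Qed.

Lemma covG_deg n x : (forall i h, homog 1 (A i h)) -> horizontal x ->
  degP G n x -> degP G n.+1 (covG x).
Proof.
move=> hA hx dx i; apply: covD_homog => //.
by rewrite (hor_retK i hx); exact: dx.
Qed.

End Global.

Variable A : forall i, {linear H -> GB i}.

Lemma covG_left n (g : locBs G) x : (forall i, homog n (g i : GB i)) -> horizontal x ->
  covG true A (locPs_mul (iotaGc g) x) =
  locPs_mul (locPs_d (iotaGc g)) x + (-1) ^+ n *: locPs_mul (iotaGc g) (covG true A x).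
Proof.
move=> hg hx; apply: dprodP => i; rewrite /covG /locPs_mul.
rewrite -[in LHS](hor_retK i hx) emb_mull hor_embK (covD_leibniz_left (A i) _ (hg i)).
by rewrite -[X in _ = X]/(_ + _ *: _) (hor_retK i hx) emb1_d.
Qed.

Lemma covG_right n (g : locBs G) x : degP G n x -> horizontal x ->
  covG false A (locPs_mul x (iotaGc g)) =
  locPs_mul (covG false A x) (iotaGc g) + (-1) ^+ n *: locPs_mul x (locPs_d (iotaGc g)).
Proof.
move=> dx hx; apply: dprodP => i; rewrite /covG /locPs_mul.
rewrite -[in LHS](hor_retK i hx) emb_mulr hor_embK (@covD_leibniz_right _ _ _ _ _ _ _ n).
  by rewrite (hor_retK i hx) emb1_d.
by rewrite (hor_retK i hx); exact: dx.
Qed.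

Variables (s : bool) (dl : qP Q -> locPs G).
Hypothesis dlP : preconnection s dl.
Hypothesis A1 : forall i h, homog 1 (A i h).
Hypothesis dlE : forall i p, dl p i = hor_emb (covD s (A i) (chiH G i p)).

Lemma covG_embP p : covG s A (embP G p) = dl p.
Proof. by apply: dprodP => i; rewrite /covG dlE -emb_chiH hor_embK. Qed.

(** On a sum z of products of base forms and elements of P, the Leibniz rule derives compatibility
    from that of [dl]. The rest u = x - z vanishes at i, so at j it lies in the kernel of [ds_r],
    which the local derivative preserves. *)
Lemma covG_GcP x : horP G x -> GcP G (covG s A x).
Proof.
move=> hx i j; have Gl := covG_linear s A.
have [] := @hor_lift _ _ _ _ G s (fun z => GcP G (covG s A (subsp_val z))) _ _ _ i (hor_ret (x i : locP G i)).
- by rewrite raddf0 (lin0 Gl); exact: GcP0.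
- by move=> y z hy hz; rewrite raddfD (linD Gl); exact: GcPD.
- move=> n w p hw.
  pose g : locBs G := fun i => ic_map (ds_B G) i w.
  have gc := iotaGc_GcP (base_form_GcB w).
  have ec := embP_GcP G p; have eh := embP_hor G p.
  have dh : GcP G (dl p) by have [] := pre_hor dlP p.
  have hg k : homog n (ic_map (ds_B G) k w).
    by have [_ m2 _] := ic_mapP (ds_B G) k; rewrite /homog -m2 hw.
  move: covG_embP; case: (s) => eE /=.
    rewrite (covG_left hg eh) eE; apply: GcPD; first by apply: GcPM => //; exact: GcP_d.
    by apply: GcPZ; exact: GcPM.
  rewrite (covG_right _ (embP_deg G p) eh) eE; apply: GcPD; first exact: GcPM.
  by apply: GcPZ; apply: GcPM => //; exact: GcP_d.
move=> z zc zE; have hz := subspP z.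
pose u := x - subsp_val z; have hu : horP G u by exact: subspB.
have ui : u i = 0.
  rewrite -[LHS]/(x i - subsp_val z i) -[subsp_val z i]/(chiGc i z) zE hor_retK ?subrr //.
  by case: hx.
have xE : x = u + subsp_val z by rewrite subrK.
have ru : ds_r G i j (u j) = 0.
  have [/(_ i j) e _] := hu; move: e; rewrite ui linear0 => e.
  by apply: (bij_inj (ds_phi_bij G i j)); rewrite -e linear0.
(* [horizontal_kernel_ext] reduces the claim to k (x) h with k (x) 1 in the kernel, where
   [covD_kernel] applies. *)
have rcu : ds_r G i j (covG s A u j) = 0.
  have [re _ _] := ds_rP G i j; have rl := alghom_linear (ds_r G i j).
  pose T (y : tens (GB j) H) := ds_r G i j (hor_emb (covD s (A j) y)).
  have Tl : linear T.
    exact: (lin_comp rl (lin_comp (@emb_lin _ _ _ _ G j) (covD_linear s (A j)))).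
  apply: (@horizontal_kernel_ext _ _ _ _ _ i j _ T Tl _ (hor_ret (u j : locP G j))).
    by move=> k h k0; exact: (covD_kernel (A j) s h re k0).
  by rewrite hor_retK //; case: hu.
have lcu : covG s A u i = 0.
  by rewrite /covG ui !linear0.
have E k : covG s A x k = covG s A u k + covG s A (subsp_val z) k.
  by rewrite {1}xE (linD Gl).
by rewrite !E lcu add0r raddfD /= rcu add0r; exact: zc.
Qed.

Definition is_scovder (D : {linear subsp (horP G) -> subsp (horP G)}) : Prop :=
  if s then is_lcovder D else is_rcovder D.

Lemma potential_covder : exists D : {linear subsp (horP G) -> subsp (horP G)},
  [/\ is_scovder D, forall p, subsp_val (D (toHor G p)) = dl p &
      forall i, corresponding D (A i)].
Proof.
have hD (x : subsp (horP G)) : horP G (covG s A (subsp_val x)).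
  by split; [apply/covG_GcP/subspP|exact: covG_hor].
have Dl : linear (fun x : subsp (horP G) => subsp_of (hD x) : subsp (horP G)).
  move=> a x y; apply: subsp_eq; rewrite [RHS]subsp_val_linear.
  by rewrite -[LHS]/(covG s A (subsp_val (a *: x + y))) subsp_val_linear covG_linear.
have hx (x : subsp (horP G)) : horizontal (subsp_val x) by case: (subspP x).
pose D := mkLin Dl; exists D.
have DE p : subsp_val (D (toHor G p)) = dl p by rewrite /= covG_embP.
have Dcov : is_covder D.
  split.
  - by move=> n x dx; exact: covG_deg.
  - by apply: subsp_eq; rewrite DE (pre_one dlP) linear0.
  - move=> x t xt i; have chil : linear (@chiGc _ _ _ _ _ (horP G) i) by [].
    pose L (x : locP G i) : locP G i := hor_emb (covD s (A i) (hor_ret x)).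
    have Ll : linear L.
      exact: (lin_comp (@emb_lin _ _ _ _ G i) (lin_comp (covD_linear s (A i)) (@hor_ret_linear _ _ _ _ G i))).
    rewrite (tmap_tmap _ chil (@lin_id _ H) Dl (@lin_id _ H)).
    transitivity (tmap L idfun (tmap (@chiGc _ _ _ _ _ (horP G) i) idfun t)).
      by rewrite (tmap_tmap _ Ll (@lin_id _ H) chil (@lin_id _ H)).
    rewrite xt /chiGc /= /covG coP_covD hor_retK //; exact: hx.
  by move=> i x; rewrite /chiGc /= /covG => ->; rewrite !linear0.
split=> //.
  rewrite /is_scovder; case es: s; split=> // n g x hg;
    rewrite -[LHS]/(covG s A _) -[subsp_val (D x)]/(covG s A _) es.
    exact: (covG_left hg (hx x)).
  exact: (covG_right _ hg (hx x)).
move=> i; exists (mkLin (covD_linear s (A i))) => [x y yE|h].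
  by rewrite /chiGc /= /covG -[subsp_val x i]/(chiGc i x) -yE hor_embK.
by rewrite [LHS](esym (covD_counit s (A i) h)).
Qed.

End FromPotential.

(** * Local connections *)

Section SidedProducts.
Variable K : fieldType.

Lemma tlift_smul (A B : uAlg K) (W : lmodType K) s (F : A -> B -> W) (x y : talg A B) :
  bilin F -> tlift F (smul s x y) =
  tlift (fun a b => tlift (fun a' b' => F (smul s a a') (smul s b b')) y) x.
Proof.
move=> FB; have Fl := tlift_linear FB.
have E (u v : talg A B) : tlift F (u * v) =
    tlift (fun (a : A) (b : B) => tlift (fun (a' : A) (b' : B) => F (a * a') (b * b')) v) u.
  rewrite -[u * v]/(tmul u v) /tmul /tlift2 (lin_tliftE _ _ Fl); apply: eq_tlift => a b.
  rewrite (lin_tliftE _ _ Fl); apply: eq_tlift => a' b'.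
  by rewrite /tmulF tlift_pure.
by case: s; rewrite /smul E // tlift_exchange.
Qed.

Lemma sw_smul (H : hopfAlg K) (W : lmodType K) s (f : H -> H -> W) a b : bilin f ->
  sw f (smul s a b) = sw (fun a1 a2 => sw (fun b1 b2 => f (smul s a1 b1) (smul s a2 b2)) b) a.
Proof.
move=> fB; apply: etrans (tlift_smul s (coprod H a : talg H H) (coprod H b) fB).
rewrite /sw; congr (tlift f _).
by case: s; rewrite /smul rmorphM.
Qed.

Lemma smul1 (A : uAlg K) s (x : A) : smul s 1 x = x.
Proof. by case: s; rewrite /smul ?mul1r ?mulr1. Qed.

Lemma smul_rmorph (A B : uAlg K) (f : alghom A B) s x y :
  f (smul s x y) = smul s (f x) (f y).
Proof. by case: s; rewrite /smul rmorphM. Qed.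

Lemma smulA (A : uAlg K) s (x y z : A) : smul s (smul s x y) z = smul s x (smul s y z).
Proof. by case: s; rewrite /smul mulrA. Qed.

Lemma pr_smul_inc (A : uAlg K) (X : dgAlg A) s n a (v : X) :
  dg_pr X n (smul s (dg_inc X a) v) = smul s (dg_inc X a) (dg_pr X n v).
Proof.
case: s; rewrite /smul; first by rewrite -[n]add0n (pr_mulD _ _ (homog_inc X a)) add0n.
elim/dg_ind: v => [|x y hx hy|m v hv].
- by rewrite mul0r !linear0 mul0r.
- by rewrite mulrDl !raddfD /= mulrDl hx hy.
rewrite (homog_prE _ (homogM hv (homog_inc X a))) (homog_prE _ hv) addn0.
by case: ifP; rewrite ?mul0r.
Qed.

Lemma santipode_smul (H : hopfAlg K) (X : dgAlg H) s (a1 a2 b : H) (v : X) :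
  smul s (dg_inc X (santipode H s (smul s a2 b))) (smul s (dg_inc X a1) v) =
  smul s (dg_inc X (santipode H s b))
    (smul s (dg_inc X (smul s (santipode H s a2) a1)) v).
Proof.
by case: s; rewrite /smul santipodeM !rmorphM /= !mulrA.
Qed.

End SidedProducts.

Section LocalConnection.
Variables (K : fieldType) (H : hopfAlg K) (I : finType) (Q : qpfb H I).
Variable G : diffStr Q.
Variable i : I.
Local Notation GH := (ds_GH G).
Local Notation X := (ds_GB G i).
Local Notation inc := (dg_inc GH).
Local Notation delta := (ds_delta G).
Local Notation coP := (@locP_coact _ _ _ _ G i).
Local Notation emb := (@hor_emb _ _ _ _ G i).
Local Notation Ss := (santipode H).

Lemma delta_coassoc (W : lmodType K) (F : GH -> H -> H -> W) v : trilin F ->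
  tlift (fun w z => tlift (fun v0 x => F v0 x z) (delta w)) (delta v) =
  tlift (fun v0 x => sw (F v0) x) (delta v).
Proof.
move=> Ft; pose Phi x := tlift (fun u y => tlift (F u) y) x.
have PhiB : bilin (fun u y => tlift (F u) y) by lin.
have Pl : linear Phi by apply: tlift_linear.
transitivity (Phi (tmap idfun (coprod H : H -> tens H H) (delta v))); last first.
  by rewrite /Phi tlift_tmap //; exact: (alghom_linear (coprod H)).
have [_ [<- _]] := ds_deltaP G.
rewrite /tmap /tassoc (lin_tliftE _ _ (tlift_linear (@tassoc_bilin2 _ _ _ _))).
rewrite (lin_tliftE _ _ Pl); apply: eq_tlift => a b.
rewrite (tlift_pure (@tassoc_bilin2 _ _ _ _)) (lin_tliftE _ _ Pl).
by apply: eq_tlift => c d; rewrite /Phi tlift_pure // tlift_pure //; lin.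
Qed.

Lemma res_pr0 (v : GH) : dg_res (dg_pr GH 0 v) = dg_res v.
Proof. by apply: (@dg_inc_inj _ _ GH); rewrite !dg_resE homog_pr. Qed.

Lemma res_homogS n (v : GH) : homog n.+1 v -> dg_res v = 0.
Proof.
by move=> hv; apply: (@dg_inc_inj _ _ GH); rewrite dg_resE (homog_prE _ hv) linear0.
Qed.

Lemma coprod_res (v : GH) : coprod H (dg_res v) = tmap (@dg_res _ _ GH) idfun (delta v).
Proof.
have rl : linear (@dg_res _ _ GH) := lin_of _.
have := delta_pr (@ds_GH_calc _ _ _ _ G) (ds_deltaP G) 0 v.
rewrite -dg_resE (delta_inc (ds_deltaP G)) => /(congr1 (tmap (@dg_res _ _ GH) (@idfun H))).
rewrite (tmap_tmap _ rl (@lin_id _ H) (alghom_linear _) (@lin_id _ H)).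
rewrite (tmap_tmap _ rl (@lin_id _ H) (lin_of _) (@lin_id _ H)).
rewrite (eq_tmap (f' := idfun) (g' := idfun) _ (@dg_incK _ _ GH)) // tmap_id => ->.
by apply: eq_tmap => //; exact: res_pr0.
Qed.

Variables (s : bool) (q : {linear GH -> X}).

(** The map q will come from [linear_descend] and need not respect degrees; only its part from
    Gamma^1(H) to Gamma^1(B_i) is kept. *)
Definition q1 (v : GH) : X := dg_pr X 1 (q (dg_pr GH 1 v)).
Lemma q1_linear : linear q1.
Proof. by rewrite /q1; lin. Qed.
HB.instance Definition _ := GRing.isLinear.Build K GH X *:%R q1 q1_linear.

Lemma q1_inc a : q1 (inc a) = 0.
Proof. by rewrite /q1 (homog_prE _ (homog_inc GH a)) !linear0. Qed.

(* For s = true and v = a dh, [vert v] is - q(eta h_1) (x) a h_2, since       *)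
(* S^-1(v_1) v_0 (x) v_2 = eta h_1 (x) a h_2; this is how a map vanishing on  *)
(* R acts on vertical forms.                                                  *)
Definition vertF (v0 : GH) (x : H) : tens X H :=
  sw (fun b c => q1 (smul s (inc (Ss s b)) v0) \ot c) x.
Definition vert (v : GH) : tens X H := - tlift vertF (delta v).

Lemma vertF_bilin : bilin vertF.
Proof. have ql := q1_linear; rewrite /vertF; lin. Qed.
Lemma vert_linear : linear vert.
Proof.
apply: lin_opp; apply: (lin_comp (tlift_linear vertF_bilin)); exact: lin_of.
Qed.
HB.instance Definition _ := GRing.isLinear.Build K GH (tens X H) *:%R vert vert_linear.

Lemma vert_inc a : vert (inc a) = 0.
Proof.
rewrite /vert (delta_inc (ds_deltaP G)) tlift_tmap //; [|exact: vertF_bilin].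
rewrite /tlift big1 ?oppr0 // => p _; rewrite /vertF /sw /tlift big1 // => p' _.
by rewrite -smul_rmorph q1_inc tpure0l.
Qed.

Lemma vert_d_inc h : vert (dg_d GH (inc h)) = - sw (fun a b => q1 (eta GH s a) \ot b) h.
Proof.
have ql := q1_linear; have dl : linear (fun a => dg_d GH (inc a)).
  exact: (lin_comp (lin_of (dg_d GH)) (alghom_linear _)).
rewrite /vert (delta_d_inc (ds_deltaP G)) tlift_tmap //; [|exact: vertF_bilin]; congr (- _).
pose F (a b c : H) := q1 (smul s (inc (Ss s b)) (dg_d GH (inc a))) \ot c.
transitivity (sw (fun a x => sw (F a) x) h); first by [].
rewrite -(sw_coassoc (F := F)).
  apply: eq_sw => a c; rewrite /eta (lin_swE _ _ ql).
  by rewrite (lin_swE _ _ (tpure_linl c)).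
rewrite /F; lin.
Qed.

(** For s = true, S^-1(a_2 v_1) a_1 v_0 (x) a_3 v_2 = S^-1(v_1) v_0 (x) a v_2, since the legs of a
    cancel. As [vert] is defined by the coaction rather than by a presentation of v as a sum of a
    dh, it is well defined from the start. *)
Lemma vert_smul a v : vert (smul s (inc a) v) = tmap idfun (smul s a) (vert v).
Proof.
have ql := q1_linear; have sl := smul_lin2 s a.
have il : linear inc := alghom_linear _.
have tl : linear (tmap (@idfun X) (smul s a)) by exact: tmap_linear.
rewrite /vert (linN _ tl); congr (- _).
have -> : delta (smul s (inc a) v) =
    smul s (tmap inc idfun (coprod H a) : talg GH H) (delta v).
  rewrite -(delta_inc (ds_deltaP G)).
  by case: (s); rewrite /smul (deltaM (@ds_GH_calc _ _ _ _ G) (ds_deltaP G)).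
rewrite (tlift_smul _ _ _ vertF_bilin) tlift_exchange (lin_tliftE _ _ tl).
apply: eq_tlift => v0 x.
have vB := vertF_bilin.
rewrite tlift_tmap //; last first.
  by split=> z; [apply: (lin_comp (vB.1 _)); exact: smul_lin1|
                 apply: (lin_comp (vB.2 _)); exact: smul_lin1].
transitivity (sw (fun b c => sw (fun a1 a' => sw (fun a2 a3 =>
    q1 (smul s (inc (Ss s b)) (smul s (inc (smul s (Ss s a2) a1)) v0)) \ot smul s a3 c)
    a') a) x).
  rewrite [RHS]sw_exchange; apply: eq_sw => a1 a'.
  rewrite /vertF sw_smul; last by lin.
  rewrite [RHS]sw_exchange; apply: eq_sw => a2 a3; apply: eq_sw => b c.
  by rewrite santipode_smul.
rewrite /vertF (lin_swE _ _ tl); apply: eq_sw => b c.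
rewrite tmap_pure //.
pose F z := q1 (smul s (inc (Ss s b)) (smul s (inc z) v0)).
have Fl : linear F by rewrite /F; lin.
rewrite -(sw_coassoc (F := fun a1 a2 a3 => F (smul s (Ss s a2) a1) \ot smul s a3 c)); last by lin.
have gl : linear (fun a3 : H => F 1 \ot smul s a3 c) by lin.
transitivity (sw (fun e a3 => (counit H e : K) *: (F 1 \ot smul s a3 c)) a).
  apply: eq_sw => e a3.
  have Fl' : linear (fun z => F z \ot smul s a3 c) by lin.
  exact: (sw_scale Fl' (sw_santipode s e)).
rewrite (sw_counitl a gl) /F rmorph1 smul1 //.
Qed.

Lemma coH_vert v : coH (vert v) = tmap vert idfun (delta v).
Proof.
have cl := @coH_linear _ H X; have ql := q1_linear; have vl := vert_linear.
rewrite /vert (linN _ cl).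
transitivity (- tlift (fun w z => tlift (fun v0 x =>
    sw (fun b c => (q1 (smul s (inc (Ss s b)) v0) \ot c) \ot z) x) (delta w)) (delta v)).
  congr (- _); rewrite (lin_tliftE _ _ cl).
  rewrite (delta_coassoc (F := fun v0 x z =>
     sw (fun b c => (q1 (smul s (inc (Ss s b)) v0) \ot c) \ot z) x)); last by lin.
  apply: eq_tlift => v0 x; rewrite /vertF (lin_swE _ _ cl).
  rewrite (sw_coassoc (F := fun b c z => (q1 (smul s (inc (Ss s b)) v0) \ot c) \ot z)); last by lin.
  by apply: eq_sw => b c; rewrite coH_pure.
have ol : linear (fun x : tens (tens X H) H => - x) by lin.
apply: (etrans (lin_tliftE _ _ ol)); rewrite /tmap; apply: eq_tlift => w z.
rewrite (bilinNl (@tpure_bilin _ _ _)) (lin_tliftE _ _ (tpure_linl z)); congr (- _).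
by apply: eq_tlift => v0 x; rewrite /vertF (lin_swE _ _ (tpure_linl z)).
Qed.

Lemma vert_deg v : tmap (dg_pr X 1) idfun (vert v) = vert v.
Proof.
have tl : linear (tmap (dg_pr X 1) (@idfun H)) by exact: tmap_linear.
rewrite /vert (linN _ tl) (lin_tliftE _ _ tl); congr (- _); apply: eq_tlift => v0 x.
rewrite /vertF (lin_swE _ _ tl); apply: eq_sw => b c.
by rewrite tmap_pure // /q1 [dg_pr _ _ _]homog_pr.
Qed.

(** In degree one there are two cases, and no sign arises: for v in H the form u (x) v is kept, and
    for u in B_i with v a one-form, u multiplies the value of [vert]. *)
Definition conF (u : X) (v : GH) : tens X H := u \ot dg_res v + tmap (smul s u) idfun (vert v).
Definition con (x : locP G i) : tens X H := tlift conF x.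

Lemma conF_bilin : bilin conF.
Proof.
have rl : linear (@dg_res _ _ GH) := lin_of _; have vl := vert_linear.
apply: bilin_add; first by lin.
split=> [v|u].
  by apply: lin_tmapl => //; move=> u; exact: smul_lin1.
by apply: lin_tmap => //; exact: smul_lin2.
Qed.
Lemma con_linear : linear con.
Proof. exact: tlift_linear conF_bilin. Qed.
HB.instance Definition _ :=
  GRing.isLinear.Build K (locP G i) (tens X H) *:%R con con_linear.
Lemma con_pure u v : con (u \ot v) = conF u v.
Proof. by rewrite /con tlift_pure //; exact: conF_bilin. Qed.

Lemma con_emb y : con (emb y) = y.
Proof.
move: y; apply: tens_ext => [||u h] //; first exact: (lin_comp con_linear (@emb_lin _ _ _ _ G i)).
by rewrite emb_pure con_pure /conF vert_inc (lin0 (tmap_linear (smul_lin2 s u) (@lin_id _ H))) addr0 dg_incK.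
Qed.

Lemma con_homog x : homog 1 x -> homog 1 (emb (con x)).
Proof.
move=> hx; rewrite /homog pr_emb -{}hx; congr emb.
have tl : linear (tmap (dg_pr X 1) (@idfun H)) by exact: tmap_linear.
have pl : linear (dg_pr (locP G i) 1) := lin_of _.
have cl := con_linear.
elim/gt_ind: x => [|x y hx hy|m n u v hu hv].
- by rewrite (lin0 pl) (lin0 cl) (lin0 tl).
- by rewrite (linD pl) (linD cl) (linD tl) hx hy.
rewrite [dg_pr _ _ _](gpr_homog 1 hu hv); case: eqP => [|_]; last by rewrite (lin0 cl) (lin0 tl).
rewrite con_pure /conF; case: m hu => [|[|m]] hu; rewrite ?addSn ?add0n // => e.
  rewrite -e in hv; rewrite (res_homogS hv) tpure0r add0r.
  rewrite -[in LHS]vert_deg (tmap_tmap _ (smul_lin2 s u) (@lin_id _ H) (lin_of _) (@lin_id _ H)).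
  rewrite (tmap_tmap _ (lin_of _) (@lin_id _ H) (lin_comp (smul_lin2 s u) (lin_of _)) (@lin_id _ H)).
  rewrite -[in RHS]vert_deg (tmap_tmap _ (smul_lin2 s u) (@lin_id _ H) (lin_of _) (@lin_id _ H)).
  apply: eq_tmap => // w; have hw := homog_pr 1 w.
  by case: (s); rewrite /smul; [exact: (homogM hu hw)|exact: (homogM hw hu)].
have {e} n0 : n = 0%N by case: e.
rewrite n0 in hv; have [h <-] := homog0P hv.
rewrite vert_inc (lin0 (tmap_linear (smul_lin2 s u) (@lin_id _ H))) addr0.
by rewrite tmap_pure // hu.
Qed.

Lemma con_smul b a x : emb (con (smul s ((dg_inc X b \ot inc a) : locP G i) x)) =
  smul s ((dg_inc X b \ot inc a) : locP G i) (emb (con x)).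
Proof.
have cl := con_linear; have el := @emb_lin _ _ _ _ G i.
move: x; apply: tens_ext => [||u v].
- exact: (lin_comp el (lin_comp cl (smul_lin2 s _))).
- exact: (lin_comp (smul_lin2 s _) (lin_comp el cl)).
have E u' v' : smul s ((dg_inc X b \ot inc a) : locP G i) (u' \ot v') =
    smul s (dg_inc X b) u' \ot smul s (inc a) v'.
  by case: (s); rewrite /smul ?gmul_incl ?gmul_incr.
rewrite E !con_pure /conF !(linD el) (linD (smul_lin2 s _)); congr (_ + _).
  rewrite !emb_pure E; congr (_ \ot _); rewrite !dg_resE.
  by rewrite pr_smul_inc.
rewrite vert_smul; have vl := vert_linear.
have tl : linear (tmap (@idfun X) (smul s a)) by apply: tmap_linear => //; exact: smul_lin2.
move: (vert v); apply: tens_ext => [||w h].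
- by apply: (lin_comp el); apply: (lin_comp _ tl); apply: tmap_linear => //; exact: smul_lin2.
- apply: (lin_comp (smul_lin2 s _)); apply: (lin_comp el).
  by apply: tmap_linear => //; exact: smul_lin2.
rewrite (tmap_pure _ _ (@lin_id _ X) (smul_lin2 s a)).
rewrite !(tmap_pure _ _ (smul_lin2 s _) (@lin_id _ H)) !emb_pure E smulA.
by rewrite smul_rmorph.
Qed.

Lemma coP_con x : coP (emb (con x)) = tmap (fun y => emb (con y)) idfun (coP x).
Proof.
have cl := con_linear; have el := @emb_lin _ _ _ _ G i; have vl := vert_linear.
have ecl : linear (fun y => emb (con y)) := lin_comp el cl.
have cPl := @coP_linear _ _ _ _ G i; have rl : linear (@dg_res _ _ GH) := lin_of _.
move: x; apply: tens_ext => [||u v].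
- exact: (lin_comp cPl ecl).
- by apply: (lin_comp _ cPl); exact: tmap_linear.
have ul : linear (fun w => u \ot w : locP G i) := tpure_linr u.
rewrite coP_pure (tmap_tmap _ ecl (@lin_id _ H) ul (@lin_id _ H)) coP_emb con_pure.
have cul : linear (conF u) := conF_bilin.2 u.
transitivity (tmap emb idfun (tmap (conF u) idfun (delta v))); last first.
  rewrite (tmap_tmap _ el (@lin_id _ H) cul (@lin_id _ H)).
  by apply: eq_tmap => // w; rewrite con_pure.
congr (tmap _ _ _); rewrite {1}/conF (linD (@coH_linear _ H X)).
have sl := smul_lin2 s u.
rewrite (tmap_coH _ sl) coH_vert (tmap_tmap _ (tmap_linear sl (@lin_id _ H)) (@lin_id _ H) vl (@lin_id _ H)).
have -> : coH (u \ot dg_res v) = tmap (fun w => u \ot dg_res w) idfun (delta v).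
  rewrite -(tmap_tmap _ (tpure_linr u) (@lin_id _ H) rl (@lin_id _ H)) -coprod_res.
  exact: coH_pure.
rewrite /tmap tlift_add; apply: eq_tlift => w h.
by rewrite -(bilinDl (@tpure_bilin _ _ _)).
Qed.

(** When [q1] o eta = A, this is the local covariant derivative of b (x) h from [emb_covF], so both
    operators agree on P. *)
Lemma con_d b h : emb (con (dg_d (locP G i) ((dg_inc X b \ot inc h) : locP G i))) =
  dg_d X (dg_inc X b) \ot inc h -
  sw (fun a c => smul s (dg_inc X b) (q1 (eta GH s a)) \ot inc c) h :> locP G i.
Proof.
have cl := con_linear; have el := @emb_lin _ _ _ _ G i; have ql := q1_linear.
have tl (u : X) : linear (tmap (smul s u) (@idfun H)) := tmap_linear (smul_lin2 s u) (@lin_id _ H).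
rewrite d_pure (linD cl) !con_pure /conF vert_inc (lin0 (tl _)) addr0 dg_incK.
rewrite (res_homogS (d_inc_homog GH h)) tpure0r add0r vert_d_inc.
rewrite (linN _ (tl _)) (linB _ _ el) emb_pure; congr (_ - _).
rewrite (lin_swE _ _ (tl _)) (lin_swE _ _ el); apply: eq_sw => a c.
by rewrite (tmap_pure _ _ (smul_lin2 s _) (@lin_id _ H)) emb_pure.
Qed.

End LocalConnection.

(** * The correspondence *)

(** The linearity proofs packed with the functions are propositions, hence equal. *)
Lemma linear_ext (K : fieldType) (V W : lmodType K) (f g : {linear V -> W}) : f =1 g -> f = g.
Proof.
case: f => f [[c1] [c2]]; case: g => g [[c1'] [c2']] /= /funext e.
move: c1 c2 c1' c2'; rewrite e => c1 c2 c1' c2'.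
by rewrite (Prop_irrelevance c1 c1') (Prop_irrelevance c2 c2').
Qed.

Section Correspondence.
Variables (K : fieldType) (H : hopfAlg K) (I : finType) (Q : qpfb H I).
Variable G : diffStr Q.
Variable s : bool.
Local Notation GH := (ds_GH G).
Local Notation GB := (ds_GB G).
Implicit Types (i j : I).

Definition is_sconn (h : {linear subsp (GcP1 G) -> subsp (horP1 G)}) : Prop :=
  if s then is_lconn h else is_rconn h.

Lemma is_sconnP h : is_sconn h <-> is_conn_projection h /\
  forall p x i, subsp_val (h (sact s p x)) i =
    smul s (embP G p i : locP G i) (subsp_val (h x) i).
Proof.
rewrite /is_sconn /sact; case: s; split=> -[hP hM]; split=> // p x.
- by move=> i; rewrite hM.
- by apply: dprodP => i; rewrite hM.
- by move=> i; rewrite hM.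
by apply: dprodP => i; rewrite hM.
Qed.

Lemma smul_GcP x y : GcP G x -> GcP G y ->
  GcP G (fun i => smul s (x i : locP G i) (y i)).
Proof. by case: s => hx hy; exact: GcPM. Qed.

Lemma toHor_linear : linear (toHor G).
Proof.
move=> a x y; apply: subsp_eq; rewrite [RHS]subsp_val_linear; apply: dprodP => i.
by rewrite /= /embP !linearP.
Qed.

Lemma toGcP1_linear : linear (toGcP1 G).
Proof.
move=> a x y; apply: subsp_eq; rewrite [RHS]subsp_val_linear; apply: dprodP => i.
rewrite /= /locPs_d /embP; have l1 := alghom_linear (dg_inc (locP G i)).
by rewrite (alghom_linear (qchi Q i)) l1 (lin_of (dg_d (locP G i))).
Qed.

Lemma chiGc_linear (W : submod (locPs G)) i : linear (@chiGc _ _ _ _ _ W i).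
Proof. by []. Qed.

Lemma toHor_coact p : coact_eq (toHor G p) (tmap (toHor G) idfun (qcoact Q p)).
Proof.
move=> i; rewrite (tmap_tmap _ (@chiGc_linear _ i) (@lin_id _ H) toHor_linear (@lin_id _ H)).
by rewrite [RHS]coP_chi.
Qed.

Lemma toGcP1_coact p : coact_eq (toGcP1 G p) (tmap (toGcP1 G) idfun (qcoact Q p)).
Proof.
move=> i; rewrite (tmap_tmap _ (@chiGc_linear _ i) (@lin_id _ H) toGcP1_linear (@lin_id _ H)).
by rewrite [RHS]coP_d_chi.
Qed.

Lemma embP_smul p p' i : embP G (smul s p p') i = smul s (embP G p i : locP G i) (embP G p' i).
Proof. by case: s; rewrite /embP /smul !rmorphM. Qed.

Lemma embP_iota b : embP G (qiota Q b) =
  iotaGc (fun i => ic_map (ds_B G) i (dg_inc (ds_B G) b)).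
Proof.
apply: dprodP => i; rewrite /iotaGc; have [-> _ _] := ic_mapP (ds_B G) i.
by rewrite (embP_pure G (qchi_iota i b)) rmorph1.
Qed.

Lemma covder_preconnection D : is_scovder s D ->
  preconnection s (fun p => subsp_val (D (toHor G p))).
Proof.
move=> hD; have Dc : is_covder D by move: hD; rewrite /is_scovder; case: s => -[].
have Dl := lin_of D.
split.
- by move=> a x y; rewrite toHor_linear Dl subsp_val_linear.
- by move=> p; exact: subspP.
- by move=> p; apply: (covder_deg Dc (n := 0)); exact: embP_deg.
- by rewrite (covder_one Dc) linear0.
- move=> p i; rewrite -(covder_covariant Dc (toHor_coact p)).
  rewrite (tmap_tmap _ Dl (@lin_id _ H) toHor_linear (@lin_id _ H)).
  by rewrite (tmap_tmap _ (@chiGc_linear _ i) (@lin_id _ H) (lin_comp Dl toHor_linear) (@lin_id _ H)).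
- by move=> p i p0; apply: (covder_ker Dc); rewrite /chiGc /= /embP p0 linear0.
move=> b p i; pose g := base_form (G := G) (dg_inc (ds_B G) b).
have hg k : homog 0 (subsp_val g k : GB k).
  by rewrite /=; have [-> _ _] := ic_mapP (ds_B G) k; exact: homog_inc.
have -> : toHor G (smul s (qiota Q b) p) = hor_smul s g (toHor G p).
  apply: subsp_eq; apply: dprodP => k.
  by rewrite hor_smulE /= embP_smul embP_iota.
rewrite !embP_iota; move: hD; rewrite /is_scovder /hor_smul; case: s => -[_ hD].
  by rewrite (hD 0 g _ hg) expr0 scale1r.
have -> := hD 0 g (toHor G p) (embP_deg G p).
by rewrite expr0 scale1r addrC.
Qed.

Lemma conn_horizontal h (y : subsp (horP1 G)) : is_conn_projection h ->
  h (horP1_incl y) = y.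
Proof.
by move=> hc; have [x <-] := conn_surj hc y; exact: (conn_idem hc).
Qed.

Lemma conn_preconnection h : is_sconn h ->
  preconnection s (fun p => subsp_val (h (toGcP1 G p))).
Proof.
move=> /is_sconnP [hc hM]; have hl := lin_of h.
split.
- by move=> a x y; rewrite toGcP1_linear hl subsp_val_linear.
- by move=> p; have [] := subspP (h (toGcP1 G p)).
- by move=> p; have [] := subspP (h (toGcP1 G p)).
- have -> : toGcP1 G 1 = 0.
    apply: subsp_eq; apply: dprodP => i; rewrite d_embP /embP !rmorph1.
    by rewrite (dg_d1 (locP G i)).
  by rewrite !linear0.
- move=> p i; rewrite -(conn_covariant hc (toGcP1_coact p)).
  rewrite (tmap_tmap _ hl (@lin_id _ H) toGcP1_linear (@lin_id _ H)).
  by rewrite (tmap_tmap _ (@chiGc_linear _ i) (@lin_id _ H) (lin_comp hl toGcP1_linear) (@lin_id _ H)).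
- move=> p i p0; apply: (conn_ker hc); rewrite /chiGc d_embP /embP p0.
  by rewrite (lin0 (alghom_linear _)) linear0.
move=> b p i.
(* In the left case d(iota(b) p) contains the horizontal term (d iota(b)) p, which h fixes;
   P-linearity treats the other term. The right case is the mirror image. *)
pose y : locPs G := fun k => smul s (dg_d (locP G k) (embP G (qiota Q b) k)) (embP G p k).
have yh : horP1 G y.
  have dE k : dg_d (locP G k) (embP G (qiota Q b) k) =
      dg_d (GB k) (ic_map (ds_B G) k (dg_inc (ds_B G) b)) \ot (1 : GH) :> locP G k.
    by rewrite embP_iota -emb1_d.
  split; [split|].
  - apply: smul_GcP; last exact: embP_GcP.
    exact: (GcP_d (embP_GcP G (qiota Q b))).
  - move=> k; rewrite /y dE -emb_chiH.
    by case: s; rewrite /smul ?emb_mull ?emb_mulr; eexists.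
  move=> k; have h1 : homog 1 (dg_d (locP G k) (embP G (qiota Q b) k)).
    by apply: homog_d; exact: embP_deg.
  have h0 := embP_deg G p k; rewrite /y; case: s; rewrite /smul.
    exact: (homogM h1 h0).
  exact: (homogM h0 h1).
have -> : toGcP1 G (smul s (qiota Q b) p) =
    horP1_incl (subsp_of yh) + sact s (qiota Q b) (toGcP1 G p).
  apply: subsp_eq; rewrite [RHS]raddfD; apply: dprodP => k.
  rewrite -[RHS]/(y k + subsp_val (sact s (qiota Q b) (toGcP1 G p)) k) sactE !d_embP.
  rewrite embP_smul /y; case: s; rewrite /smul.
    by rewrite (dg_leibniz _ (embP_deg G (qiota Q b) k)) expr0 scale1r.
  by rewrite (dg_leibniz _ (embP_deg G p k)) expr0 scale1r addrC.
by rewrite raddfD /= conn_horizontal // -hM.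
Qed.

(** In each chart x agrees with a sum of products of base forms and elements of P, where the Leibniz
    rule determines D; kernel preservation carries this over to x. *)
Lemma scovder_unique D D' : is_scovder s D -> is_scovder s D' ->
  (forall p, subsp_val (D (toHor G p)) = subsp_val (D' (toHor G p))) -> D = D'.
Proof.
move=> hD hD' e; apply: linear_ext => x; apply: subsp_eq; apply: dprodP => i.
have Dc : is_covder D by move: hD; rewrite /is_scovder; case: s => -[].
have Dc' : is_covder D' by move: hD'; rewrite /is_scovder; case: s => -[].
have [] := @hor_lift _ _ _ _ G s (fun z => D z = D' z) _ _ _ i (hor_ret (subsp_val x i : locP G i)).
- by rewrite !linear0.
- by move=> y z hy hz; rewrite !raddfD /= hy hz.
- move=> n w p hw; apply: subsp_eq; move: hD hD'; rewrite /is_scovder /hor_smul.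
  have hg k : homog n (subsp_val (base_form w) k : GB k).
    by have [_ m2 _] := ic_mapP (ds_B G) k; rewrite /= /homog -m2 hw.
  case: s => -[_ hD] [_ hD'].
    by rewrite (hD _ _ _ hg) (hD' _ _ _ hg) e.
  have -> := hD 0 (base_form w) (toHor G p) (embP_deg G p).
  by have -> := hD' 0 (base_form w) (toHor G p) (embP_deg G p); rewrite e.
move=> z zE zi; have x0 : chiGc i (x - z) = 0.
  rewrite -[LHS]/(chiGc i (x - z)) (linB _ _ (@chiGc_linear (horP G) i)) zi hor_retK ?subrr //.
  by have [] := subspP x.
have := covder_ker Dc x0; have := covder_ker Dc' x0.
rewrite (linB _ _ (lin_of D)) (linB _ _ (lin_of D')) !(linB _ _ (@chiGc_linear (horP G) i)).
by move=> /eqP; rewrite subr_eq0 => /eqP e1 /eqP; rewrite subr_eq0 => /eqP e2;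
  rewrite -[LHS]/(chiGc i (D x)) -[RHS]/(chiGc i (D' x)) e1 e2 zE.
Qed.

(** In each chart x agrees with a sum of forms p dp', or (dp') p in the right case, where
    P-linearity determines h; kernel preservation does the rest. *)
Lemma sconn_unique h h' : is_sconn h -> is_sconn h' ->
  (forall p, subsp_val (h (toGcP1 G p)) = subsp_val (h' (toGcP1 G p))) -> h = h'.
Proof.
move=> /is_sconnP [hc hM] /is_sconnP [hc' hM'] e.
apply: linear_ext => x; apply: subsp_eq; apply: dprodP => i.
have dx : homog 1 (subsp_val x i : locP G i) by have [_ h1] := subspP x; exact: h1.
have [] := @one_form_lift _ _ _ _ G s (fun z => h z = h' z) _ _ _ i _ dx.
- by rewrite !linear0.
- by move=> y z hy hz; rewrite !raddfD /= hy hz.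
- by move=> p p'; apply: subsp_eq; apply: dprodP => k; rewrite hM hM' e.
move=> z zE zi; have x0 : chiGc i (x - z) = 0.
  by rewrite (linB _ _ (@chiGc_linear (GcP1 G) i)) zi subrr.
have := conn_ker hc x0; have := conn_ker hc' x0.
rewrite (linB _ _ (lin_of h)) (linB _ _ (lin_of h')) !(linB _ _ (@chiGc_linear (horP1 G) i)).
by move=> /eqP; rewrite subr_eq0 => /eqP e1 /eqP; rewrite subr_eq0 => /eqP e2;
  rewrite -[LHS]/(chiGc i (h x)) -[RHS]/(chiGc i (h' x)) e1 e2 zE.
Qed.

End Correspondence.

(** * Vanishing on R and extension to connections *)

Section Vanishing.
Variables (K : fieldType) (H : hopfAlg K) (I : finType) (Q : qpfb H I).
Variable G : diffStr Q.
Variable s : bool.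
Local Notation GH := (ds_GH G).
Local Notation GB := (ds_GB G).
Local Notation Ss := (santipode H s).
Implicit Types (i j : I).

Variables (dl : qP Q -> locPs G) (A : forall i, {linear H -> GB i}).
Hypothesis dlP : preconnection s dl.
Hypothesis A1 : forall i h, homog 1 (A i h).
Hypothesis dlE : forall i p, dl p i = hor_emb (covD s (A i) (chiH G i p)).

Lemma potential_pure i p h : qchi Q i p = (1 : qalg (qJ Q i)) \ot h ->
  dl p i = - sw (fun a b => A i a \ot dg_inc GH b : locP G i) h.
Proof.
move=> pE; have el := @emb_lin _ _ _ _ G i.
rewrite dlE (chiH_pure G pE) rmorph1 covD_one (linN _ el) (lin_swE _ _ el); congr (- _).
by apply: eq_sw => a b; rewrite emb_pure.
Qed.

Lemma tensor_one_inj i (g : GB i) : g \ot (1 : GH) = 0 :> locP G i -> g = 0.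
Proof.
move=> g0; have el : linear (fun x : H => counit H x : K^o) := lin_of (counit H).
have Fl : linear (tlift (fun (w : GB i) (k : H) => (counit H k : K) *: w)) by lin.
have : hor_emb (G := G) (g \ot (1 : H)) = 0 by rewrite emb_pure rmorph1.
move/(congr1 (@hor_ret _ _ _ _ G i)); rewrite hor_embK linear0.
move/(congr1 (tlift (fun (w : GB i) (k : H) => (counit H k : K) *: w))).
rewrite (lin0 Fl) tlift_pure; last by lin.
by rewrite counit1 scale1r.
Qed.

Lemma potential_one i : A i 1 = 0.
Proof.
have := potential_pure (i := i) (rmorph1 (qchi Q i)).
rewrite (pre_one dlP) sw1; last by lin.
by move/esym/eqP; rewrite oppr_eq0 rmorph1 => /eqP; exact: tensor_one_inj.
Qed.

(** In the left case, let sigma(a) lift 1 (x) a. The form sigma(S^-1(r_2)) d sigma(r_1) has i-th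
    component 1 (x) eta(r) = 0, so its image under h vanishes at i. That image is - A_i(r_1) (x)
    S^-1(r_3) r_2 = - A_i(r) (x) 1. *)
Lemma conn_vanish h : is_sconn s h ->
  (forall p, subsp_val (h (toGcP1 G p)) = dl p) ->
  forall i r, eta GH s r = 0 -> A i r = 0.
Proof.
move=> /is_sconnP [hc hM] hE i r r0.
have [g gE] := generalized_inverse (alghom_linear (qchi Q i)).
pose sig (a : H) := g ((1 : qalg (qJ Q i)) \ot a).
have sigl : linear sig := lin_comp (lin_of g) (tpure_linr _).
have sigE a : qchi Q i (sig a) = (1 : qalg (qJ Q i)) \ot a.
  by have [p pE] := @qchi_surj _ _ _ Q i ((1 : qalg (qJ Q i)) \ot a); rewrite /sig -pE gE.
have sE a : embP G (sig a) i = (1 : GB i) \ot dg_inc GH a.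
  by rewrite (embP_pure G (sigE a)) rmorph1.
pose x := sw (fun a b => sact s (sig (Ss b)) (toGcP1 G (sig a))) r.
have chl W : linear (@chiGc _ _ _ _ G W i) by [].
have x0 : chiGc i x = 0.
  rewrite /x (lin_swE _ _ (@chl (GcP1 G))).
  transitivity ((1 : GB i) \ot eta GH s r : locP G i); last by rewrite r0 tpure0r.
  rewrite /eta (lin_swE _ _ (tpure_linr _)); apply: eq_sw => a b.
  rewrite /chiGc sactE d_embP !sE.
  have := @d_pure _ _ _ _ G i 1 a; rewrite rmorph1 (dg_d1 (GB i)) tpure0l add0r => ->.
  by case: s; rewrite /smul gmul_1r.
have := conn_ker hc x0; rewrite /x (lin_swE _ _ (lin_of h)) (lin_swE _ _ (@chl (horP1 G))) => e.
apply: tensor_one_inj; apply/eqP; rewrite -oppr_eq0 -{}e; apply/eqP.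
have ol : linear (fun x : locP G i => - x) by lin.
pose F (c e b : H) : locP G i := - (A i c \ot dg_inc GH (smul s (Ss b) e)).
have Ft : trilin F by rewrite /F; lin.
transitivity (sw (fun a b => sw (fun c e => F c e b) a) r).
  rewrite (sw_coassoc _ Ft).
  transitivity (sw (fun c e => (counit H e : K) *: - (A i c \ot (1 : GH) : locP G i)) r).
    have gl : linear (fun c : H => - (A i c \ot (1 : GH) : locP G i)) by lin.
    by rewrite (sw_counitr r gl).
  apply: eq_sw => c e.
  have gl : linear (fun z : H => - (A i c \ot dg_inc GH z : locP G i)) by lin.
  by have := sw_scale gl (sw_santipode s e); rewrite rmorph1 => <-.
apply: eq_sw => a b; rewrite /chiGc hM hE sE (potential_pure (sigE a)).
rewrite (linN _ (smul_lin2 s _)) (lin_swE _ _ (smul_lin2 s _)).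
apply: (etrans (esym (lin_swE _ _ ol))); congr (- _); apply: eq_sw => c e.
by rewrite smul_rmorph; case: s; rewrite /smul gmul_incl ?mul1r ?mulr1.
Qed.

(** A_i factors through the invariant forms, and the factor q defines the local projections [con].
    They glue first on forms coming from Gamma^1(P), then on all of Gamma_c^1(P). *)
Lemma conn_potential : (forall i r, counit H r = 0 -> eta GH s r = 0 -> A i r = 0) ->
  exists2 h, is_sconn s h & forall p, subsp_val (h (toGcP1 G p)) = dl p.
Proof.
move=> vanish.
(* Both eta and A_i vanish at 1, so r may be replaced by r - eps(r) 1, which lies in ker eps. *)
have eta_ker i r : eta GH s r = 0 -> A i r = 0.
  move=> r0; have el := eta_linear GH s.
  have e1 : eta GH s 1 = 0.
    rewrite /eta sw1; last by lin.
    by rewrite rmorph1 (dg_d1 GH) (lin0 (smul_lin2 s _)).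
  have al := lin_of (A i).
  rewrite -[r](subrK ((counit H r : K) *: (1 : H))) (linD al) (linZ _ _ al).
  rewrite potential_one scaler0 addr0.
  apply: vanish.
    rewrite (linB _ _ (lin_of (counit H))) (linZ _ _ (lin_of (counit H))) counit1.
    by rewrite /GRing.scale /= mulr1 subrr.
  by rewrite (linB _ _ el) (linZ _ _ el) r0 e1 scaler0 subrr.
have qex i : exists q : {linear GH -> GB i}, forall h, q (eta GH s h) = A i h.
  exact: (linear_descend (eta_linear GH s) (lin_of (A i)) (eta_ker i)).
pose q i := projT1 (cid (qex i)).
have qE i h : q1 (q i) (eta GH s h) = A i h.
  by rewrite /q1 (eta_homog GH s h) /q; case: cid => f /= ->; rewrite [LHS]A1.
pose L i (x : locP G i) : locP G i := hor_emb (con s (q i) x).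
have Ll i : linear (@L i) := lin_comp (@emb_lin _ _ _ _ G i) (@con_linear _ _ _ _ G i s (q i)).
pose hG (x : locPs G) : locPs G := fun i => L i (x i).
have hl : linear hG by move=> a x y; apply: dprodP => i; exact: Ll.
have L_smul i p x : L i (smul s (embP G p i : locP G i) x) = smul s (embP G p i : locP G i) (L i x).
  rewrite /embP; move: (qchi Q i p) => y.
  have il := alghom_linear (dg_inc (locP G i)).
  move: y; apply: tens_ext => [||b h].
  - exact: (lin_comp (Ll i) (lin_comp (smul_lin1 s x) il)).
  - exact: (lin_comp (smul_lin1 s _) il).
  by rewrite /= gincE; exact: con_smul.
have L_d i p : L i (dg_d (locP G i) (embP G p i)) = dl p i.
  rewrite dlE /embP /chiH; move: (qchi Q i p) => y.
  have il := alghom_linear (dg_inc (locP G i)).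
  move: y; apply: tens_ext => [||b h].
  - exact: (lin_comp (Ll i) (lin_comp (lin_of (dg_d (locP G i))) il)).
  - apply: (lin_comp (@emb_lin _ _ _ _ G i)); apply: (lin_comp (covD_linear s (A i))).
    exact: tmap_linear.
  rewrite /= gincE [LHS]con_d tmap_pure // covD_pure emb_covF.
  congr (_ - _); apply: eq_sw => a c; rewrite qE.
  by rewrite (stwist_homog s (homog_inc _ b)) expr0 if_same scale1r.
have hG_d p : hG (locPs_d (embP G p)) = dl p by apply: dprodP => i; exact: L_d.
have hG_smul p (x : locPs G) : hG (fun i => smul s (embP G p i : locP G i) (x i)) =
    fun i => smul s (embP G p i : locP G i) (hG x i).
  by apply: dprodP => i; exact: L_smul.
have dlG p : GcP G (dl p) by have [] := pre_hor dlP p.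
pose fm (w : ds_P G) : locPs G := fun i => ic_map (ds_P G) i w.
have fml : linear fm.
  by move=> a x y; apply: dprodP => i; exact: (alghom_linear (ic_map (ds_P G) i)).
(* One-forms on P are sums of a db, or (db) a in the right case, and the local maps send these to
   products of a with the compatible family [dl b]. *)
have hG_form w : homog 1 w -> GcP G (hG (fm w)).
  move: w; apply: (degree1_ind (@ic_calcP _ _ _ _ _ _ (ds_P G)) (s := s)).
  - by rewrite (lin0 fml) (lin0 hl); exact: GcP0.
  - by move=> x y hx hy; rewrite (linD fml) (linD hl); exact: GcPD.
  move=> a b.
  have -> : fm (smul s (dg_inc (ds_P G) a) (dg_d (ds_P G) (dg_inc (ds_P G) b))) =
    (fun i => smul s (embP G a i : locP G i) (locPs_d (embP G b) i)) :> locPs G.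
    apply: dprodP => i; have [m1 _ m3] := ic_mapP (ds_P G) i.
    by rewrite /fm smul_rmorph m1 m3 m1.
  rewrite hG_smul hG_d; apply: smul_GcP => //; exact: embP_GcP.
have hG_GcP (x : subsp (GcP1 G)) : GcP G (hG (subsp_val x)).
  move=> i j; have dx k : homog 1 (subsp_val x k : locP G k) by have [_] := subspP x; exact.
  have [] := @one_form_lift _ _ _ _ G s (fun z => GcP G (hG (subsp_val z))) _ _ _ i _ (dx i).
  - by rewrite linear0 (lin0 hl); exact: GcP0.
  - by move=> y z hy hz; rewrite raddfD (linD hl); exact: GcPD.
  - move=> p p'; have -> : subsp_val (sact s p (toGcP1 G p')) =
      (fun k => smul s (embP G p k : locP G k) (locPs_d (embP G p') k)) :> locPs G.
      by apply: dprodP => k; rewrite sactE.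
    rewrite hG_smul hG_d; apply: smul_GcP => //; exact: embP_GcP.
  move=> z zc zi; have [uc ud] := subspP (x - z).
  have ui : subsp_val (x - z) i = 0.
    have := @linB _ _ _ _ x z (@chiGc_linear _ _ _ _ G (GcP1 G) i).
    by rewrite zi subrr.
  have ru : ds_r G i j (subsp_val (x - z) j) = 0.
    have := uc i j; rewrite ui linear0 => e.
    by apply: (bij_inj (ds_phi_bij G i j)); rewrite -e linear0.
  (* Since x - z vanishes at i, its component at j is chi_j(w) with chi_i(w) = 0. Passing to the
     degree-one part of w makes [hG_form] applicable. *)
  have [_ _ rP] := ds_rP G i j; have [w wi wj] := (rP _).1 ru.
  pose w1 := dg_pr (ds_P G) 1 w.
  have [_ mi _] := ic_mapP (ds_P G) i; have [_ mj _] := ic_mapP (ds_P G) j.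
  have w1i : ic_map (ds_P G) i w1 = 0 by rewrite mi wi linear0.
  have w1j : ic_map (ds_P G) j w1 = subsp_val (x - z) j by rewrite mj wj; exact: ud.
  have := hG_form w1 (homog_pr 1 w) i j.
  rewrite /hG /fm w1i w1j (lin0 (Ll i)) linear0 => e.
  have := zc i j; rewrite /hG => ez.
  have Ex k : subsp_val x k = subsp_val (x - z) k + subsp_val z k.
    by rewrite -{1}(subrK z x) [subsp_val (_ + z)]raddfD.
  have Ei : L i (subsp_val x i) = L i (subsp_val z i) by rewrite Ex ui add0r.
  have Ej : L j (subsp_val x j) = L j (subsp_val (x - z) j) + L j (subsp_val z j).
    by rewrite Ex (linD (Ll j)).
  by rewrite Ei Ej raddfD /= raddfD /= -e add0r.
have hP (x : subsp (GcP1 G)) : horP1 G (hG (subsp_val x)).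
  split; first split=> //; first by move=> i; eexists.
  by move=> i; apply: con_homog; have [_] := subspP x; exact.
have Hl : linear (fun x : subsp (GcP1 G) => subsp_of (hP x) : subsp (horP1 G)).
  move=> a x y; apply: subsp_eq; rewrite [RHS]subsp_val_linear.
  by rewrite -[LHS]/(hG (subsp_val (a *: x + y))) subsp_val_linear hl.
pose h := mkLin Hl; exists h; last by move=> p; exact: hG_d.
have h_incl (y : subsp (horP1 G)) : h (horP1_incl y) = y.
  apply: subsp_eq; apply: dprodP => i; have [[_ /(_ i) [z zE]] _] := subspP y.
  by rewrite /= /hG /L -zE con_emb.
apply/is_sconnP; split; last first.
  move=> p x i; rewrite -[LHS]/(L i (subsp_val (sact s p x) i)) sactE L_smul //.
split.
- by move=> y; exists (horP1_incl y).
- by move=> x; exact: h_incl.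
- move=> x t xt i; have chl W : linear (@chiGc _ _ _ _ G W i) by [].
  rewrite (tmap_tmap _ (chl _) (@lin_id _ H) Hl (@lin_id _ H)).
  transitivity (tmap (L i) idfun (tmap (@chiGc _ _ _ _ _ (GcP1 G) i) idfun t)).
    by rewrite (tmap_tmap _ (Ll i) (@lin_id _ H) (chl _) (@lin_id _ H)).
  by rewrite xt; symmetry; exact: coP_con.
by move=> i x; rewrite /chiGc /= /hG => ->; exact: (lin0 (Ll i)).
Qed.

End Vanishing.

(** * The bijection *)

Section Bijection.
Variables (K : fieldType) (H : hopfAlg K) (I : finType) (Q : qpfb H I).
Variable G : diffStr Q.
Implicit Types (D : {linear subsp (horP G) -> subsp (horP G)})
  (h : {linear subsp (GcP1 G) -> subsp (horP1 G)}).

Definition sideal s : set H := [set r | counit H r = 0 /\ eta (ds_GH G) s r = 0].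

(** By [eta_antipode], r satisfies the right-handed conditions exactly when S(r) lies in R. *)
Lemma rcideal_right : [set antipodeV H r | r in rcideal G]%classic = sideal false.
Proof.
apply/seteqP; split=> [_ [r [r0 r1] <-]|r [r0 r1]].
  split; first by rewrite -counit_antipode antipodeVK.
  by apply: oppr_inj; rewrite -eta_antipode antipodeVK oppr0.
exists (antipode H r); last exact: antipodeK.
split; first by rewrite counit_antipode.
by rewrite [LHS](eta_antipode (ds_GH G) r) r1 oppr0.
Qed.

Lemma conn_covder s h : is_sconn s h -> exists D, [/\ is_scovder s D,
  maps_vanish_on D (sideal s) &
  forall p, subsp_val (D (toHor G p)) = subsp_val (h (toGcP1 G p))].
Proof.
move=> hc; have hP := conn_preconnection hc.
have [A [A1 AE]] := preconnection_potential hP.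
have [D [Dc DE DA]] := potential_covder hP A1 AE; exists D; split=> //.
exists A => // i r [_ r0]; by have v := conn_vanish AE hc (fun=> erefl); exact: v.
Qed.

Lemma covder_conn s D : is_scovder s D -> maps_vanish_on D (sideal s) ->
  exists2 h, is_sconn s h &
    forall p, subsp_val (h (toGcP1 G p)) = subsp_val (D (toHor G p)).
Proof.
move=> Dc [A' DA' A'0]; have DP := covder_preconnection Dc.
have [A [A1 AE]] := preconnection_potential DP.
apply: (conn_potential DP A1 AE) => i r r0 r1.
(* Any A' corresponding to D is the potential: [Di] is fixed on chi_i(P), in particular at 1 (x)
   r. *)
suff <- : A' i r = A i r by apply: A'0; split.
have [Di DiE ->] := DA' i.
have [p pE] := @qchi_surj _ _ _ Q i ((1 : qalg (qJ Q i)) \ot r).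
have pE' : chiH G i p = (1 : ds_GB G i) \ot r by rewrite (chiH_pure G pE) rmorph1.
rewrite -pE'; have := DiE (toHor G p) (chiH G i p) (emb_chiH G i p).
rewrite -[chiGc i (D _)]/(subsp_val (D (toHor G p)) i) AE => /hor_emb_inj ->.
by rewrite pE'; exact: covD_counit.
Qed.

Lemma conn_covder_bij s :
  exists Phi : {linear subsp (GcP1 G) -> subsp (horP1 G)} ->
               {linear subsp (horP G) -> subsp (horP G)},
    set_bij (is_sconn s) (fun D => is_scovder s D /\ maps_vanish_on D (sideal s)) Phi /\
    forall h, is_sconn s h ->
      forall p, subsp_val (Phi h (toHor G p)) = subsp_val (h (toGcP1 G p)).
Proof.
have ex h : exists D, is_sconn s h -> [/\ is_scovder s D, maps_vanish_on D (sideal s) &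
    forall p, subsp_val (D (toHor G p)) = subsp_val (h (toGcP1 G p))].
  have [hc|nhc] := pselect (is_sconn s h).
    by have [D DP] := conn_covder hc; exists D.
  (* Off the set of connections the value is arbitrary; the identity serves. *)
  by exists (mkLin (@lin_id _ _)).
pose Phi h := projT1 (cid (ex h)).
have PhiP h : is_sconn s h -> [/\ is_scovder s (Phi h), maps_vanish_on (Phi h) (sideal s) &
    forall p, subsp_val (Phi h (toHor G p)) = subsp_val (h (toGcP1 G p))].
  by rewrite /Phi; case: cid.
exists Phi; split; last by move=> h /PhiP [].
split.
- by move=> h /PhiP [].
- move=> h h' /set_mem hc /set_mem hc' e; apply: (sconn_unique hc hc') => p.
  by have [_ _ <-] := PhiP h hc; have [_ _ <-] := PhiP h' hc'; rewrite e.
move=> D [Dc D0]; have [h hc hE] := covder_conn Dc D0.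
exists h => //; have [Pc _ PE] := PhiP h hc.
by apply: (scovder_unique Pc Dc) => p; rewrite PE hE.
Qed.

End Bijection.

Theorem proposition12 (R : realType) (H : hopfAlg (complex R)) (I : finType)
    (Q : qpfb H I) (G : diffStr Q) :
  (exists Phi : {linear subsp (GcP1 G) -> subsp (horP1 G)} ->
                {linear subsp (horP G) -> subsp (horP G)},
     set_bij (fun h => is_lconn h)
       (fun D => is_lcovder D /\ maps_vanish_on D (rcideal G)) Phi /\
     forall h, is_lconn h ->
       forall p, subsp_val (Phi h (toHor G p)) = subsp_val (h (toGcP1 G p))) /\
  (exists Phi : {linear subsp (GcP1 G) -> subsp (horP1 G)} ->
                {linear subsp (horP G) -> subsp (horP G)},
     set_bij (fun h => is_rconn h)
       (fun D => is_rcovder D /\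
          maps_vanish_on D [set antipodeV H r | r in rcideal G]%classic) Phi /\
     forall h, is_rconn h ->
       forall p, subsp_val (Phi h (toHor G p)) = subsp_val (h (toGcP1 G p))).
Proof.
(* For s = true, [sideal] unfolds to [rcideal]. *)
split; first exact: (conn_covder_bij G true).
by rewrite rcideal_right; exact: (conn_covder_bij G false).
Qed.
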